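(* Let $A$ be a unital separable $C^*$-algebra and let $J\subset A$ be a closed ideal. Let $(\alpha,u):G\curvearrowright A$ be a cocycle action of a countable discrete group $G$, and let $(A_\flat)^\alpha$ be the fixed point subalgebra of $A_\flat$ for the $G$-action on $A_\flat$ induced by $\alpha$. Suppose that $(A_\flat)^\alpha$ contains a unital copy of the Cuntz algebra $\mathcal{O}_\infty$. Then for any continuous map $x:[0,1]\times[0,\infty)\to U(J)$ there exists a continuous map $y:[0,1]\times[0,\infty)\to U(J)$ such that $$y(0,t)=x(0,t),\quad y(1,t)=x(1,t),\quad \operatorname{Lip}(y(\cdot,t))<25\pi\qquad\forall t\in[0,\infty),$$ $$\limsup_{t\to\infty}\sup_{s\in[0,1]}\|[y(s,t),a]\|\le 243\limsup_{t\to\infty}\sup_{s\in[0,1]}\|[x(s,t),a]\|\qquad\forall a\in A,$$ and $$\limsup_{t\to\infty}\sup_{s\in[0,1]}\|\alpha_g(y(s,t))-y(s,t)\|\le 243\limsup_{t\to\infty}\sup_{s\in[0,1]}\|\alpha_g(x(s,t))-x(s,t)\|\qquad\forall g\in G.$$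
   Context: For this statement, $A^\flat=C^b([0,\infty),A)/C_0([0,\infty),A)$ and $A_\flat=A^\flat\cap A'$, where $A$ is embedded in $A^\flat$ as constant functions. For a closed ideal $J$ of a unital $C^*$-algebra $A$, $U(J)=\{u\in U(A): u-1\in J\}$ with the norm topology, where $U(A)$ is the unitary group of $A$. $\operatorname{Lip}(f)$ is the Lipschitz constant of a function $f$ on $[0,1]$ with respect to the norm. $[a,b]=ab-ba$. A cocycle action $(\alpha,u):G\curvearrowright A$ is a pair of maps $\alpha:G\to\operatorname{Aut}(A)$, $u:G\times G\to U(A)$ with $\alpha_g\circ\alpha_h=\operatorname{Ad}u(g,h)\circ\alpha_{gh}$, $u(g,h)u(gh,k)=\alpha_g(u(h,k))u(g,hk)$ (with the usual normalization at the neutral element). Since inner automorphisms by unitaries of $A$ act trivially on $A_\flat$, $\alpha$ induces a genuine $G$-action on $A_\flat$ (pointwise in $t$). *)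

(* Defs.v *)
From HB Require Import structures.
From mathcomp Require Import all_boot all_order all_algebra.
From mathcomp Require Import complex.
From mathcomp Require Import all_classical all_reals all_analysis.
From mathcomp Require Import ring.
Set Implicit Arguments. Unset Strict Implicit. Unset Printing Implicit Defensive.
Import Order.TTheory GRing.Theory Num.Theory numFieldNormedType.Exports.
Local Open Scope classical_set_scope.
Local Open Scope ring_scope.
Local Open Scope complex_scope.
Local Open Scope quotient_scope.

HB.mixin Record Algebra_hasStar (R : realType) A & GRing.Algebra R[i] A := {
  star : A -> A;
  starK : involutive star;
  starD : {morph star : x y / x + y};
  starZ : forall (c : R[i]) (x : A), star (c *: x) = c^*%C *: star x;
  starM : forall x y : A, star (x * y) = star y * star x
}.

#[short(type="starAlgType")]
HB.structure Definition StarAlgebra (R : realType) :=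
  {A of GRing.Algebra R[i] A & Algebra_hasStar R A}.

(* A nonzero unital C*-algebra. MathComp's number domains already join rings
   with norms, so Hierarchy Builder refuses a later join of algebras and normed
   modules; the product is therefore part of the mixin, and the algebra and star
   structures are derived from it below. Norms take their values in R[i]. *)
HB.mixin Record CompleteNormedModule_isCStarAlgebra (R : realType) A
    & CompleteNormedModule R[i] A := {
  cs_one : A;
  cs_mul : A -> A -> A;
  cs_star : A -> A;
  cs_mulA : associative cs_mul;
  cs_mul1 : left_id cs_one cs_mul;
  cs_mulr1 : right_id cs_one cs_mul;
  cs_mulDl : left_distributive cs_mul +%R;
  cs_mulDr : right_distributive cs_mul +%R;
  cs_one_neq0 : cs_one != 0;
  cs_scaleAl : forall (c : R[i]) (x y : A), c *: cs_mul x y = cs_mul (c *: x) y;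
  cs_scaleAr : forall (c : R[i]) (x y : A), c *: cs_mul x y = cs_mul x (c *: y);
  cs_starK : involutive cs_star;
  cs_starD : {morph cs_star : x y / x + y};
  cs_starZ : forall (c : R[i]) (x : A), cs_star (c *: x) = c^*%C *: cs_star x;
  cs_starM : forall x y : A, cs_star (cs_mul x y) = cs_mul (cs_star y) (cs_star x);
  cs_normM : forall x y : A, `|cs_mul x y| <= `|x| * `|y|;
  cs_norm_star : forall x : A, `|cs_mul (cs_star x) x| = `|x| ^+ 2
}.

#[short(type="cstarAlgType")]
HB.structure Definition CStarAlgebra (R : realType) :=
  {A of CompleteNormedModule R[i] A & CompleteNormedModule_isCStarAlgebra R A}.

#[non_forgetful_inheritance]
HB.instance Definition _ (R : realType) (A : cstarAlgType R) :=
  GRing.Zmodule_isNzRing.Build A (@cs_mulA R A) cs_mul1 cs_mulr1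
    cs_mulDl cs_mulDr cs_one_neq0.
#[non_forgetful_inheritance]
HB.instance Definition _ (R : realType) (A : cstarAlgType R) :=
  GRing.Lmodule_isLalgebra.Build R[i] A (@cs_scaleAl R A).
#[non_forgetful_inheritance]
HB.instance Definition _ (R : realType) (A : cstarAlgType R) :=
  GRing.Lalgebra_isAlgebra.Build R[i] A (@cs_scaleAr R A).
#[non_forgetful_inheritance]
HB.instance Definition _ (R : realType) (A : cstarAlgType R) :=
  Algebra_hasStar.Build R A (@cs_starK R A) cs_starD cs_starZ cs_starM.


Section StarTheory.
Variables (R : realType) (B : starAlgType R).
Implicit Types x y : B.

Lemma star0 : star (0 : B) = 0.
Proof. by apply: (addrI (star 0)); rewrite -starD !addr0. Qed.

Lemma starN x : star (- x) = - star x.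
Proof. by apply: (addrI (star x)); rewrite -starD !subrr star0. Qed.

Lemma starB x y : star (x - y) = star x - star y.
Proof. by rewrite starD starN. Qed.

Lemma star1 : star (1 : B) = 1.
Proof. by rewrite -[LHS]mulr1 -[X in _ * X](starK 1) -starM mulr1 starK. Qed.

End StarTheory.

Section CStarTheory.
Variables (R : realType) (A : cstarAlgType R).
Implicit Types x y : A.

Lemma cstar_normM x y : `|x * y| <= `|x| * `|y|.
Proof. exact: cs_normM. Qed.

Lemma cstar_norm_star x : `|star x * x| = `|x| ^+ 2.
Proof. exact: cs_norm_star. Qed.

Lemma norm_star x : `|star x| = `|x|.
Proof.
suff le y : `|y| <= `|star y|.
  by apply/eqP; rewrite eq_le le andbT -[X in _ <= `|X|](starK x) le.
have [->|y0] := eqVneq y 0; first by rewrite normr0.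
rewrite -(@ler_pM2r _ `|y|) ?normr_gt0// -expr2 -cstar_norm_star.
exact: cstar_normM.
Qed.

Lemma cstar_norm1 : `|1 : A| = 1.
Proof.
have := cstar_norm_star (1 : A); rewrite star1 mulr1 expr2 => h.
have n0 : `|1 : A| != 0 by rewrite normr_eq0 oner_eq0.
by apply: (mulfI n0); rewrite mulr1 -h.
Qed.

Lemma star_continuous : continuous (star : A -> A).
Proof.
move=> x; apply/cvgrPdist_lt => e e0; near=> y.
by rewrite -starB norm_star; near: y; apply: cvgr_dist_lt.
Unshelve. all: by end_near. Qed.

Lemma mul_continuous : continuous (fun z : A * A => z.1 * z.2).
Proof.
move=> [x y]; apply/cvgrPdist_lt => e e0 /=.
have M0 : 0 < `|x| + `|y| + 1 by rewrite ltr_wpDl// addr_ge0.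
have d0 : 0 < e / 2 / (`|x| + `|y| + 1) by rewrite !divr_gt0.
have fx : z.1 @[z --> (x, y)] --> x by exact: cvg_fst.
have fy : z.2 @[z --> (x, y)] --> y by exact: cvg_snd.
near=> z => /=.
have -> : x * y - z.1 * z.2 = x * (y - z.2) + (x - z.1) * z.2.
  by rewrite mulrBr mulrBl addrA subrK.
rewrite (splitr e) (le_lt_trans (ler_normD _ _))// ltrD//.
  rewrite (le_lt_trans (cstar_normM _ _))//.
  rewrite (@le_lt_trans _ _ ((`|x| + `|y| + 1) * `|y - z.2|))//.
    by rewrite ler_wpM2r// -addrA lerDl addr_ge0.
  rewrite mulrC -ltr_pdivlMr//.
  by near: z; exact: (cvgr_dist_lt _ _ fy).
rewrite (le_lt_trans (cstar_normM _ _))//.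
rewrite (@le_lt_trans _ _ (`|x - z.1| * (`|x| + `|y| + 1)))//.
  rewrite ler_wpM2l//.
  have : `|y - z.2| < 1 by near: z; exact: (cvgr_dist_lt _ _ fy).
  move=> h; rewrite -[z.2](subKr y) (le_trans (ler_normB _ _))//.
  by rewrite lerD// ?lerDr// ltW.
rewrite -ltr_pdivlMr//.
by near: z; exact: (cvgr_dist_lt _ _ fx).
Unshelve. all: by end_near. Qed.

End CStarTheory.

Section StarHom.
Variable R : realType.

Definition star_hom (A B : starAlgType R) (f : A -> B) : Prop :=
  [/\ linear f, monoid_morphism f & {morph f : x / star x}].

Section Theory.
Variables (A B : starAlgType R) (f : A -> B).
Context (fH : star_hom f).

Lemma star_homZD (c : R[i]) x y : f (c *: x + y) = c *: f x + f y.
Proof. by have [+ _ _] := fH; exact. Qed.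

Lemma star_homD : {morph f : x y / x + y}.
Proof. by move=> x y; rewrite -[x]scale1r star_homZD !scale1r. Qed.

Lemma star_hom0 : f 0 = 0.
Proof. by apply: (addrI (f 0)); rewrite -star_homD !addr0. Qed.

Lemma star_homZ (c : R[i]) x : f (c *: x) = c *: f x.
Proof. by rewrite -[c *: x]addr0 star_homZD star_hom0 addr0. Qed.

Lemma star_homN : {morph f : x / - x}.
Proof. by move=> x; rewrite -scaleN1r star_homZ scaleN1r. Qed.

Lemma star_homB : {morph f : x y / x - y}.
Proof. by move=> x y; rewrite star_homD star_homN. Qed.

Lemma star_hom1 : f 1 = 1.
Proof. by have [_ [+ _] _] := fH. Qed.

Lemma star_homM : {morph f : x y / x * y}.
Proof. by have [_ [_ +] _] := fH. Qed.

Lemma star_hom_star : {morph f : x / star x}.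
Proof. by have [_ _ +] := fH. Qed.
End Theory.

Lemma cvg_cstarM (A : cstarAlgType R) T (F : set_system T) (FF : Filter F)
    (f g : T -> A) (a b : A) :
  f x @[x --> F] --> a -> g x @[x --> F] --> b ->
  f x * g x @[x --> F] --> a * b.
Proof.
move=> fa gb.
apply: (@continuous2_cvg _ _ _ _ _ _ f g (fun a b => a * b) a b _ fa gb).
exact: (@mul_continuous R A (a, b)).
Qed.

Lemma cvg_star (A : cstarAlgType R) T (F : set_system T) (FF : Filter F)
    (f : T -> A) (a : A) :
  f x @[x --> F] --> a -> star (f x) @[x --> F] --> (star a : A).
Proof. by move=> fa; apply: continuous_cvg => //; exact: star_continuous. Qed.

(* The fixed point y satisfies (1 - y)^2 = 1 - h^2. *)
Lemma cstar_sqrt_fixpoint (A : cstarAlgType R) (h : A) :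
  `|h| < 1 -> star h = h ->
  exists y : A, [/\ star y = y, y * h = h * y & y *+ 2 = h * h + y * y].
Proof.
move=> h1 sh.
have [q hq] : exists q : R, `|h| = q%:C.
  by exists (complex.Re `|h|); rewrite RRe_real// ger0_real.
have q0 : 0 <= q by rewrite -ler0c -hq.
have q1 : q < 1 by rewrite -ltcR -hq.
have cq0 : 0 <= q%:C by rewrite ler0c.
have u0 : 1 - q%:C != 0 by rewrite subr_eq0 eq_sym -hq lt_eqF.
have half2 : 2^-1 * q%:C + 2^-1 * q%:C = q%:C by rewrite -mulrDl -[2^-1]mul1r -splitr mul1r.
have nhalf (z : A) : `|2^-1 *: z| = 2^-1 * `|z|.
  by rewrite normrZ ger0_norm// invr_ge0.
pose g (z : A) : A := 2^-1 *: (h * h + z * z).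
pose y n := iter n g 0.
have yq n : `|y n| <= q%:C.
  elim: n => [|n ih]; first by rewrite normr0.
  rewrite /= nhalf (le_trans (ler_wpM2l _ (ler_normD _ _))) ?invr_ge0//.
  rewrite mulrDr -[leRHS]half2 lerD// ler_wpM2l ?invr_ge0//.
    rewrite (le_trans (cstar_normM _ _))// hq ler_piMr//.
    by rewrite -hq ltW.
  rewrite (le_trans (cstar_normM _ _))// (le_trans (ler_pM _ _ ih ih))//.
  by rewrite ler_piMr// -hq ltW.
have step n : `|y n.+1 - y n| <= q%:C ^+ n.
  elim: n => [|n ih].
    by rewrite subr0 expr0 (le_trans (yq 1))// -hq ltW.
  have -> : y n.+2 - y n.+1 =
    2^-1 *: (y n.+1 * (y n.+1 - y n) + (y n.+1 - y n) * y n).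
    rewrite [y n.+2]/= {1}[y n.+1]/= {2}/g -scalerBr; congr (_ *: _).
    by rewrite mulrBr mulrBl addrA subrK opprD addrACA subrr add0r.
  rewrite nhalf (le_trans (ler_wpM2l _ (ler_normD _ _))) ?invr_ge0//.
  have -> : q%:C ^+ n.+1 = 2^-1 * q%:C ^+ n.+1 + 2^-1 * q%:C ^+ n.+1.
    by rewrite exprS mulrA -mulrDl half2.
  rewrite mulrDr lerD// ler_wpM2l ?invr_ge0//.
    by rewrite (le_trans (cstar_normM _ _))// exprS ler_pM.
  by rewrite (le_trans (cstar_normM _ _))// exprSr ler_pM.
have tail n m : `|y n - y (n + m)%N| <= q%:C ^+ n * (1 - q%:C)^-1 * (1 - q%:C ^+ m).
  elim: m => [|m ih]; first by rewrite addn0 subrr normr0 expr0 subrr mulr0.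
  rewrite -(subrKA (y (n + m)%N)) (le_trans (ler_normD _ _))//.
  rewrite (le_trans (lerD ih (_ : _ <= q%:C ^+ (n + m))))//.
    by rewrite addnS distrC.
  by rewrite exprD exprS le_eqVlt; apply/orP; left; apply/eqP; field.
have cy : cvg (y n @[n --> \oo]).
  apply/cauchy_cvgP/cauchy_exP => e e0.
  have [e' ee] : exists e' : R, e = e'%:C.
    by exists (complex.Re e); rewrite RRe_real// gtr0_real.
  have e'0 : 0 < e' by rewrite -ltcR -ee.
  have d0 : 0 < e' * (1 - q) by rewrite mulr_gt0// subr_gt0.
  have qn : `|q| < 1 by rewrite ger0_norm.
  have /cvgrPdist_lt/(_ _ d0)[N _ HN] := cvg_expr qn.
  have qN : q%:C ^+ N * (1 - q%:C)^-1 < e.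
    have := HN N (leqnn N); rewrite sub0r normrN ger0_norm ?exprn_ge0// => h2.
    rewrite ltr_pdivrMr ?subr_gt0 -?hq// hq ee.
    by rewrite -(rmorph1 (real_complex R)) -rmorphB -rmorphXn -rmorphM /= ltcR.
  exists (y N); exists N => // n /= Nn.
  rewrite -ball_normE /= -(subnKC Nn) (le_lt_trans (tail _ _))//.
  apply: le_lt_trans qN; rewrite ler_piMr//.
    by rewrite mulr_ge0 ?exprn_ge0// invr_ge0 subr_ge0 -hq ltW.
  by rewrite gerBl exprn_ge0.
pose l := lim (y n @[n --> \oo]).
have yl : y n @[n --> \oo] --> l by [].
have uni : forall (u : nat -> A) (a b : A), u n @[n --> \oo] --> a ->
    u n @[n --> \oo] --> b -> a = b.
  by move=> u a b; apply: cvg_unique; exact: norm_hausdorff.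
exists l; split.
- apply: (uni y) (yl).
  suff -> : y = fun n => star (y n) by exact: cvg_star.
  apply/funext; elim=> [|n ih] /=; first by rewrite star0.
  by rewrite /g starZ starD !starM sh -ih fmorphV rmorph_nat.
- apply: (uni (fun n => y n * h)).
    by apply: cvg_cstarM => //; exact: cvg_cst.
  suff -> : (fun n => y n * h) = (fun n => h * y n).
    by apply: cvg_cstarM => //; exact: cvg_cst.
  apply/funext => n; elim: n => [|n ih] /=; first by rewrite mul0r mulr0.
  by rewrite /g -scalerAl -scalerAr mulrDl mulrDr -!mulrA ih !mulrA ih.
- suff lg : l = g l by rewrite {1}lg /g -scaler_nat scalerA mulfV ?scale1r// pnatr_eq0.
  apply: (uni (fun n => y n.+1)).
    by rewrite (cvg_shiftS y).
  rewrite /y/= /g; apply: cvgZr; apply: cvgD; first exact: cvg_cst.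
  exact: cvg_cstarM.
Unshelve. all: by end_near. Qed.

(* For self-adjoint h with `|h| < 1, the previous lemma gives k with
   h^2 + k^2 = 1, so h is the mean of the unitaries h + ik and h - ik. *)
Lemma star_hom_norm_le (A B : cstarAlgType R) (f : A -> B) :
  star_hom f -> forall a, `|f a| <= `|a|.
Proof.
move=> fH.
have sa (h : A) : `|h| < 1 -> star h = h -> `|f h| <= 1.
  move=> h1 sh; have [y [sy yh yy]] := cstar_sqrt_fixpoint h1 sh.
  pose k : A := 1 - y; pose u : A := h + 'i *: k; pose v : A := h - 'i *: k.
  have ii : 'i * 'i = -1 :> R[i] by rewrite -expr2 sqr_i.
  have su : star u = v.
    rewrite /u /v starD starZ sh /k starB star1 sy -scaleNr; congr (_ + _ *: _).
    by apply/eqP; rewrite eq_complex /= oppr0 !eqxx.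
  have vu : v * u = 1.
    rewrite /v /u mulrBl !mulrDr -!scalerAl -!scalerAr scalerA ii scaleN1r.
    have -> : k * h = h * k by rewrite /k mulrBl mulrBr mul1r mulr1 yh.
    have -> : h * h + 'i *: (h * k) - ('i *: (h * k) - k * k) = h * h + k * k.
      by rewrite opprB addrACA subrr addr0.
    rewrite /k mulrBr mulr1 mulrBl mul1r opprB addrCA (addrA (h * h)).
    by rewrite -yy mulr2n addrK subrK.
  have fu : `|f u| = 1.
    have : `|f u| ^+ 2 = 1.
      rewrite -cstar_norm_star -(star_hom_star fH) -(star_homM fH) su vu.
      by rewrite (star_hom1 fH) cstar_norm1.
    by move/eqP; rewrite -[X in _ == X](expr1n _ 2) eqrXn2// => /eqP.
  have fv : `|f v| = 1 by rewrite -su (star_hom_star fH) norm_star.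
  have -> : h = 2^-1 *: (u + v).
    rewrite /u /v addrACA subrr addr0 -mulr2n -[h *+ 2]scaler_nat scalerA.
    by rewrite mulVf ?scale1r ?pnatr_eq0.
  rewrite (star_homZ fH) (star_homD fH) normrZ ger0_norm ?invr_ge0//.
  by rewrite ler_pdivrMl// mulr1 (le_trans (ler_normD _ _))// fu fv.
move=> a.
have le (b : A) : star b = b -> `|f b| <= `|b|.
  move=> sb; apply/ler_addgt0Pr => e e0.
  have c0 : 0 < `|b| + e by rewrite ltr_wpDl.
  pose c := `|b| + e; have cc : c^* = c.
    by rewrite /c; have /complex_realP[r ->] := gtr0_real c0; exact: conjc_real.
  have := sa (c^-1 *: b); rewrite (star_homZ fH) starZ sb !normrZ.
  rewrite (gtr0_norm (_ : 0 < c^-1)) ?invr_gt0//.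
  rewrite !ler_pdivrMl// ltr_pdivrMl// mulr1; apply.
    by rewrite ltrDl.
  by rewrite fmorphV/= cc.
rewrite -(@ler_pXn2r _ 2)// ?nnegrE// -!cstar_norm_star.
rewrite -(star_hom_star fH) -(star_homM fH) le//.
by rewrite starM starK.
Qed.

Lemma star_hom_continuous (A B : cstarAlgType R) (f : A -> B) :
  star_hom f -> continuous f.
Proof.
move=> fH x; apply/cvgrPdist_lt => e e0; near=> y.
rewrite -(star_homB fH) (le_lt_trans (star_hom_norm_le fH _))//.
Unshelve. all: by end_near. Qed.

End StarHom.

Definition halfline (R : realType) : set R := `[0, +oo[.

Section Cb.
Variables (R : realType) (A : cstarAlgType R).

(* Functions are total on R, but only their restriction to [0, +oo[ is
   constrained. Values at t < 0 disappear in the quotient by C0, hence Aflat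
   is C^b([0, +oo[, A) / C_0([0, +oo[, A). *)
Definition cb_set : set (R -> A) :=
  [set f | {within @halfline R, continuous f} /\
           exists M : R[i], forall t, 0 <= t -> `|f t| <= M].

Definition cb_pred : {pred R -> A} := mem cb_set.

Lemma within_cstarM (f g : R -> A) (D : set R) :
  {within D, continuous f} -> {within D, continuous g} ->
  {within D, continuous (f * g : R -> A)}.
Proof. by move=> cf cg t; apply: cvg_cstarM; [exact: cf|exact: cg]. Qed.

Lemma cb_subring : subring_closed cb_pred.
Proof.
split.
- rewrite inE; split; first by move=> t; exact: cvg_cst.
  by exists 1 => t _ /=; rewrite cstar_norm1.
- move=> f g; rewrite !inE => -[cf [M fM]] [cg [N gN]]; split.
    by move=> t; apply: cvgB; [exact: cf|exact: cg].
  exists (M + N) => t t0; rewrite (le_trans (ler_normB _ _))//.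
  by rewrite lerD ?fM ?gN.
- move=> f g; rewrite !inE => -[cf [M fM]] [cg [N gN]]; split.
    exact: within_cstarM.
  exists (M * N) => t t0; rewrite (le_trans (cstar_normM _ _))//.
  by rewrite ler_pM ?fM ?gN.
Qed.

Lemma cb_scale (c : R[i]) (f : R -> A) : cb_set f -> cb_set (c *: f).
Proof.
move=> [cf [M fM]]; split; first by move=> t; apply: cvgZr; exact: cf.
by exists (`|c| * M) => t t0; rewrite normrZ ler_wpM2l// fM.
Qed.

HB.instance Definition _ := GRing.isSubringClosed.Build (R -> A) cb_pred
  cb_subring.

Lemma cb_star (f : R -> A) : cb_set f -> cb_set (fun t => star (f t)).
Proof.
move=> [cf [M fM]]; split; first by move=> t; apply: cvg_star; exact: cf.
by exists M => t t0; rewrite norm_star fM.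
Qed.

Lemma cb_scaler_closed : GRing.scaler_closed cb_pred.
Proof. by move=> c f; rewrite !inE; exact: cb_scale. Qed.

HB.instance Definition _ := GRing.isScaleClosed.Build R[i] (R -> A) cb_pred
  cb_scaler_closed.

Record Cb := MkCb { cb_fun :> R -> A; cb_funP : cb_fun \in cb_pred }.

HB.instance Definition _ := [isSub for cb_fun].
HB.instance Definition _ := [Choice of Cb by <:].
HB.instance Definition _ := [SubChoice_isSubNzRing of Cb by <:].
HB.instance Definition _ := [SubZmodule_isSubLmodule of Cb by <:].

Lemma CbE (f g : Cb) : (forall t, f t = g t) -> f = g.
Proof. by move=> fg; apply/val_inj/funext. Qed.

Lemma CbDE (f g : Cb) t : (f + g) t = f t + g t. Proof. by []. Qed.
Lemma CbME (f g : Cb) t : (f * g) t = f t * g t. Proof. by []. Qed.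
Lemma CbZE (c : R[i]) (f : Cb) t : (c *: f) t = c *: f t. Proof. by []. Qed.

Lemma Cb_scaleAl (c : R[i]) (f g : Cb) : c *: (f * g) = c *: f * g.
Proof. by apply: CbE => t; rewrite !(CbZE, CbME) scalerAl. Qed.

Lemma Cb_scaleAr (c : R[i]) (f g : Cb) : c *: (f * g) = f * (c *: g).
Proof. by apply: CbE => t; rewrite !(CbZE, CbME) scalerAr. Qed.

HB.instance Definition _ := GRing.Lmodule_isLalgebra.Build R[i] Cb Cb_scaleAl.
HB.instance Definition _ := GRing.Lalgebra_isAlgebra.Build R[i] Cb Cb_scaleAr.

Definition Cb_star (f : Cb) : Cb :=
  MkCb (mem_set (cb_star (set_mem (cb_funP f)))).

Lemma Cb_starK : involutive Cb_star.
Proof. by move=> f; apply: CbE => t; exact: starK. Qed.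

Lemma Cb_starD : {morph Cb_star : f g / f + g}.
Proof. by move=> f g; apply: CbE => t; rewrite CbDE /= starD. Qed.

Lemma Cb_starZ (c : R[i]) (f : Cb) : Cb_star (c *: f) = c^* *: Cb_star f.
Proof. by apply: CbE => t; rewrite CbZE /= starZ. Qed.

Lemma Cb_starM (f g : Cb) : Cb_star (f * g) = Cb_star g * Cb_star f.
Proof. by apply: CbE => t; rewrite CbME /= starM. Qed.

HB.instance Definition _ :=
  Algebra_hasStar.Build R Cb Cb_starK Cb_starD Cb_starZ Cb_starM.

Definition C0 : {pred Cb} :=
  [pred f : Cb | `[< (f : R -> A) t @[t --> +oo] --> (0 : A) >]].

Lemma C0P (f : Cb) : reflect (f t @[t --> +oo] --> (0 : A)) (f \in C0).
Proof. exact: asboolP. Qed.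

Lemma C0_zmod : zmod_closed C0.
Proof.
split; first by apply/C0P; exact: cvg_cst.
move=> f g /C0P f0 /C0P g0; apply/C0P; rewrite -[0 : A]subr0; exact: cvgB.
Qed.

HB.instance Definition _ := GRing.isZmodClosed.Build Cb C0 C0_zmod.

Lemma Cb_bounded_near (f : Cb) : exists2 M : R[i], 0 < M & \forall t \near +oo, `|f t| <= M.
Proof.
have [_ [M fM]] := set_mem (cb_funP f).
exists (`|M| + 1); first by rewrite ltr_wpDl.
near=> t; have t0 : 0 <= t by near: t; exact: nbhs_pinfty_ge.
rewrite (le_trans (fM _ t0))// (@le_trans _ _ `|M|) ?lerDl//.
by rewrite real_ler_norm// ger0_real// (le_trans _ (fM _ t0)).
Unshelve. all: by end_near. Qed.

Lemma C0_mull (f g : Cb) : g \in C0 -> f * g \in C0.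
Proof.
move=> /C0P /cvgr0Pnorm_lt g0; apply/C0P/cvgr0Pnorm_lt => e e0.
have [M M0 fM] := Cb_bounded_near f; near=> t.
rewrite (le_lt_trans (cstar_normM _ _))//.
have h1 : `|f t| <= M by near: t.
rewrite (le_lt_trans (ler_wpM2r _ h1))// -ltr_pdivlMl// mulrC.
by near: t; apply: g0; rewrite divr_gt0.
Unshelve. all: by end_near. Qed.

Lemma C0_star (f : Cb) : f \in C0 -> star f \in C0.
Proof.
by move=> /C0P f0; apply/C0P; rewrite -[X in _ --> X](@star0 R A); exact: cvg_star.
Qed.

Lemma C0_mulr (f g : Cb) : f \in C0 -> f * g \in C0.
Proof.
by move=> f0; rewrite -[f * g]starK starM C0_star// C0_mull// C0_star.
Qed.

Lemma C0_scale (c : R[i]) (f : Cb) : f \in C0 -> c *: f \in C0.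
Proof. by move=> f0; rewrite -[c *: f]mul1r -scalerAr scalerAl C0_mull. Qed.

Lemma C0_1 : (1 : Cb) \notin C0.
Proof.
apply/C0P => h; have : (1 : A) = 0.
  have := @cvg_unique _ (@norm_hausdorff _ A) (cst (1 : A) t @[t --> +oo%R]) _.
  by apply; [exact: cvg_cst|exact: h].
by apply/eqP; exact: oner_neq0.
Qed.

(* Only the star-algebra structure of the quotient is built: an injective
   star-homomorphism between C*-algebras is automatically isometric, so the norm
   plays no role in saying that Aflat contains a copy of a C*-algebra. *)
Definition Aflat : Type := Quotient.quot C0.
HB.instance Definition _ := GRing.Zmodule.on Aflat.

Definition flat_pi (f : Cb) : Aflat := \pi_(Quotient.quot C0) f.
Definition flat_repr (x : Aflat) : Cb := repr (x : Quotient.quot C0).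

Lemma flat_reprK : cancel flat_repr flat_pi.
Proof. by move=> x; exact: reprK. Qed.

Lemma flat_piP (f g : Cb) : reflect (flat_pi f = flat_pi g) (f - g \in C0).
Proof. by rewrite Quotient.idealrBE; exact: eqP. Qed.

Lemma flat_reprP (f : Cb) : flat_repr (flat_pi f) - f \in C0.
Proof. by apply/flat_piP; rewrite flat_reprK. Qed.

Lemma flat_ind (P : Aflat -> Prop) : (forall f, P (flat_pi f)) -> forall x, P x.
Proof. by move=> Pf x; rewrite -[x]flat_reprK. Qed.

Lemma flat_piD : {morph flat_pi : f g / f + g}.
Proof. by move=> f g; rewrite /flat_pi Quotient.pi_add. Qed.

Lemma flat_piN : {morph flat_pi : f / - f}.
Proof. by move=> f; rewrite /flat_pi Quotient.pi_opp. Qed.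

Lemma flat_pi0 : flat_pi 0 = 0.
Proof. by rewrite -[0]subr0 flat_piD flat_piN subrr. Qed.

Definition flat_one : Aflat := flat_pi 1.
Definition flat_mul (x y : Aflat) : Aflat := flat_pi (flat_repr x * flat_repr y).
Definition flat_scale (c : R[i]) (x : Aflat) : Aflat := flat_pi (c *: flat_repr x).
Definition flat_star (x : Aflat) : Aflat := flat_pi (star (flat_repr x)).

Lemma flat_mulE f g : flat_mul (flat_pi f) (flat_pi g) = flat_pi (f * g).
Proof.
apply/flat_piP; set f' := flat_repr _; set g' := flat_repr _.
have -> : f' * g' - f * g = (f' - f) * g' + f * (g' - g).
  by rewrite mulrBl mulrBr addrA subrK.
by apply: rpredD; [apply: C0_mulr|apply: C0_mull]; exact: flat_reprP.
Qed.

Lemma flat_scaleE c f : flat_scale c (flat_pi f) = flat_pi (c *: f).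
Proof. by apply/flat_piP; rewrite -scalerBr C0_scale ?flat_reprP. Qed.

Lemma flat_starE f : flat_star (flat_pi f) = flat_pi (star f).
Proof.
by apply/flat_piP; rewrite -starB C0_star ?flat_reprP.
Qed.

Lemma flat_mulA : associative flat_mul.
Proof.
by move=> x y z; elim/flat_ind: x => f; elim/flat_ind: y => g; elim/flat_ind: z => h; rewrite !flat_mulE mulrA.
Qed.
Lemma flat_mul1 : left_id flat_one flat_mul.
Proof. by move=> x; elim/flat_ind: x => f; rewrite flat_mulE mul1r. Qed.
Lemma flat_mulr1 : right_id flat_one flat_mul.
Proof. by move=> x; elim/flat_ind: x => f; rewrite flat_mulE mulr1. Qed.
Lemma flat_mulDl : left_distributive flat_mul +%R.
Proof.
move=> x y z; elim/flat_ind: x => f; elim/flat_ind: y => g; elim/flat_ind: z => h.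
by rewrite -flat_piD !flat_mulE -flat_piD mulrDl.
Qed.
Lemma flat_mulDr : right_distributive flat_mul +%R.
Proof.
move=> x y z; elim/flat_ind: x => f; elim/flat_ind: y => g; elim/flat_ind: z => h.
by rewrite -flat_piD !flat_mulE -flat_piD mulrDr.
Qed.
Lemma flat_one_neq0 : flat_one != 0.
Proof.
by apply/eqP; rewrite -flat_pi0 => /flat_piP; rewrite subr0; apply/negP; exact: C0_1.
Qed.
HB.instance Definition _ := GRing.Zmodule_isNzRing.Build Aflat flat_mulA
  flat_mul1 flat_mulr1 flat_mulDl flat_mulDr flat_one_neq0.

Lemma flat_scaleA a b x : flat_scale a (flat_scale b x) = flat_scale (a * b) x.
Proof. by elim/flat_ind: x => f; rewrite !flat_scaleE scalerA. Qed.
Lemma flat_scale1 : left_id 1 flat_scale.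
Proof. by move=> x; elim/flat_ind: x => f; rewrite flat_scaleE scale1r. Qed.
Lemma flat_scaleDr : right_distributive flat_scale +%R.
Proof.
move=> c; move=> x y; elim/flat_ind: x => f; elim/flat_ind: y => g.
by rewrite -flat_piD !flat_scaleE -flat_piD scalerDr.
Qed.
Lemma flat_scaleDl x : {morph flat_scale^~ x : a b / a + b}.
Proof. by move=> a b; elim/flat_ind: x => f; rewrite !flat_scaleE -flat_piD scalerDl. Qed.
HB.instance Definition _ := GRing.Zmodule_isLmodule.Build R[i] Aflat
  flat_scaleA flat_scale1 flat_scaleDr flat_scaleDl.

Lemma flat_piM f g : flat_pi (f * g) = flat_pi f * flat_pi g.
Proof. by rewrite -flat_mulE. Qed.
Lemma flat_piZ c f : flat_pi (c *: f) = c *: flat_pi f.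
Proof. by rewrite -flat_scaleE. Qed.

Lemma flat_scaleAl (c : R[i]) (x y : Aflat) : c *: (x * y) = c *: x * y.
Proof.
elim/flat_ind: x => f; elim/flat_ind: y => g.
by rewrite -flat_piM -!flat_piZ -flat_piM scalerAl.
Qed.
Lemma flat_scaleAr (c : R[i]) (x y : Aflat) : c *: (x * y) = x * (c *: y).
Proof.
elim/flat_ind: x => f; elim/flat_ind: y => g.
by rewrite -flat_piM -!flat_piZ -flat_piM scalerAr.
Qed.
HB.instance Definition _ := GRing.Lmodule_isLalgebra.Build R[i] Aflat flat_scaleAl.
HB.instance Definition _ := GRing.Lalgebra_isAlgebra.Build R[i] Aflat flat_scaleAr.

Lemma flat_starK : involutive flat_star.
Proof. by move=> x; elim/flat_ind: x => f; rewrite !flat_starE starK. Qed.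
Lemma flat_starD : {morph flat_star : x y / x + y}.
Proof.
move=> x y; elim/flat_ind: x => f; elim/flat_ind: y => g.
by rewrite -flat_piD !flat_starE -flat_piD starD.
Qed.
Lemma flat_starZ (c : R[i]) x : flat_star (c *: x) = c^* *: flat_star x.
Proof. by elim/flat_ind: x => f; rewrite -flat_piZ !flat_starE -flat_piZ starZ. Qed.
Lemma flat_starM (x y : Aflat) : flat_star (x * y) = flat_star y * flat_star x.
Proof.
elim/flat_ind: x => f; elim/flat_ind: y => g.
by rewrite -flat_piM !flat_starE -flat_piM starM.
Qed.
HB.instance Definition _ :=
  Algebra_hasStar.Build R Aflat flat_starK flat_starD flat_starZ flat_starM.

Lemma flat_pi_star f : flat_pi (star f) = star (flat_pi f).
Proof. by rewrite -flat_starE. Qed.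

Lemma cb_cst (a : A) : cb_set (cst a).
Proof. by split; [move=> t; exact: cvg_cst|exists `|a|]. Qed.

Definition flat_cst (a : A) : Aflat := flat_pi (MkCb (mem_set (cb_cst a))).

Definition Aflat_commutant : set Aflat :=
  [set x | forall a, flat_cst a * x = x * flat_cst a].

End Cb.

Section Act.
Variables (R : realType) (A : cstarAlgType R).

Record starAut := StarAut {
  aut_fun :> A -> A;
  aut_star_hom : star_hom aut_fun;
  aut_bij : bijective aut_fun }.

Lemma cb_comp (f : starAut) (x : R -> A) : cb_set x -> cb_set (f \o x).
Proof.
move=> [cx [M xM]]; split.
  move=> t; apply: continuous_cvg; last exact: cx.
  exact: (star_hom_continuous (aut_star_hom f)).
exists M => t t0; exact: le_trans (star_hom_norm_le (aut_star_hom f) _) (xM _ t0).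
Qed.

Definition Cb_map (f : starAut) (x : Cb A) : Cb A :=
  MkCb (mem_set (cb_comp f (set_mem (cb_funP x)))).

Definition flat_map (f : starAut) (x : Aflat A) : Aflat A :=
  flat_pi (Cb_map f (flat_repr x)).

Lemma flat_mapE (f : starAut) (x : Cb A) :
  flat_map f (flat_pi x) = flat_pi (Cb_map f x).
Proof.
apply/flat_piP/C0P; have /C0P/cvgr0Pnorm_lt x0 := flat_reprP x.
apply/cvgr0Pnorm_lt => e e0; near=> t.
have -> : (Cb_map f (flat_repr (flat_pi x)) - Cb_map f x) t
    = f ((flat_repr (flat_pi x) - x) t).
  by rewrite CbDE [RHS](star_homB (aut_star_hom f)).
rewrite (le_lt_trans (star_hom_norm_le (aut_star_hom f) _))//.
by near: t; exact: x0.
Unshelve. all: by end_near. Qed.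

End Act.

Section Statement.
Variables (R : realType) (A : cstarAlgType R).

Definition rnorm (a : A) : R := complex.Re `|a|.

Definition commutator (a b : A) : A := a * b - b * a.

Definition separable_space (T : topologicalType) : Prop :=
  exists D : set T, countable D /\ dense D.

Definition closed_ideal (J : set A) : Prop :=
  [/\ closed J, J 0, forall x y, J x -> J y -> J (x + y) &
      forall a x, J x -> J (a * x) /\ J (x * a)].

Definition unitary : set A := [set u | star u * u = 1 /\ u * star u = 1].

Definition unitary_of_ideal (J : set A) : set A :=
  [set u | unitary u /\ J (u - 1)].

Definition cocycle_action (G : groupType) (alpha : G -> starAut A)
    (u : G -> G -> A) : Prop :=
  [/\ forall g h, unitary (u g h),
      forall g h a, alpha g (alpha h a) = u g h * alpha (g * h)%g a * star (u g h),
      forall g h k, u g h * u (g * h)%g k = alpha g (u h k) * u g (h * k)%g,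
      forall a, alpha 1%g a = a &
      forall g, u 1%g g = 1 /\ u g 1%g = 1].

(* A cocycle action need not act on Aflat, but it does on the commutant of A,
   where Ad u(g, h) is trivial. *)
Definition Aflat_fixed (G : groupType) (alpha : G -> starAut A) : set (Aflat A) :=
  [set x | Aflat_commutant x /\ forall g, flat_map (alpha g) x = x].

Definition cuntz_isometries (B : cstarAlgType R) (S : nat -> B) : Prop :=
  forall i j, star (S i) * S j = (i == j)%:R.

(* O is the universal unital C*-algebra generated by a sequence of isometries
   with pairwise orthogonal ranges. *)
Definition is_cuntz_infty (O : cstarAlgType R) : Prop :=
  exists S : nat -> O, cuntz_isometries S /\
  forall (B : cstarAlgType R) (T : nat -> B), cuntz_isometries T ->
  exists! phi : O -> B, star_hom phi /\ forall i, phi (S i) = T i.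

Definition contains_cuntz_infty (E : starAlgType R) (D : set E) : Prop :=
  exists O : cstarAlgType R, is_cuntz_infty O /\
  exists phi : O -> E, [/\ star_hom phi, injective phi & forall z, D (phi z)].

Definition unit_itv : set R := `[0, 1].

Definition continuous_into (D : set A) (x : R -> R -> A) : Prop :=
  {within unit_itv `*` @halfline R, continuous (fun p : R * R => x p.1 p.2)} /\
  forall s t, unit_itv s -> halfline t -> D (x s t).

Definition Lip (f : R -> A) : \bar R :=
  ereal_sup [set r | exists s s', [/\ unit_itv s, unit_itv s', s != s' &
                       r = (rnorm (f s - f s') / `|s - s'|)%:E]].

Definition limsup_sup (F : R -> R -> A) : \bar R :=
  limf_esup (fun t : R => ereal_sup [set (rnorm (F s t))%:E | s in unit_itv])
    (pinfty_nbhs R).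

End Statement.

(* Main.v *)
Require Import Defs.
From mathcomp Require Import all_boot all_order all_algebra.
From mathcomp Require Import complex.
From mathcomp Require Import all_classical all_reals all_analysis.
From mathcomp Require Import ring lra.
Set Implicit Arguments. Unset Strict Implicit. Unset Printing Implicit Defensive.
Import Order.TTheory GRing.Theory Num.Theory numFieldNormedType.Exports.
Local Open Scope classical_set_scope.
Local Open Scope ring_scope.
Local Open Scope complex_scope.

(**
  Let u(s,t) = x(s,t) x(0,t)^*, a path of unitaries from 1 to u(1,t).  A path
  of controlled length from 1 to u(1,t) is obtained by a swindle in matrix
  blocks that almost commute with everything in sight, and multiplying it
  back by x(0,t) gives y.

  Blocks.  Two of the isometries that generate the copy of O_infty lift to
  continuous functions [0, +oo[ -> A, which polar decomposition turns into
  honest isometries s0(t), s1(t) with orthogonal ranges (central_isometries).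
  The words s1^k s0 s0 and s1^k s0 s1 are then two sequences a_k, b_k of
  isometries with pairwise orthogonal ranges; they asymptotically commute
  with A and are asymptotically fixed by the action.

  Swindle.  If v is a unitary, then diag(v, v^* ) is joined to 1 by a path of
  length at most 2 pi inside 2 x 2 matrices (swindle): conjugate diag(v^*, 1) by
  rotations and multiply by diag(v, 1).  Cut the path u( . , t) into small
  steps u_0 = u(1,t), u_1, ..., u_n = 1.  Using this homotopy in the blocks
  (a_k, b_k) for u_k, and in the blocks (b_k, a_{k+1}) for u_{k+1}, the
  product of the two paths (double_swindle) ends at
  diag(u_0, u_0^* u_1, 1, u_1^* u_2, 1, ...), which is close to
  diag(u_0, 1, 1, ...).  Its length does not depend on n.  Everything is block
  diagonal up to a permutation, and block diagonal elements have as norm the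
  maximum of the norms of their blocks (rnorm_orthogonal_sum): this is why
  neither the length nor the commutators grow with n.

  The whole of u_0.  The projection p = a_0 a_0^* almost commutes with u_0,
  so u_0 is close to the product of a_0 u_0 a_0^* + (1 - p) and of a unitary
  c_0 of the corner of f = 1 - p, extended by p.  The first factor is reached by the
  double swindle above.  The second one is reached by a double swindle whose
  blocks are f, a_0 a_k f and a_0 b_k f, which fit next to f because their
  ranges lie under p (swindle_path).  The length is at most 8 pi.

  Exactness.  The path so obtained is exactly unitary and ends near u_0 only.
  Adding a small linear term corrects the end point, and taking the unitary
  part restores unitarity (corrected_path).  The unitary part is computed by
  Newton's iteration z -> z + z (1 - z^* z) / 2, which stays inside
  1 + J and is 3-Lipschitz near the unitaries (polar_lipschitz); hence the
  constant 24 pi + 1 < 25 pi.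

  Estimates.  Commutators with c and the differences alpha_g(z) - z are both
  of the form f(z) c - c z with f a star-homomorphism (twisted), and such maps
  satisfy a twisted Leibniz rule; the block structure gives the factor 8 from
  u to the path, hence 17 = 2 * 8 + 1 from x to y, well below 243.

  Parameters.  As t grows, the number of steps and the speed at which the
  isometries run to infinity are chosen by continuous functions of t
  (reparametrization), the second depending on the first, so that all errors
  tend to 0.  Only countably many conditions can be imposed; a dense sequence
  in A is enough, since commutators are Lipschitz in c.
*)

(** * Real-valued norms *)

Section RealNorm.
Variables (R : realType) (A : cstarAlgType R).
Implicit Types (a b x y : A) (c : R).

Lemma rnormE a : `|a| = (rnorm a)%:C.
Proof. by rewrite /rnorm RRe_real// ger0_real. Qed.

Lemma rnorm_ge0 a : 0 <= rnorm a.
Proof. by rewrite -ler0c -rnormE. Qed.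

Lemma rnorm_eq0 a : rnorm a = 0 -> a = 0.
Proof. by move=> h; apply/eqP; rewrite -normr_eq0 rnormE h. Qed.

Lemma rnorm0 : rnorm (0 : A) = 0.
Proof. by rewrite /rnorm normr0. Qed.

Lemma rnormN a : rnorm (- a) = rnorm a.
Proof. by rewrite /rnorm normrN. Qed.

Lemma rnormBC a b : rnorm (a - b) = rnorm (b - a).
Proof. by rewrite /rnorm distrC. Qed.

Lemma rnormD a b : rnorm (a + b) <= rnorm a + rnorm b.
Proof. by rewrite -lecR rmorphD /= -!rnormE ler_normD. Qed.

Lemma rnormB a b : rnorm (a - b) <= rnorm a + rnorm b.
Proof. by rewrite -(rnormN b) rnormD. Qed.

Lemma rnormM a b : rnorm (a * b) <= rnorm a * rnorm b.
Proof. by rewrite -lecR rmorphM /= -!rnormE cstar_normM. Qed.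

Lemma rnorm_star a : rnorm (star a) = rnorm a.
Proof. by rewrite /rnorm norm_star. Qed.

Lemma rnorm_cstar a : rnorm (star a * a) = rnorm a ^+ 2.
Proof. by apply: complexI; rewrite rmorphXn /= -!rnormE cstar_norm_star. Qed.

Lemma rnorm1 : rnorm (1 : A) = 1.
Proof. by rewrite /rnorm cstar_norm1. Qed.

Lemma rnormZ c a : rnorm (c%:C *: a) = `|c| * rnorm a.
Proof.
by apply: complexI; rewrite rmorphM /= -!rnormE normrZ normc_def /= expr0n /= addr0 sqrtr_sqr.
Qed.

Lemma starZr c a : star (c%:C *: a) = c%:C *: star a.
Proof. by rewrite starZ conjc_real. Qed.

Lemma cvg_rnormP T (F : set_system T) (FF : Filter F) (f : T -> A) a :
  f x @[x --> F] --> a <->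
  forall e : R, 0 < e -> \forall x \near F, rnorm (a - f x) < e.
Proof.
split=> [/cvgrPdist_lt h e e0|h].
  near=> x; rewrite -ltcR -rnormE; near: x; apply: h; by rewrite ltcR.
apply/cvgrPdist_lt => e e0.
have [e' ee] : exists e' : R, e = e'%:C.
  by exists (complex.Re e); rewrite RRe_real// gtr0_real.
rewrite ee ltcR in e0 *.
by near=> x; rewrite rnormE ltcR; near: x; exact: h.
Unshelve. all: by end_near. Qed.

Lemma cvg_rscale T (F : set_system T) (FF : Filter F) (g : T -> R) (f : T -> A) c a :
  g x @[x --> F] --> c -> f x @[x --> F] --> a ->
  (g x)%:C *: f x @[x --> F] --> c%:C *: a.
Proof.
move=> gc fa; apply: cvgZ => //.
apply/cvgrPdist_lt => e e0.
have [e' ee] : exists e' : R, e = e'%:C.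
  by exists (complex.Re e); rewrite RRe_real// gtr0_real.
rewrite ee ltcR in e0 *.
near=> x; rewrite -rmorphB /= normc_def /= expr0n /= addr0 sqrtr_sqr ltcR.
by near: x; move/cvgrPdist_lt: gc; exact.
Unshelve. all: by end_near. Qed.

End RealNorm.

(** * Norms of orthogonal sums *)
Section OrthogonalSums.
Variables (R : realType) (A : cstarAlgType R).
Implicit Types (x y z : A) (M : R).

Definition orthogonal x y := star x * y = 0 /\ x * star y = 0.

Lemma orthogonalC x y : orthogonal x y -> orthogonal y x.
Proof.
move=> [h1 h2]; split.
  by rewrite -[LHS]starK starM starK h1 star0.
by rewrite -[LHS]starK starM starK h2 star0.
Qed.

Lemma orthogonalDr x y z : orthogonal x y -> orthogonal x z -> orthogonal x (y + z).
Proof.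
by move=> [h1 h2] [h3 h4]; split; rewrite ?starD mulrDr ?h1 ?h2 ?h3 ?h4 addr0.
Qed.

(** Passing from x, y to x^* x, y^* y preserves orthogonality and squares all
    norms, so the triangle inequality, which costs a factor 2 at every scale,
    can be applied at the scale of 2^k-th powers. *)
Lemma rnorm_orthogonal_pow x y M k : orthogonal x y ->
  rnorm x <= M -> rnorm y <= M -> rnorm (x + y) ^+ (2 ^ k)%N <= 2 * M ^+ (2 ^ k)%N.
Proof.
elim: k x y M => [|k ih] x y M xy xM yM.
  by rewrite !expr1 (le_trans (rnormD _ _))// mulr_natl mulr2n lerD.
have sq z : rnorm z <= M -> rnorm (star z * z) <= M ^+ 2.
  by move=> zM; rewrite rnorm_cstar lerXn2r// nnegrE ?rnorm_ge0// (le_trans _ zM) ?rnorm_ge0.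
rewrite expnS !exprM -rnorm_cstar.
have -> : star (x + y) * (x + y) = star x * x + star y * y.
  have [h1 _] := xy; have [h2 _] := orthogonalC xy.
  by rewrite starD mulrDl !mulrDr h1 h2 addr0 add0r.
apply: ih; [|exact: sq|exact: sq].
have [h1 h2] := xy; split; rewrite !(starM, starK).
  by rewrite -mulrA (mulrA x) h2 mul0r mulr0.
by rewrite -mulrA (mulrA x) h2 mul0r mulr0.
Qed.

(** The factor 2 of the previous lemma disappears after taking 2^k-th roots. *)
Lemma rnorm_orthogonal x y M : orthogonal x y ->
  rnorm x <= M -> rnorm y <= M -> rnorm (x + y) <= M.
Proof.
move=> xy xM yM; rewrite leNgt; apply/negP => Mr.
have M0 : 0 <= M := le_trans (rnorm_ge0 _) xM.
have h k := rnorm_orthogonal_pow k xy xM yM.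
set r := rnorm (x + y) in Mr h.
have {}M0 : 0 < M.
  rewrite lt_neqAle M0 andbT eq_sym; apply/eqP => Me.
  by have := h 0; rewrite !expr1 Me mulr0 leNgt -Me Mr.
pose e := r / M - 1.
have e0 : 0 < e by rewrite subr_gt0 ltr_pdivlMr// mul1r.
have le2 k : 1 + e *+ k <= 2.
  have : (r / M) ^+ (2 ^ k)%N <= 2.
    by rewrite expr_div_n ler_pdivrMr ?exprn_gt0.
  apply: le_trans; have -> : r / M = 1 + e by rewrite /e addrC subrK.
  have bern n : 1 + e *+ n <= (1 + e) ^+ n.
    elim: n => [|n ih]; first by rewrite mulr0n addr0 expr0.
    rewrite exprS mulrDl mul1r mulrSr addrA lerD//.
    by apply: ler_peMr; [exact: ltW|apply: exprn_ege1; rewrite lerDl ltW].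
  rewrite (le_trans (bern k))// ler_weXn2l ?lerDl ?ltW//.
  by apply/ltnW/ltn_expl.
have ei : 0 < e^-1 by rewrite invr_gt0.
have := archi_boundP (ltW ei).
set k := Num.bound _ => hk; have := le2 k.+1; rewrite leNgt => /negP; apply.
have : 1 < e *+ k by rewrite -mulr_natl -ltr_pdivrMr// div1r.
rewrite [e *+ k.+1]mulrSr => ?; lra.
Qed.

Lemma orthogonal_sumr I (s : seq I) (P : pred I) (F : I -> A) x :
  (forall i, P i -> orthogonal x (F i)) -> orthogonal x (\sum_(i <- s | P i) F i).
Proof.
move=> h; elim/big_rec: _ => [|i y Pi xy].
  by split; rewrite ?star0 mulr0.
by apply: orthogonalDr; [exact: h|].
Qed.

Lemma rnorm_orthogonal_sum n (F : nat -> A) M : 0 <= M ->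
  (forall i, (i < n)%N -> rnorm (F i) <= M) ->
  (forall i j, i != j -> orthogonal (F i) (F j)) ->
  rnorm (\sum_(i < n) F i) <= M.
Proof.
move=> M0; elim: n => [|n ih] FM Fo; first by rewrite big_ord0 rnorm0.
rewrite big_ord_recr /=; apply: rnorm_orthogonal; last exact: FM.
  apply/orthogonalC/orthogonal_sumr => i _; apply: Fo.
  by rewrite gtn_eqF.
by apply: ih => // i ni; apply: FM; rewrite ltnS ltnW.
Qed.

Lemma mul_sum_diag n (F G : nat -> A) :
  (forall i j, i != j -> F i * G j = 0) ->
  (\sum_(i < n) F i) * (\sum_(i < n) G i) = \sum_(i < n) F i * G i.
Proof.
move=> h; rewrite mulr_suml; apply: eq_bigr => i _.
rewrite mulr_sumr (bigD1 i)//= big1 ?addr0// => j ji.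
by rewrite h// eq_sym.
Qed.

End OrthogonalSums.

(** * The unitary part of an almost unitary element *)
Section Polar.
Variables (R : realType) (A : cstarAlgType R).
Implicit Types (a b z w : A) (C : R).

(** The limit is taken here once and for all; the explicit bound on its
    distance to z 0 is what makes the unitary part a small correction. *)
Lemma cauchy_geometric (z : nat -> A) C :
  (forall n, rnorm (z n.+1 - z n) <= C * 2^-1 ^+ n) ->
  exists2 l, z n @[n --> \oo] --> l & rnorm (l - z 0) <= 2 * C.
Proof.
move=> step.
have C0 : 0 <= C by have := step 0%N; rewrite expr0 mulr1; apply: le_trans; exact: rnorm_ge0.
have tail n m : rnorm (z (n + m)%N - z n) <= 2 * C * 2^-1 ^+ n * (1 - 2^-1 ^+ m).
  elim: m => [|m ih]; first by rewrite addn0 subrr rnorm0 expr0 subrr mulr0.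
  rewrite addnS -(subrKA (z (n + m)%N)) (le_trans (rnormD _ _))//.
  apply: (le_trans (lerD (step _) ih)).
  by rewrite exprD exprS le_eqVlt; apply/orP; left; apply/eqP; field.
have tail' n m : rnorm (z (n + m)%N - z n) <= 2 * C * 2^-1 ^+ n.
  apply: le_trans (tail n m) _; apply: ler_piMr.
    by rewrite !mulr_ge0// exprn_ge0 ?invr_ge0.
  by rewrite lerBlDr lerDl exprn_ge0// invr_ge0.
have cz : cvg (z n @[n --> \oo]).
  apply/cauchy_cvgP/cauchy_exP => e e0.
  have [e' ee] : exists e' : R, e = e'%:C.
    by exists (complex.Re e); rewrite RRe_real// gtr0_real.
  rewrite ee ltcR in e0.
  have C1 : 0 < 2 * C + 1 by lra.
  have hn : `|2^-1 : R| < 1 by rewrite ger0_norm ?invr_ge0// invf_lt1// ltr1n.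
  have d0 : 0 < e' / (2 * C + 1) by rewrite divr_gt0.
  have /cvgrPdist_lt/(_ _ d0)[N _ HN] := cvg_expr hn.
  exists (z N); exists N => // n /= Nn.
  rewrite -ball_normE /= distrC rnormE ee ltcR -(subnKC Nn).
  apply: (le_lt_trans (tail' _ _)).
  have := HN N (leqnn N); rewrite sub0r normrN ger0_norm ?exprn_ge0 ?invr_ge0//.
  rewrite ltr_pdivlMr// => h; apply: le_lt_trans h.
  by rewrite mulrC ler_wpM2l ?exprn_ge0 ?invr_ge0//; lra.
exists (lim (z n @[n --> \oo])) => //.
apply/ler_addgt0Pr => e e0.
have /cvg_rnormP /(_ _ e0) [N _ HN] : z n @[n --> \oo] --> lim (z n @[n --> \oo]) by [].
have := HN N (leqnn N) => /= h.
rewrite -(subrKA (z N)) (le_trans (rnormD _ _))// [2 * C + e]addrC; apply: lerD; first exact: ltW.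
by have := tail' 0%N N; rewrite add0n expr0 mulr1.
Qed.

(** Deviation of z from being an isometry.  The Newton iteration below is
    polynomial in z and star z, so that its limits stay in closed
    star-subalgebras and keep relations of the form a * z = 0. *)
Definition defect z := 1 - star z * z.
Definition newton z := z + 2^-1%:C *: (z * defect z).

Lemma rnorm_half z : rnorm (2^-1%:C *: z) = 2^-1 * rnorm z.
Proof. by rewrite rnormZ ger0_norm ?invr_ge0. Qed.

Lemma defect_star z : star (defect z) = defect z.
Proof. by rewrite /defect starB star1 starM starK. Qed.

Lemma rnorm_defect z : rnorm (defect z) <= 8^-1 -> rnorm z <= 17 / 16.
Proof.
move=> h; have : rnorm z ^+ 2 <= (17 / 16) ^+ 2.
  rewrite -rnorm_cstar.
  have -> : star z * z = 1 - defect z by rewrite /defect subKr.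
  rewrite (le_trans (rnormB _ _))// rnorm1; lra.
by rewrite ler_pXn2r// nnegrE ?rnorm_ge0//; lra.
Qed.

(** With h the defect of z, star z * z = 1 - h, and
    (1 - h) (1 + h / 2)^2 = 1 - 3 h^2 / 4 - h^3 / 4. *)
Lemma defect_newton z : defect (newton z) =
  4^-1%:C *: (3%:C *: (defect z * defect z) + defect z * defect z * defect z).
Proof.
set h := defect z.
have hE : star z * z = 1 - h by rewrite /h /defect subKr.
have hS : star h = h by exact: defect_star.
have -> : newton z = z * (1 + 2^-1%:C *: h).
  by rewrite mulrDr mulr1 -scalerAr.
rewrite /defect starM starD star1 starZr hS; clearbody h.
have -> : (1 + 2^-1%:C *: h) * star z * (z * (1 + 2^-1%:C *: h))
   = (1 + 2^-1%:C *: h) * (1 - h) * (1 + 2^-1%:C *: h).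
  by rewrite -mulrA (mulrA (star z)) hE mulrA.
set k : R[i] := 2^-1%:C.
have kk : k + k = 1 by rewrite /k -rmorphD /= (_ : 2^-1 + 2^-1 = 1 :> R) ?rmorph1//; lra.
have -> : (1 + k *: h) * (1 - h) = 1 - k *: h - k *: (h * h).
  rewrite mulrBr mulr1 mulrDl mul1r -scalerAl opprD addrA; congr (_ - _).
  rewrite -addrA; congr (_ + _).
  by rewrite -[X in _ - X]scale1r -kk scalerDl opprD addrA subrr add0r.
rewrite mulrDr mulr1 !mulrBl mul1r -!scalerAl -!scalerAr !scalerA.
set h3 := h * h * h; set h2 := h * h.
have -> : 1 - k *: h - k *: h2 + (k *: h - (k * k) *: h2 - (k * k) *: h3)
  = 1 - (k *: h2 + (k * k) *: h2) - (k * k) *: h3.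
  rewrite addrA; congr (_ - _); rewrite addrA opprD addrA; congr (_ - _).
  by rewrite -addrA [_ + k *: h]addrC addrA subrK.
rewrite -addrA -opprD subKr -scalerDl scalerDr scalerA -!rmorphM -rmorphD /=.
congr (_%:C *: _ + _%:C *: _); lra.
Qed.

(** The new defect is quadratic in the old one, which is at most 1/8. *)
Lemma rnorm_defect_newton z : rnorm (defect z) <= 8^-1 ->
  rnorm (defect (newton z)) <= 8^-1 * rnorm (defect z).
Proof.
move=> h1; rewrite defect_newton; set h := defect z in h1 *.
rewrite rnormZ ger0_norm ?invr_ge0//.
have := rnormD (3%:C *: (h * h)) (h * h * h); rewrite rnormZ ger0_norm//.
have := rnormM (h * h) h; have := rnormM h h; have := rnorm_ge0 h.
set r := rnorm h in h1 *; set r2 := rnorm (h * h); set r3 := rnorm (h * h * h).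
nra.
Qed.

Lemma rnorm_defect_newton_sub z w : rnorm (defect z) <= 8^-1 -> rnorm (defect w) <= 8^-1 ->
  rnorm (defect (newton z) - defect (newton w)) <= 4^-1 * rnorm (defect z - defect w).
Proof.
move=> h1 h2; rewrite !defect_newton -scalerBr rnormZ ger0_norm ?invr_ge0//.
move: (defect z) (defect w) h1 h2 => h g h1 h2.
have sq : rnorm (h * h - g * g) <= 4^-1 * rnorm (h - g).
  have -> : h * h - g * g = h * (h - g) + (h - g) * g.
    by rewrite mulrBr mulrBl addrA subrK.
  have := rnormD (h * (h - g)) ((h - g) * g).
  have := rnormM h (h - g); have := rnormM (h - g) g.
  have := rnorm_ge0 (h - g); nra.
have cb : rnorm (h * h * h - g * g * g) <= 16^-1 * rnorm (h - g).
  have -> : h * h * h - g * g * g = h * h * (h - g) + (h * h - g * g) * g.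
    by rewrite mulrBr mulrBl addrA subrK.
  have := rnormD (h * h * (h - g)) ((h * h - g * g) * g).
  have := rnormM (h * h) (h - g); have := rnormM (h * h - g * g) g; have := rnormM h h.
  have := rnorm_ge0 (h - g); have := rnorm_ge0 (h * h - g * g).
  have := rnorm_ge0 h; have := rnorm_ge0 g.
  move: h1 h2 sq; set a := rnorm h; set b := rnorm g; set c := rnorm (h - g).
  set s := rnorm (h * h - g * g); set t := rnorm (h * h).
  move=> h1 h2 sq g0 a0 s0 c0 k1 k2 k3 k4.
  have : t <= 64^-1 by nra.
  nra.
have -> : 3%:C *: (h * h) + h * h * h - (3%:C *: (g * g) + g * g * g)
  = 3%:C *: (h * h - g * g) + (h * h * h - g * g * g).
  by rewrite opprD addrACA scalerBr.
have := rnormD (3%:C *: (h * h - g * g)) (h * h * h - g * g * g).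
rewrite rnormZ ger0_norm// => k; have := rnorm_ge0 (h - g); lra.
Qed.

Lemma rnorm_newton_sub z w : rnorm (defect z) <= 8^-1 -> rnorm (defect w) <= 8^-1 ->
  rnorm (newton z - newton w) <=
  (1 + 2^-1 * rnorm (defect z)) * rnorm (z - w) + 17 / 32 * rnorm (defect z - defect w).
Proof.
move=> h1 h2; have w1 := rnorm_defect h2.
rewrite /newton; move: (defect z) (defect w) h1 h2 => h g h1 h2.
have -> : z + 2^-1%:C *: (z * h) - (w + 2^-1%:C *: (w * g))
  = (z - w) + 2^-1%:C *: ((z - w) * h + w * (h - g)).
  rewrite opprD addrACA; congr (_ + _); rewrite -scalerBr; congr (_ *: _).
  by rewrite mulrBr mulrBl addrA subrK.
have := rnormD (z - w) (2^-1%:C *: ((z - w) * h + w * (h - g))).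
rewrite rnorm_half; have := rnormD ((z - w) * h) (w * (h - g)).
have := rnormM (z - w) h; have := rnormM w (h - g).
have := rnorm_ge0 (h - g); have := rnorm_ge0 (z - w); nra.
Qed.

Lemma newton_star z : newton (star z) = star (newton z).
Proof.
rewrite /newton starD starZr starM defect_star /defect starK.
by rewrite mulrBr mulrBl mulr1 mul1r mulrA.
Qed.

Lemma rnorm_defect_iter z n : rnorm (defect z) <= 8^-1 ->
  rnorm (defect (iter n newton z)) <= rnorm (defect z) * 8^-1 ^+ n.
Proof.
move=> hz; elim: n => [|n ih]; first by rewrite expr0 mulr1.
have hn : rnorm (defect (iter n newton z)) <= 8^-1.
  apply: (le_trans ih); apply: le_trans hz; apply: ler_piMr; first exact: rnorm_ge0.
  by apply: exprn_ile1; lra.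
rewrite iterS (le_trans (rnorm_defect_newton hn))//.
rewrite exprS mulrCA; apply: ler_wpM2l ih; lra.
Qed.

Lemma rnorm_defect_iter8 z n : rnorm (defect z) <= 8^-1 ->
  rnorm (defect (iter n newton z)) <= 8^-1.
Proof.
move=> hz; apply: (le_trans (rnorm_defect_iter n hz)); apply: le_trans hz.
by apply: ler_piMr; [exact: rnorm_ge0|apply: exprn_ile1; lra].
Qed.

(** The partial isometry of the polar decomposition of z, when z is almost an
    isometry. *)
Definition polar z := lim (iter n newton z @[n --> \oo]).

Lemma polar_cvg z : rnorm (defect z) <= 8^-1 ->
  iter n newton z @[n --> \oo] --> polar z /\
  rnorm (polar z - z) <= 2 * rnorm (defect z).
Proof.
move=> hz; have [n|l cl bl] := @cauchy_geometric (fun n => iter n newton z) (rnorm (defect z)).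
  rewrite iterS {1}/newton addrC addKr rnorm_half.
  have := rnorm_defect_iter n hz; have := rnorm_defect (rnorm_defect_iter8 n hz).
  set w := iter n newton z => w1 w2; have := rnormM w (defect w).
  have : 8^-1 ^+ n <= 2^-1 ^+ n :> R by apply: lerXn2r; rewrite ?nnegrE; lra.
  have := rnorm_ge0 (defect z); have := rnorm_ge0 (defect w).
  have : 0 <= (8^-1 : R) ^+ n by apply: exprn_ge0; lra.
  move: w1 w2; set p := _ ^+ n; set p' := _ ^+ n; set r := rnorm (defect w); set c := rnorm (defect z).
  set m := rnorm w; move=> w1 w2 p0 r0 c0 pp mr.
  have : m * r <= 17 / 16 * r by apply: ler_wpM2r.
  have : c * p <= c * p' by apply: ler_wpM2l.
  nra.
suff -> : polar z = l by [].
by apply/cvg_lim => //; exact: norm_hausdorff.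
Qed.

Lemma polar_id z : defect z = 0 -> polar z = z.
Proof.
move=> hz; have [|_ ] := @polar_cvg z; rewrite hz rnorm0 ?invr_ge0// mulr0 => h.
by apply/eqP; rewrite -subr_eq0; apply/eqP/rnorm_eq0/le_anti; rewrite h rnorm_ge0.
Qed.

Lemma polar_closed (B : A -> Prop) z : rnorm (defect z) <= 8^-1 ->
  closed B -> (forall w, B w -> B (newton w)) -> B z -> B (polar z).
Proof.
move=> hz cB nB Bz; have [cz _] := polar_cvg hz.
apply: (closed_cvg B cB _ _ cz).
by apply: nearW; elim=> //= n; exact: nB.
Qed.

Lemma polar_isometry z : rnorm (defect z) <= 8^-1 -> star (polar z) * polar z = 1.
Proof.
move=> hz; have [cz _] := polar_cvg hz.
have h1 : star (iter n newton z) * iter n newton z @[n --> \oo] --> star (polar z) * polar z.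
  by apply: cvg_cstarM => //; exact: cvg_star.
have h2 : star (iter n newton z) * iter n newton z @[n --> \oo] --> (1 : A).
  apply/cvg_rnormP => e e0.
  have hn : `|8^-1 : R| < 1 by rewrite ger0_norm ?invr_ge0// invf_lt1// ltr1n.
  have /cvgrPdist_lt/(_ _ e0) := cvg_expr hn; apply: filterS => n.
  rewrite sub0r normrN ger0_norm ?exprn_ge0 ?invr_ge0//; apply: le_lt_trans.
  apply: (le_trans (rnorm_defect_iter n hz)).
  by apply: ler_piMl; [apply: exprn_ge0; lra|lra].
exact: (cvg_unique _ h1 h2).
Qed.

(** As the iteration commutes with star, polar z is a co-isometry as soon as
    star z is almost an isometry. *)
Lemma polar_star z : rnorm (defect z) <= 8^-1 -> polar (star z) = star (polar z).
Proof.
move=> hz; have [cz _] := polar_cvg hz.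
apply/cvg_lim; first exact: norm_hausdorff.
have -> : (fun n => iter n newton (star z)) = fun n => star (iter n newton z).
  by apply/funext; elim=> //= n ->; rewrite newton_star.
exact: cvg_star.
Qed.

Lemma polar_unitary z : rnorm (defect z) <= 8^-1 -> rnorm (defect (star z)) <= 8^-1 ->
  unitary (polar z).
Proof.
move=> h1 h2; split; first exact: polar_isometry.
by have := polar_isometry h2; rewrite polar_star// starK.
Qed.

(** The differences of defects decay geometrically and feed the differences of
    iterates, hence a bound of the form 3 - 2 / 4^n along the iteration; its
    limit 3 is not optimal, but leaves room below 25 pi. *)
Lemma polar_lipschitz z w : rnorm (defect z) <= 8^-1 -> rnorm (defect w) <= 8^-1 ->
  rnorm (polar z - polar w) <= 3 * rnorm (z - w).
Proof.
move=> hz hw.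
have e0 : rnorm (defect z - defect w) <= 17 / 8 * rnorm (z - w).
  have -> : defect z - defect w = star w * (w - z) + star (w - z) * z.
    by rewrite /defect opprB addrC addrA subrK starB mulrBr mulrBl addrA subrK.
  have := rnormD (star w * (w - z)) (star (w - z) * z).
  have := rnormM (star w) (w - z); have := rnormM (star (w - z)) z.
  rewrite !rnorm_star rnormBC; have := rnorm_defect hz; have := rnorm_defect hw.
  have := rnorm_ge0 (z - w); nra.
have en n : rnorm (defect (iter n newton z) - defect (iter n newton w)) <=
    17 / 8 * rnorm (z - w) * 4^-1 ^+ n.
  elim: n => [|n ih]; first by rewrite expr0 mulr1.
  rewrite !iterS (le_trans (rnorm_defect_newton_sub _ _)) ?rnorm_defect_iter8//.
  by rewrite exprS mulrCA; apply: ler_wpM2l ih; lra.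
have dn n : rnorm (iter n newton z - iter n newton w) <=
    (3 - 2 * 4^-1 ^+ n) * rnorm (z - w).
  elim: n => [|n ih]; first by rewrite expr0 mulr1 /=; lra.
  rewrite !iterS (le_trans (rnorm_newton_sub _ _)) ?rnorm_defect_iter8//.
  have := en n; have := rnorm_defect_iter n hz; rewrite exprS.
  have p8 : (8^-1 : R) ^+ n <= 4^-1 ^+ n by apply: lerXn2r; rewrite ?nnegrE; lra.
  have p0 : 0 <= (8^-1 : R) ^+ n by apply: exprn_ge0; lra.
  move: (rnorm_ge0 (iter n newton z - iter n newton w)) (rnorm_ge0 (z - w)).
  move: (rnorm_ge0 (defect z)) hz ih p8 p0 => k0 hz ih p8 p0 d0 c0 hp ep.
  have hp' : rnorm (defect (iter n newton z)) <= 8^-1 * 4^-1 ^+ n.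
    by apply: (le_trans hp); apply: ler_pM.
  have hd : rnorm (defect (iter n newton z)) * rnorm (iter n newton z - iter n newton w)
      <= 8^-1 * 4^-1 ^+ n * (3 * rnorm (z - w)).
    apply: ler_pM => //; first exact: rnorm_ge0.
    apply: (le_trans ih); apply: ler_wpM2r => //.
    by rewrite gerBl mulr_ge0// exprn_ge0// invr_ge0.
  have pc : 0 <= 4^-1 ^+ n * rnorm (z - w).
    by apply: mulr_ge0 => //; exact: le_trans p0 p8.
  by move: hd ih ep pc; lra.
have [cz _] := polar_cvg hz; have [cw _] := polar_cvg hw.
apply/ler_addgt0Pr => e e1.
have e2 : 0 < e / 2 by lra.
move/cvg_rnormP/(_ _ e2) : cz => cz; move/cvg_rnormP/(_ _ e2) : cw => cw.
have [n [/= hn1 hn2]] := filter_ex (filterI cz cw).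
have -> : polar z - polar w = (polar z - iter n newton z) + (iter n newton z - iter n newton w) + (iter n newton w - polar w).
  by rewrite !addrA !subrK.
have := dn n; have := rnormD (polar z - iter n newton z + (iter n newton z - iter n newton w)) (iter n newton w - polar w).
have := rnormD (polar z - iter n newton z) (iter n newton z - iter n newton w).
rewrite [rnorm (iter n newton w - _)]rnormBC.
have : 0 <= (4^-1 : R) ^+ n by apply: exprn_ge0; lra.
have := rnorm_ge0 (z - w); nra.
Qed.

End Polar.

(** * Block matrices over families of partial isometries *)
Section Sandwich.
Variables (R : realType) (A : cstarAlgType R).
Implicit Types (a b c d x y z q : A).

(** The entry c of a matrix whose rows and columns are indexed by partial
    isometries: x and y play the role of column vectors. *)
Definition sandwich x c y := x * c * star y.

Lemma sandwichD x c d y : sandwich x (c + d) y = sandwich x c y + sandwich x d y.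
Proof. by rewrite /sandwich mulrDr mulrDl. Qed.

Lemma sandwichN x c y : sandwich x (- c) y = - sandwich x c y.
Proof. by rewrite /sandwich mulrN mulNr. Qed.

Lemma sandwich0 x y : sandwich x 0 y = 0.
Proof. by rewrite /sandwich mulr0 mul0r. Qed.

Lemma sandwichZ (k : R[i]) x c y : sandwich x (k *: c) y = k *: sandwich x c y.
Proof. by rewrite /sandwich -scalerAr -scalerAl. Qed.

Lemma star_sandwich x c y : star (sandwich x c y) = sandwich y (star c) x.
Proof. by rewrite /sandwich !starM starK mulrA. Qed.

Lemma sandwichM x c y x' c' y' q : star y * x' = q -> c * q = c ->
  sandwich x c y * sandwich x' c' y' = sandwich x (c * c') y'.
Proof.
move=> yx cq; rewrite /sandwich -!mulrA; congr (_ * _).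
by rewrite (mulrA (star y)) yx !mulrA cq.
Qed.

Lemma sandwichM0 x c y x' c' y' : star y * x' = 0 ->
  sandwich x c y * sandwich x' c' y' = 0.
Proof. by move=> yx; rewrite /sandwich -!mulrA (mulrA (star y)) yx mul0r !mulr0. Qed.

Lemma orthogonal_sandwich x c y x' c' y' : star x * x' = 0 -> star y * y' = 0 ->
  orthogonal (sandwich x c y) (sandwich x' c' y').
Proof. by move=> xx yy; split; rewrite star_sandwich sandwichM0. Qed.

Lemma rnorm_sandwich x c y : rnorm x <= 1 -> rnorm y <= 1 ->
  rnorm (sandwich x c y) <= rnorm c.
Proof.
move=> x1 y1; apply: (le_trans (rnormM _ _)); rewrite rnorm_star.
apply: (@le_trans _ _ (rnorm (x * c))); first by apply: ler_piMr; rewrite ?rnorm_ge0.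
by apply: (le_trans (rnormM _ _)); apply: ler_piMl; rewrite ?rnorm_ge0.
Qed.

(** Orthogonality of ranges, without a common initial projection: in this form it
    passes to the images under a star-homomorphism. *)
Definition ortho_pair (a b : nat -> A) :=
  [/\ forall i j, i != j -> star (a i) * a j = 0,
      forall i j, i != j -> star (b i) * b j = 0,
      forall i j, star (a i) * b j = 0,
      forall i, rnorm (a i) <= 1 & forall i, rnorm (b i) <= 1].

Lemma ortho_pairC (a b : nat -> A) : ortho_pair a b -> ortho_pair b a.
Proof.
move=> [h1 h2 h3 h4 h5]; split=> // i j.
by rewrite -[LHS]starK starM starK h3 star0.
Qed.

Lemma rnorm_diag (a b a' b' c e : nat -> A) n (M : R) :
  ortho_pair a b -> ortho_pair a' b' -> 0 <= M ->
  (forall k, (k < n)%N -> rnorm (c k) <= M) ->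
  (forall k, (k < n)%N -> rnorm (e k) <= M) ->
  rnorm (\sum_(k < n) (sandwich (a k) (c k) (a' k) + sandwich (b k) (e k) (b' k))) <= M.
Proof.
move=> ab ab' M0 cM eM.
have [a1 a2 a3 a4 a5] := ab; have [b1 b2 b3 b4 b5] := ab'.
apply: (@rnorm_orthogonal_sum _ _ _
  (fun k => sandwich (a k) (c k) (a' k) + sandwich (b k) (e k) (b' k))) => //.
  move=> k kn; apply: rnorm_orthogonal.
  - exact: orthogonal_sandwich.
  - exact: le_trans (rnorm_sandwich _ _ _) (cM k kn).
  - exact: le_trans (rnorm_sandwich _ _ _) (eM k kn).
have [_ _ a3' _ _] := ortho_pairC ab; have [_ _ b3' _ _] := ortho_pairC ab'.
move=> i j ij.
apply: orthogonalDr; apply/orthogonalC/orthogonalDr; apply/orthogonal_sandwich; rewrite ?(a1, a2, a3, b1, b2, b3, a3', b3')//;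
  by rewrite eq_sym.
Qed.

End Sandwich.

(** * The rotation homotopy from the identity to diag(v, star v) *)
Section Swindle.
Variables (R : realType) (A : cstarAlgType R).
Implicit Types (a b d : nat -> A) (q x y z : A) (s : R) (n : nat).

Definition isometric_pair q a b :=
  [/\ forall i j, star (a i) * a j = if i == j then q else 0,
      forall i j, star (b i) * b j = if i == j then q else 0,
      forall i j, star (a i) * b j = 0 & q * q = q].

Lemma isometric_pair_ortho q a b : isometric_pair q a b -> ortho_pair a b.
Proof.
move=> [h1 h2 h3 h4].
have qs : star q = q by have := h1 0%N 0%N; rewrite eqxx => <-; rewrite starM starK.
have q1 : rnorm q <= 1.
  have := rnorm_cstar q; rewrite qs h4 expr2.
  have := rnorm_ge0 q; nra.
have n1 x : star x * x = q -> rnorm x <= 1.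
  have := rnorm_ge0 x; have := rnorm_cstar x => + + xq; rewrite xq; nra.
split=> //.
- by move=> i j /negbTE ij; rewrite h1 ij.
- by move=> i j /negbTE ij; rewrite h2 ij.
- by move=> i; apply: n1; rewrite h1 eqxx.
- by move=> i; apply: n1; rewrite h2 eqxx.
Qed.

(** Dropping a 0 and exchanging the two sequences: the blocks of the second
    rotation homotopy are interlaced with those of the first. *)
Lemma isometric_pairS q a b : isometric_pair q a b ->
  isometric_pair q b (fun k => a k.+1).
Proof.
move=> [h1 h2 h3 h4]; split=> //.
- by move=> i j; rewrite h1 eqSS.
- by move=> i j; rewrite -[LHS]starK starM starK h3 star0.
Qed.

(** The equations for 1 + z to be unitary, with the unit cancelled: in this form
    they add up over orthogonal families. *)
Definition unitary_defect z :=
  star z * z = - (z + star z) /\ z * star z = - (z + star z).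

Lemma unitary_defectP z : unitary_defect z <-> unitary (1 + z).
Proof.
rewrite /unitary_defect /unitary /= starD star1 !mulrDl !mulrDr !mulr1 !mul1r.
have k (t : A) : (1 + z + (star z + t) = 1) <-> t = - (z + star z).
  split=> [h|->]; last by rewrite -(addrA 1) (addrA z) subrr addr0.
  have : z + star z + t = 0 by apply: (addrI 1); rewrite addr0 -[RHS]h !addrA.
  by move/eqP; rewrite addrC addr_eq0 => /eqP.
have k' (t : A) : (1 + star z + (z + t) = 1) <-> t = - (z + star z).
  by rewrite -k -!addrA (addrCA (star z)).
by have := k (star z * z); have := k' (z * star z); tauto.
Qed.

Definition corner_seq q d :=
  [/\ forall k, q * d k = d k, forall k, d k * q = d k & forall k, unitary_defect (d k)].

(** The 2 x 2 matrix with rows (p, r) and (t, w), in the block (x, y). *)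
Definition block2 (x y p r t w : A) :=
  sandwich x p x + sandwich x r y + sandwich y t x + sandwich y w y.

Lemma block2M q x y p r t w p' r' t' w' :
  star x * x = q -> star y * y = q -> star x * y = 0 -> star y * x = 0 ->
  p * q = p -> r * q = r -> t * q = t -> w * q = w ->
  block2 x y p r t w * block2 x y p' r' t' w' =
  block2 x y (p * p' + r * t') (p * r' + r * w') (t * p' + w * t') (t * r' + w * w').
Proof.
move=> xx yy xy yx pq rq tq wq; rewrite /block2 !mulrDl !mulrDr.
do 4 rewrite (sandwichM _ _ _ xx)// (sandwichM _ _ _ yy)//.
rewrite !(sandwichM0 _ _ _ _ xy) !(sandwichM0 _ _ _ _ yx) !addr0 !add0r !sandwichD.
by rewrite [X in X + _ + _]addrACA -(addrA _ (_ + _)) [X in _ + X]addrACA !addrA.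
Qed.

Lemma star_block2 x y p r t w :
  star (block2 x y p r t w) = block2 x y (star p) (star t) (star r) (star w).
Proof.
by rewrite /block2 !starD !star_sandwich; congr (_ + _); rewrite -!addrA; congr (_ + _); rewrite addrC.
Qed.

Lemma block2D x y p r t w p' r' t' w' : block2 x y p r t w + block2 x y p' r' t' w' =
  block2 x y (p + p') (r + r') (t + t') (w + w').
Proof.
rewrite /block2 !sandwichD addrACA; congr (_ + _); rewrite addrACA; congr (_ + _).
exact: addrACA.
Qed.

Lemma block2N x y p r t w : - block2 x y p r t w = block2 x y (- p) (- r) (- t) (- w).
Proof. by rewrite /block2 !sandwichN !opprD. Qed.

(** With c = sin^2 and e = sin cos of an angle, and v = 1 + z, this is
    diag(v, 1) rot diag(star v, 1) (star rot) - 1 where rot is the rotation by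
    that angle.  Written out it is linear in z and star z, so that it lies in
    every ideal that contains z, and vanishes with z. *)
Definition rot_block x y z (c e : R) :=
  block2 x y (c%:C *: z) (- (e%:C *: z)) (e%:C *: star z) (c%:C *: star z).

(** The hypothesis on c and e says that the point (c, e) lies on the circle of
    radius 1/2 and centre (1/2, 0), as sin^2 and sin cos do. *)
Lemma unitary_defect_rot_block q x y z (c e : R) :
  star x * x = q -> star y * y = q -> star x * y = 0 ->
  q * z = z -> z * q = z -> unitary_defect z -> c ^+ 2 + e ^+ 2 = c ->
  unitary_defect (rot_block x y z c e).
Proof.
move=> xx yy xy qz zq [z1 z2] ce.
have yx : star y * x = 0 by rewrite -[LHS]starK starM starK xy star0.
have qs : star q = q by rewrite -xx starM starK.
have qz' : q * star z = star z by rewrite -[RHS](congr1 star zq) starM qs.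
have zq' : star z * q = star z by rewrite -[RHS](congr1 star qz) starM qs.
have qq (k : R[i]) t : t * q = t -> (k *: t) * q = k *: t by move=> h; rewrite -scalerAl h.
have nq t : t * q = t -> (- t) * q = - t by move=> h; rewrite mulNr h.
have cC : c%:C * c%:C + e%:C * e%:C = c%:C :> R[i] by rewrite -!rmorphM -rmorphD /= -!expr2 ce.
rewrite /unitary_defect /rot_block star_block2 !(starN, starZr, starK) block2D block2N.
rewrite !(block2M _ _ _ _ xx yy xy yx); do ?by [|exact: qq|exact/nq/qq].
rewrite !(mulrN, mulNr, opprK) -!(scalerAl, scalerAr) !scalerA z1 z2.
rewrite ?[e%:C * c%:C]mulrC !subrr ?addNr -!scalerDl -!scalerDr cC.
rewrite -!scalerN !oppr0 [star z + z]addrC.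
split; congr block2.
all: by rewrite (addrC (e%:C * _)) cC.
Qed.

(** The diagonal and off-diagonal parts are separated because the parameter of
    the path only enters through one scalar factor in front of each. *)
Definition swindle_diag n a b d :=
  \sum_(k < n) (sandwich (a k) (d k) (a k) + sandwich (b k) (star (d k)) (b k)).
Definition swindle_off n a b d :=
  \sum_(k < n) (sandwich (b k) (star (d k)) (a k) + sandwich (a k) (- d k) (b k)).

Definition swindle n a b d s :=
  1 + ((1 - cos (pi * s)) / 2)%:C *: swindle_diag n a b d
    + (sin (pi * s) / 2)%:C *: swindle_off n a b d.

(** With the angle pi s / 2, sin^2 = (1 - cos (pi s)) / 2 and
    sin cos = sin (pi s) / 2. *)
Lemma swindle_blocks n a b d s : swindle n a b d s =
  1 + \sum_(k < n) rot_block (a k) (b k) (d k) ((1 - cos (pi * s)) / 2) (sin (pi * s) / 2).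
Proof.
rewrite /swindle -addrA; congr (_ + _).
rewrite !scaler_sumr -big_split /=; apply: eq_bigr => k _.
rewrite /rot_block /block2 !scalerDr -!sandwichZ scalerN -!addrA; congr (_ + _).
by rewrite [LHS]addrCA [X in _ + X = _]addrC [LHS]addrCA.
Qed.

Lemma orthogonal_rot_block q a b z w i j (c e : R) : isometric_pair q a b -> i != j ->
  orthogonal (rot_block (a i) (b i) z c e) (rot_block (a j) (b j) w c e).
Proof.
move=> ab ij; have [h1 h2 h3 _ _] := isometric_pair_ortho ab.
have [_ _ h4 _ _] := ortho_pairC (isometric_pair_ortho ab).
rewrite /rot_block /block2.
do ?[apply: orthogonalDr]; apply/orthogonalC; do ?[apply: orthogonalDr];
  apply/orthogonal_sandwich; rewrite ?(h3, h4)// ?h1 ?h2// eq_sym//.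
Qed.

Lemma unitary_orthogonal_sum n (F : nat -> A) :
  (forall k, (k < n)%N -> unitary_defect (F k)) ->
  (forall i j, i != j -> orthogonal (F i) (F j)) ->
  unitary (1 + \sum_(k < n) F k).
Proof.
move=> uF oF; apply/unitary_defectP.
have sE : star (\sum_(k < n) F k) = \sum_(k < n) star (F k).
  by elim/big_ind2: _ => [|? ? ? ? <- <-|//]; rewrite ?star0 ?starD.
split; rewrite sE -big_split -sumrN /=.
  rewrite (@mul_sum_diag _ _ _ (fun k => star (F k))); last by move=> i j /oF[].
  by apply: eq_bigr => k _; have [] := uF k (ltn_ord k).
rewrite (@mul_sum_diag _ _ _ _ (fun k => star (F k))); last by move=> i j /oF[].
by apply: eq_bigr => k _; have [] := uF k (ltn_ord k).
Qed.

Lemma swindle_unitary n q a b d s : isometric_pair q a b -> corner_seq q d ->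
  unitary (swindle n a b d s).
Proof.
move=> ab [qd dq ud]; rewrite swindle_blocks.
set c := (1 - cos _) / 2; set e := sin _ / 2.
apply: (@unitary_orthogonal_sum _ (fun k => rot_block (a k) (b k) (d k) c e)).
  move=> k _; have [h1 h2 h3 _] := ab.
  apply: (@unitary_defect_rot_block q); rewrite ?h1 ?h2 ?h3 ?eqxx//.
  by rewrite /c /e; have := cos2Dsin2 (pi * s); lra.
by move=> i j ij; exact: orthogonal_rot_block ab ij.
Qed.

Lemma swindle0 n a b d : swindle n a b d 0 = 1.
Proof. by rewrite /swindle mulr0 cos0 sin0 subrr !mul0r !scale0r !addr0. Qed.

Lemma swindle1 n a b d : swindle n a b d 1 = 1 + swindle_diag n a b d.
Proof.
rewrite /swindle mulr1 cospi sinpi opprK mul0r scale0r addr0.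
by rewrite (_ : (1 + 1) / 2 = 1) ?scale1r//; lra.
Qed.

Lemma rnorm_swindle_diag n a b d (M : R) : ortho_pair a b -> 0 <= M ->
  (forall k, (k < n)%N -> rnorm (d k) <= M) -> rnorm (swindle_diag n a b d) <= M.
Proof.
move=> ab M0 dM; apply: (@rnorm_diag _ _ a b a b d (fun k => star (d k))) => //.
by move=> k kn; rewrite rnorm_star dM.
Qed.

Lemma rnorm_swindle_off n a b d (M : R) : ortho_pair a b -> 0 <= M ->
  (forall k, (k < n)%N -> rnorm (d k) <= M) -> rnorm (swindle_off n a b d) <= M.
Proof.
move=> ab M0 dM; apply: (@rnorm_diag _ _ b a a b (fun k => star (d k)) (fun k => - d k)) => //.
- exact: ortho_pairC.
- by move=> k kn; rewrite rnorm_star dM.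
- by move=> k kn; rewrite rnormN dM.
Qed.

End Swindle.

(** * Two interlaced rotation homotopies *)
Section Trig.
Variable R : realType.

Lemma lipschitz_of_is_derive (f df : R -> R) (x y : R) :
  (forall z : R, is_derive z 1 f (df z)) -> (forall z, `|df z| <= 1) ->
  `|f x - f y| <= `|x - y|.
Proof.
move=> fd d1; wlog xy : x y / x <= y.
  by move=> h; case: (leP x y) => [|/ltW] /h //; rewrite distrC (distrC y).
have cf : {within `[x, y], continuous f}.
  apply: continuous_subspaceT => z; have [dz _] := fd z.
  by apply/differentiable_continuous/derivable1_diffP.
have [c _ fE] := MVT_segment xy (fun z _ => fd z) cf.
by rewrite distrC fE normrM distrC ler_piMl.
Qed.

Lemma lipschitz_sin (x y : R) : `|sin x - sin y| <= `|x - y|.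
Proof.
apply: lipschitz_of_is_derive => z.
by rewrite ler_norml cos_geN1 cos_le1.
Qed.

Lemma lipschitz_cos (x y : R) : `|cos x - cos y| <= `|x - y|.
Proof.
apply: (@lipschitz_of_is_derive _ (fun z => - sin z)) => z.
by rewrite normrN ler_norml sin_geN1 sin_le1.
Qed.

End Trig.

Lemma swindle_diag_regroup (V : zmodType) (u x xa xb ya yb p : V) :
  u + (yb + ya) + (x + (xa - (xa + ya)) + (xb + p)) = u + x + (xb + yb + p).
Proof.
rewrite opprD (addrA xa) subrr add0r -!(addrA u); congr (_ + _).
rewrite addrA [yb + ya + (_ + _)]addrACA subrr addr0 [yb + x]addrC -addrA; congr (_ + _).
by rewrite addrA [yb + xb]addrC.
Qed.

Section DoubleSwindle.
Variables (R : realType) (A : cstarAlgType R).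
Implicit Types (a b d : nat -> A) (q x y z : A) (s : R) (n : nat).

Lemma swindle_lipschitz n a b d s s' : ortho_pair a b ->
  (forall k, (k < n)%N -> rnorm (d k) <= 2) ->
  rnorm (swindle n a b d s - swindle n a b d s') <= 2 * pi * `|s - s'|.
Proof.
move=> ab d2; rewrite /swindle.
have -> : forall (u v w v' w' : A), u + v + w - (u + v' + w') = (v - v') + (w - w').
  by move=> u v w v' w'; rewrite opprD addrACA; congr (_ + _); rewrite opprD addrACA subrr add0r.
rewrite -!scalerBl -!rmorphB /=; apply: (le_trans (rnormD _ _)); rewrite !rnormZ.
have x2 := rnorm_swindle_diag ab (ler0n _ 2) d2.
have y2 := rnorm_swindle_off ab (ler0n _ 2) d2.
have p0 := pi_gt0 R.
have e : `|pi * s - pi * s'| = pi * `|s - s'| by rewrite -mulrBr normrM gtr0_norm.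
have h1 : `|(1 - cos (pi * s)) / 2 - (1 - cos (pi * s')) / 2| <= 2^-1 * (pi * `|s - s'|).
  have -> : (1 - cos (pi * s)) / 2 - (1 - cos (pi * s')) / 2 = 2^-1 * (cos (pi * s') - cos (pi * s)) by field.
  by rewrite normrM ger0_norm ?invr_ge0// ler_wpM2l ?invr_ge0// distrC -e lipschitz_cos.
have h2 : `|sin (pi * s) / 2 - sin (pi * s') / 2| <= 2^-1 * (pi * `|s - s'|).
  have -> : sin (pi * s) / 2 - sin (pi * s') / 2 = 2^-1 * (sin (pi * s) - sin (pi * s')) by field.
  by rewrite normrM ger0_norm ?invr_ge0// ler_wpM2l ?invr_ge0// -e lipschitz_sin.
have h3 := ler_pM (normr_ge0 _) (rnorm_ge0 _) h1 x2.
have h4 := ler_pM (normr_ge0 _) (rnorm_ge0 _) h2 y2.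
lra.
Qed.

Definition double_swindle n a b d s :=
  swindle n a b d s * swindle n b (fun k => a k.+1) (fun k => d k.+1) s.

Lemma unitary_rnorm x : unitary x -> rnorm x = 1.
Proof.
move=> [h _]; have := rnorm_cstar x; rewrite h rnorm1 => e.
have := rnorm_ge0 x; nra.
Qed.

Lemma unitaryM x y : unitary x -> unitary y -> unitary (x * y).
Proof.
move=> [x1 x2] [y1 y2]; split; rewrite starM.
  by rewrite mulrA -(mulrA _ (star x)) x1 mulr1.
by rewrite mulrA -(mulrA _ y) y2 mulr1.
Qed.

Lemma unitary_star x : unitary x -> unitary (star x).
Proof. by move=> [x1 x2]; split; rewrite starK. Qed.

Lemma corner_seqS q d : corner_seq q d -> corner_seq q (fun k => d k.+1).
Proof. by move=> [h1 h2 h3]; split. Qed.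

Lemma unitary_defect_norm z : unitary_defect z -> rnorm z <= 2.
Proof.
move=> /unitary_defectP /unitary_rnorm h.
have -> : z = (1 + z) - 1 by rewrite addrC addKr.
by rewrite (le_trans (rnormB _ _))// h rnorm1.
Qed.

Lemma double_swindle_unitary n q a b d s : isometric_pair q a b -> corner_seq q d ->
  unitary (double_swindle n a b d s).
Proof.
move=> ab qd; apply: unitaryM; first exact: swindle_unitary ab qd.
exact: swindle_unitary (isometric_pairS ab) (corner_seqS qd).
Qed.

Lemma mul_lipschitz (x x' y y' : A) (K K' : R) : rnorm x <= 1 -> rnorm y' <= 1 ->
  rnorm (x - x') <= K -> rnorm (y - y') <= K' -> rnorm (x * y - x' * y') <= K + K'.
Proof.
move=> x1 y1 hx hy.
have -> : x * y - x' * y' = (x - x') * y' + x * (y - y').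
  by rewrite mulrBr mulrBl [RHS]addrC addrA subrK.
apply: (le_trans (rnormD _ _)); apply: lerD.
  apply: (le_trans (rnormM _ _)); apply: (le_trans (ler_piMr _ y1)) => //; exact: rnorm_ge0.
apply: (le_trans (rnormM _ _)); apply: (le_trans (ler_piMl _ x1)) => //; exact: rnorm_ge0.
Qed.

Lemma double_swindle_lipschitz n q a b d s s' : isometric_pair q a b -> corner_seq q d ->
  rnorm (double_swindle n a b d s - double_swindle n a b d s') <= 4 * pi * `|s - s'|.
Proof.
move=> ab qd; have ab' := isometric_pairS ab; have qd' := corner_seqS qd.
have -> : 4 * pi * `|s - s'| = 2 * pi * `|s - s'| + 2 * pi * `|s - s'| by ring.
have [_ _ ud] := qd.
apply: mul_lipschitz.
- by rewrite (unitary_rnorm (swindle_unitary _ _ ab qd)).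
- by rewrite (unitary_rnorm (swindle_unitary _ _ ab' qd')).
- apply: swindle_lipschitz (isometric_pair_ortho ab) _ => k _; exact: unitary_defect_norm.
- apply: swindle_lipschitz (isometric_pair_ortho ab') _ => k _; exact: unitary_defect_norm.
Qed.

Lemma double_swindle0 n a b d : double_swindle n a b d 0 = 1.
Proof. by rewrite /double_swindle !swindle0 mulr1. Qed.

(** At the end of both homotopies the matrices are diagonal.  In the position of
    b_k the entries star v_k and v_{k+1} meet; in the position of a_{k+1} the
    entries v_{k+1} and star v_{k+1} meet and cancel; nothing meets v_0 in the
    position of a_0. *)
Lemma mul_diag_swindle n q a b d : isometric_pair q a b -> corner_seq q d -> d n = 0 ->
  (1 + swindle_diag n a b d) * (1 + swindle_diag n b (fun k => a k.+1) (fun k => d k.+1))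
  = 1 + sandwich (a 0) (d 0) (a 0) + \sum_(k < n)
    (sandwich (b k) (star (d k) + d k.+1 + star (d k) * d k.+1) (b k) +
     sandwich (a k.+1) 0 (a k.+1)).
Proof.
move=> ab [qd dq ud] dn; have [h1 h2 h3 qq] := ab.
have [_ _ h4 _] := isometric_pairS ab.
have qs : star q = q by have := h1 0%N 0%N; rewrite eqxx => <-; rewrite starM starK.
have dq' k : star (d k) * q = star (d k) by rewrite -[RHS](congr1 star (qd k)) starM qs.
pose Xa : A := \sum_(k < n) sandwich (a k.+1) (d k.+1) (a k.+1).
pose Xb : A := \sum_(k < n) sandwich (b k) (star (d k)) (b k).
pose Ya : A := \sum_(k < n) sandwich (a k.+1) (star (d k.+1)) (a k.+1).
pose Yb : A := \sum_(k < n) sandwich (b k) (d k.+1) (b k).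
pose X0 : A := sandwich (a 0) (d 0) (a 0).
have -> : swindle_diag n a b d = X0 + Xa + Xb.
  rewrite /swindle_diag big_split /=; congr (_ + _).
  have <- : \sum_(k < n.+1) sandwich (a k) (d k) (a k) = X0 + Xa by rewrite big_ord_recl.
  by rewrite big_ord_recr /= dn sandwich0 addr0.
have -> : swindle_diag n b (fun k => a k.+1) (fun k => d k.+1) = Yb + Ya.
  by rewrite /swindle_diag big_split.
have z0 (m : nat) (F G : nat -> A) : (forall i j, F i * G j = 0) ->
    (\sum_(i < n) F i) * (\sum_(j < m) G j) = 0.
  move=> FG; rewrite mulr_suml big1// => i _; rewrite mulr_sumr big1// => j _; exact: FG.
have e1 : X0 * Yb = 0.
  by rewrite mulr_sumr big1// => j _; apply: sandwichM0.
have e2 : X0 * Ya = 0.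
  by rewrite mulr_sumr big1// => j _; apply: sandwichM0; rewrite h1.
have e3 : Xa * Yb = 0.
  apply: (z0 n (fun k => sandwich (a k.+1) (d k.+1) (a k.+1)) (fun k => sandwich (b k) (d k.+1) (b k))) => i j.
  exact: sandwichM0.
have e4 : Xb * Ya = 0.
  apply: (z0 n (fun k => sandwich (b k) (star (d k)) (b k)) (fun k => sandwich (a k.+1) (star (d k.+1)) (a k.+1))) => i j.
  exact: sandwichM0.
have e5 : Xa * Ya = - (Xa + Ya).
  rewrite (@mul_sum_diag _ _ _ (fun k => sandwich (a k.+1) (d k.+1) (a k.+1)) (fun k => sandwich (a k.+1) (star (d k.+1)) (a k.+1))).
    rewrite -big_split -sumrN /=; apply: eq_bigr => k _.
    rewrite (@sandwichM _ _ _ _ _ _ _ _ q) ?h1 ?eqxx//.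
    by rewrite -sandwichD -sandwichN; have [_ ->] := ud k.+1.
  by move=> i j /negbTE ij; apply: sandwichM0; rewrite h1 eqSS ij.
have e6 : Xb * Yb = \sum_(k < n) sandwich (b k) (star (d k) * d k.+1) (b k).
  rewrite (@mul_sum_diag _ _ _ (fun k => sandwich (b k) (star (d k)) (b k)) (fun k => sandwich (b k) (d k.+1) (b k))).
    by apply: eq_bigr => k _; rewrite (@sandwichM _ _ _ _ _ _ _ _ q) ?h2 ?eqxx.
  by move=> i j /negbTE ij; apply: sandwichM0; rewrite h2 ij.
transitivity (1 + X0 + (Xb + Yb + Xb * Yb)).
  rewrite !(mulrDl, mulrDr) !mul1r !mulr1 e1 e2 e3 e4 e5 !addr0 add0r.
  exact: swindle_diag_regroup.
rewrite e6 -!big_split /=; congr (_ + _); apply: eq_bigr => k _.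
by rewrite sandwich0 addr0 !sandwichD.
Qed.

(** The entry star v_k * v_{k+1} - 1 has the norm of v_{k+1} - v_k, and the
    errors in different positions do not add up. *)
Lemma double_swindle1 n q a b d (e : R) : isometric_pair q a b -> corner_seq q d ->
  d n = 0 -> 0 <= e -> (forall k, (k < n)%N -> rnorm (d k.+1 - d k) <= e) ->
  rnorm (double_swindle n a b d 1 - (1 + sandwich (a 0) (d 0) (a 0))) <= e.
Proof.
move=> ab qd dn e0 de; rewrite /double_swindle !swindle1 (mul_diag_swindle ab qd dn).
rewrite addrC addKr; have [_ _ ud] := qd.
apply: (@rnorm_diag _ _ b (fun k => a k.+1) b (fun k => a k.+1)
  (fun k => star (d k) + d k.+1 + star (d k) * d k.+1) (fun=> 0)) => //.
- exact: isometric_pair_ortho (isometric_pairS ab).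
- exact: isometric_pair_ortho (isometric_pairS ab).
- move=> k kn; apply: le_trans (de k kn).
  have -> : star (d k) + d k.+1 + star (d k) * d k.+1 = star (1 + d k) * (d k.+1 - d k).
    rewrite starD star1 mulrDl mul1r mulrBr; have [-> _] := ud k.
    by rewrite opprK [star (d k) * _ + _]addrC [RHS]addrA [d k.+1 - _ + _]addrA subrK [d k.+1 + _]addrC.
  apply: (le_trans (rnormM _ _)); apply: ler_piMl; first exact: rnorm_ge0.
  by rewrite rnorm_star unitary_rnorm//; apply/unitary_defectP.
- by move=> k _; rewrite rnorm0.
Qed.

Lemma swindle_sub1 (J : A -> Prop) n a b d s :
  J 0 -> (forall x y, J x -> J y -> J (x + y)) -> (forall x y, J x -> J (y * x) /\ J (x * y)) ->
  (forall k, J (d k)) -> (forall k, J (star (d k))) ->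
  J (swindle n a b d s - 1).
Proof.
move=> J0 JD JM Jd Jd'.
have JZ (k : R[i]) x : J x -> J (k *: x).
  by move=> Jx; rewrite -[x]mul1r scalerAl; apply: (JM _ _ Jx).1.
have Js x c y : J c -> J (sandwich x c y).
  by move=> Jc; apply: (JM _ _ _).2; apply: (JM _ _ _).1.
have JS (F : nat -> A) : (forall k, J (F k)) -> J (\sum_(k < n) F k).
  by move=> JF; elim/big_ind: _ => // k _; exact: JF.
rewrite /swindle -(addrA 1) addrAC subrr add0r; apply: (JD); apply: (JZ).
  apply: (JS (fun k => sandwich (a k) (d k) (a k) + sandwich (b k) (star (d k)) (b k))) => k.
  by apply: (JD); apply: (Js).
apply: (JS (fun k => sandwich (b k) (star (d k)) (a k) + sandwich (a k) (- d k) (b k))) => k.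
apply: (JD); apply: (Js) => //.
by rewrite -scaleN1r; exact: JZ.
Qed.

End DoubleSwindle.

(** * Twisted commutators *)
Lemma rnorm_sum_le (R : realType) (A : cstarAlgType R) n (F : nat -> A) (e : R) :
  (forall k, (k < n)%N -> rnorm (F k) <= e) -> rnorm (\sum_(k < n) F k) <= e * n%:R.
Proof.
elim: n => [|n ih] Fe; first by rewrite big_ord0 rnorm0 mulr0.
rewrite big_ord_recr /= -natr1 mulrDr mulr1; apply: (le_trans (rnormD _ _)).
by apply: lerD (Fe n (leqnn _)); apply: ih => k kn; apply: Fe; rewrite ltnS ltnW.
Qed.

Section TwistedDerivation.
Variables (R : realType) (A : cstarAlgType R) (f : A -> A) (c : A).
Hypothesis fH : star_hom f.
Implicit Types (a b d : nat -> A) (x y z : A) (s M : R) (n : nat).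

(** With f the identity this is the commutator of z and c; with c = 1 it is
    f z - z.  Both kinds of estimates of the theorem are instances. *)
Definition twisted z := f z * c - c * z.

Lemma rnorm_star_hom z : rnorm (f z) <= rnorm z.
Proof. by rewrite -lecR -!rnormE; exact: star_hom_norm_le. Qed.

Lemma twistedD x y : twisted (x + y) = twisted x + twisted y.
Proof. by rewrite /twisted (star_homD fH) mulrDl mulrDr opprD addrACA. Qed.

Lemma twistedN x : twisted (- x) = - twisted x.
Proof. by rewrite /twisted (star_homN fH) mulNr mulrN opprB opprK addrC. Qed.

Lemma twistedB x y : twisted (x - y) = twisted x - twisted y.
Proof. by rewrite twistedD twistedN. Qed.

Lemma twistedZ (k : R[i]) x : twisted (k *: x) = k *: twisted x.
Proof. by rewrite /twisted (star_homZ fH) -scalerAl -scalerAr scalerBr. Qed.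

Lemma twisted1 : twisted 1 = 0.
Proof. by rewrite /twisted (star_hom1 fH) mul1r mulr1 subrr. Qed.

Lemma twisted0 : twisted 0 = 0.
Proof. by rewrite /twisted (star_hom0 fH) mul0r mulr0 subrr. Qed.

Lemma twistedM x y : twisted (x * y) = f x * twisted y + twisted x * y.
Proof. by rewrite /twisted (star_homM fH) mulrBr mulrBl !mulrA addrA subrK. Qed.

Lemma rnorm_twisted_le x : rnorm (twisted x) <= 2 * rnorm c * rnorm x.
Proof.
apply: (le_trans (rnormB _ _)).
have := rnormM (f x) c; have := rnormM c x; have := rnorm_star_hom x.
have := rnorm_ge0 c; nra.
Qed.

Lemma rnorm_twistedM x y : rnorm x <= 1 -> rnorm y <= 1 ->
  rnorm (twisted (x * y)) <= rnorm (twisted x) + rnorm (twisted y).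
Proof.
move=> x1 y1; rewrite twistedM addrC; apply: (le_trans (rnormD _ _)); apply: lerD.
  apply: (le_trans (rnormM _ _)); apply: ler_piMr => //; exact: rnorm_ge0.
apply: (le_trans (rnormM _ _)); apply: ler_piMl; first exact: rnorm_ge0.
exact: le_trans (rnorm_star_hom _) x1.
Qed.

(** star x * x = 1 expresses the value at star x through the value at x; for
    elements that are not unitary there is no such relation. *)
Lemma rnorm_twisted_star x : unitary x -> rnorm (twisted (star x)) <= rnorm (twisted x).
Proof.
move=> ux; have [x1 x2] := ux.
have -> : twisted (star x) = - (f (star x) * twisted x * star x).
  rewrite /twisted mulrBr mulrBl opprB !mulrA -(star_homM fH) x1 (star_hom1 fH) mul1r.
  by rewrite -!mulrA x2 mulr1.
have u1 := unitary_rnorm (unitary_star ux).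
rewrite rnormN; apply: (le_trans (rnormM _ _)); rewrite u1 mulr1.
apply: (le_trans (rnormM _ _)); apply: ler_piMl; first exact: rnorm_ge0.
by apply: (le_trans (rnorm_star_hom _)); rewrite u1.
Qed.

Lemma twisted_sandwich x (d : A) y : twisted (sandwich x d y) =
  sandwich (f x) (twisted d) y + (f x * f d * twisted (star y) + twisted x * d * star y).
Proof.
rewrite /sandwich twistedM twistedM (star_homM fH) mulrDl.
by rewrite addrCA addrA.
Qed.

Lemma rnorm_twisted_sandwich_err x (d : A) y e : rnorm x <= 1 -> rnorm y <= 1 -> rnorm d <= 2 ->
  rnorm (twisted x) <= e -> rnorm (twisted (star y)) <= e ->
  rnorm (f x * f d * twisted (star y) + twisted x * d * star y) <= 4 * e.
Proof.
move=> x1 y1 d2 xe ye; apply: (le_trans (rnormD _ _)).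
have h1 : rnorm (f x * f d * twisted (star y)) <= 2 * e.
  apply: (le_trans (rnormM _ _)); apply: ler_pM => //; rewrite ?rnorm_ge0//.
  apply: (le_trans (rnormM _ _)); rewrite -[2]mul1r; apply: ler_pM; rewrite ?rnorm_ge0//.
    exact: le_trans (rnorm_star_hom _) x1.
  exact: le_trans (rnorm_star_hom _) d2.
have h2 : rnorm (twisted x * d * star y) <= 2 * e.
  apply: (le_trans (rnormM _ _)); rewrite rnorm_star.
  apply: (@le_trans _ _ (rnorm (twisted x * d))).
    by apply: ler_piMr => //; exact: rnorm_ge0.
  by apply: (le_trans (rnormM _ _)); rewrite mulrC; apply: ler_pM; rewrite ?rnorm_ge0.
lra.
Qed.

Definition nearly_fixed (e : R) x := rnorm (twisted x) <= e /\ rnorm (twisted (star x)) <= e.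

(** The Leibniz rule splits every entry into a main term, which is again block
    diagonal (for the families f a_k, f b_k on the left), and an error in
    which an almost fixed factor occurs.  Only the errors add up with n. *)
Lemma rnorm_twisted_diag a b a' b' (d g : nat -> A) n M e :
  ortho_pair a b -> ortho_pair a' b' -> 0 <= M ->
  (forall k, (k < n)%N -> nearly_fixed e (a k) /\ nearly_fixed e (b k)) ->
  (forall k, (k < n)%N -> nearly_fixed e (a' k) /\ nearly_fixed e (b' k)) ->
  (forall k, (k < n)%N -> rnorm (d k) <= 2 /\ rnorm (g k) <= 2) ->
  (forall k, (k < n)%N -> rnorm (twisted (d k)) <= M /\ rnorm (twisted (g k)) <= M) ->
  rnorm (twisted (\sum_(k < n) (sandwich (a k) (d k) (a' k) + sandwich (b k) (g k) (b' k))))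
  <= M + 8 * e * n%:R.
Proof.
move=> ab ab' M0 ae ae' d2 dM.
have sumE (F : nat -> A) : twisted (\sum_(k < n) F k) = \sum_(k < n) twisted (F k).
  by elim/big_ind2: _ => [|? ? ? ? <- <-|//]; rewrite ?twisted0 ?twistedD.
rewrite (sumE (fun k => sandwich (a k) (d k) (a' k) + sandwich (b k) (g k) (b' k))).
pose E x (d : A) y := f x * f d * twisted (star y) + twisted x * d * star y.
have -> : \sum_(k < n) twisted (sandwich (a k) (d k) (a' k) + sandwich (b k) (g k) (b' k)) =
  \sum_(k < n) (sandwich (f (a k)) (twisted (d k)) (a' k) + sandwich (f (b k)) (twisted (g k)) (b' k))
  + \sum_(k < n) (E (a k) (d k) (a' k) + E (b k) (g k) (b' k)).
  rewrite -big_split /=; apply: eq_bigr => k _.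
  by rewrite twistedD !twisted_sandwich addrACA.
apply: (le_trans (rnormD _ _)); apply: lerD.
  have [h1 h2 h3 h4 h5] := ab.
  have fs x y : star x * y = 0 -> star (f x) * f y = 0.
    by move=> xy; rewrite -(star_hom_star fH) -(star_homM fH) xy (star_hom0 fH).
  apply: (@rnorm_diag _ _ (f \o a) (f \o b) a' b' (twisted \o d) (twisted \o g)) => //.
  - split=> *; rewrite /=; try (by apply: fs; auto); exact: le_trans (rnorm_star_hom _) _.
  - by move=> k /dM[].
  - by move=> k /dM[].
have [_ _ _ a1 b1] := ab; have [_ _ _ a1' b1'] := ab'.
apply: (@rnorm_sum_le _ _ n (fun k => E (a k) (d k) (a' k) + E (b k) (g k) (b' k))) => k kn.
have [[h1 h2] [h3 h4]] := ae k kn.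
have [[h1' h2'] [h3' h4']] := ae' k kn.
have [d2k g2k] := d2 k kn.
apply: (le_trans (rnormD _ _)).
have := rnorm_twisted_sandwich_err (a1 k) (a1' k) d2k h1 h2'.
have := rnorm_twisted_sandwich_err (b1 k) (b1' k) g2k h3 h4'.
rewrite -/(E _ _ _) -/(E _ _ _); lra.
Qed.

Lemma rnorm_twisted_swindle n a b d s M e : ortho_pair a b -> 0 <= M ->
  (forall k, (k < n)%N -> nearly_fixed e (a k) /\ nearly_fixed e (b k)) ->
  (forall k, (k < n)%N -> rnorm (d k) <= 2) ->
  (forall k, (k < n)%N -> nearly_fixed M (d k)) ->
  rnorm (twisted (swindle n a b d s)) <= 2 * (M + 8 * e * n%:R).
Proof.
move=> ab M0 ae d2 dM.
have h1 : rnorm (twisted (swindle_diag n a b d)) <= M + 8 * e * n%:R.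
  apply: (@rnorm_twisted_diag _ _ _ _ d (fun k => star (d k))) => //.
  by move=> k /d2 h; rewrite rnorm_star.
have h2 : rnorm (twisted (swindle_off n a b d)) <= M + 8 * e * n%:R.
  apply: (@rnorm_twisted_diag b a a b (fun k => star (d k)) (fun k => - d k)) => //.
  - exact: ortho_pairC.
  - by move=> k /ae[].
  - by move=> k /d2 h; rewrite rnormN rnorm_star.
  - by move=> k /dM[? ?]; rewrite twistedN rnormN.
have c1 : `|(1 - cos (pi * s)) / 2| <= 1.
  by rewrite ler_norml; have := cos_le1 (pi * s); have := cos_geN1 (pi * s); lra.
have s1 : `|sin (pi * s) / 2| <= 1.
  by rewrite ler_norml; have := sin_le1 (pi * s); have := sin_geN1 (pi * s); lra.
rewrite /swindle !twistedD twisted1 add0r !twistedZ.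
apply: (le_trans (rnormD _ _)); rewrite !rnormZ mulr_natl mulr2n; apply: lerD.
  by rewrite -[X in _ <= X]mul1r; apply: ler_pM; rewrite ?rnorm_ge0.
by rewrite -[X in _ <= X]mul1r; apply: ler_pM; rewrite ?rnorm_ge0.
Qed.

Lemma rnorm_twisted_double_swindle n q a b d s M e :
  isometric_pair q a b -> corner_seq q d -> 0 <= M ->
  (forall k, (k <= n)%N -> nearly_fixed e (a k) /\ nearly_fixed e (b k)) ->
  (forall k, (k <= n)%N -> nearly_fixed M (d k)) ->
  rnorm (twisted (double_swindle n a b d s)) <= 4 * (M + 8 * e * n%:R).
Proof.
move=> ab qd M0 ae dM; have ab' := isometric_pairS ab; have qd' := corner_seqS qd.
have [_ _ ud] := qd.
have h1 : rnorm (twisted (swindle n a b d s)) <= 2 * (M + 8 * e * n%:R).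
  apply: rnorm_twisted_swindle => //; first exact: isometric_pair_ortho ab.
  - by move=> k /ltnW /ae.
  - by move=> k _; exact: unitary_defect_norm.
  - by move=> k /ltnW /dM.
have h2 : rnorm (twisted (swindle n b (fun k => a k.+1) (fun k => d k.+1) s)) <= 2 * (M + 8 * e * n%:R).
  apply: rnorm_twisted_swindle => //; first exact: isometric_pair_ortho ab'.
  - by move=> k kn; split; [have [] := ae k (ltnW kn)|have [] := ae k.+1 kn].
  - by move=> k _; exact: unitary_defect_norm.
  - by move=> k /dM.
apply: (le_trans (rnorm_twistedM _ _)); last by lra.
  by rewrite (unitary_rnorm (swindle_unitary _ _ ab qd)).
by rewrite (unitary_rnorm (swindle_unitary _ _ ab' qd')).
Qed.

End TwistedDerivation.

(** * Locally finite sums, choice of parameters, compactness *)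
Lemma continuous_comp_within (S T U : topologicalType) (D : set T) (f : T -> U) (g : S -> T) :
  {within D, continuous f} -> continuous g -> (forall s, D (g s)) -> continuous (f \o g).
Proof.
move=> /subspace_continuousP cf cg Dg s.
apply: cvg_trans (cf _ (Dg s)) => P /= hP; rewrite /nbhs /=.
have := cg s _ hP; rewrite /nbhs /=; apply: filterS => u /=; apply; exact: Dg.
Qed.

(** The number of steps of the partition varies with t, but a change of it only
    adds or removes zero terms. *)
Lemma continuous_locally_finite_sum (T : topologicalType) (K : numFieldType)
    (V : normedModType K) (F : nat -> T -> V) (N : T -> nat) :
  (forall k, continuous (F k)) -> (forall k p, (N p <= k)%N -> F k p = 0) ->
  (forall p : T, exists m : nat, \forall p' \near p, (N p' <= m)%N) ->
  continuous (fun p => \sum_(k < N p) F k p).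
Proof.
move=> cF F0 bN p; have [m hm] := bN p.
have ext p' : (N p' <= m)%N -> \sum_(k < N p') F k p' = \sum_(k < m) F k p'.
  move=> pm; rewrite -!(big_mkord xpredT (fun k => F k p')) [RHS](@big_cat_nat _ _ _ (N p'))//=.
  by rewrite [X in _ + X]big_nat_cond [X in _ + X]big1 ?addr0// => k /andP[/andP[/F0]].
have cm : continuous (fun p => \sum_(k < m) F k p).
  clear hm ext; elim: m => [|m ih].
    have -> : (fun p => \sum_(k < 0) F k p) = cst 0 by apply/funext => q; rewrite big_ord0.
    by move=> q; exact: cvg_cst.
  have -> : (fun p => \sum_(k < m.+1) F k p) = (fun p => \sum_(k < m) F k p + F m p).
    by apply/funext => q; rewrite big_ord_recr.
  by move=> q; apply: cvgD; [exact: ih|exact: cF].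
suff : \sum_(k < N p') F k p' @[p' --> p] --> \sum_(k < N p) F k p by [].
rewrite [X in _ --> X]ext; last exact: nbhs_singleton hm.
apply: cvg_trans (cm p); apply: near_eq_cvg.
by apply: filterS hm => p' /ext ->.
Qed.

Section Reparametrization.
Variable R : realType.

(** Equal to 1 for t >= k - 1 and to 0 for t <= k - 2. *)
Definition ramp (k : nat) (t : R) : R := Num.min 1 (Num.max 0 (t - k%:R + 2)).

Lemma ramp_continuous k : continuous (ramp k).
Proof.
move=> t; apply: (@continuous_min R R (cst 1) (fun t => Num.max 0 (t - k%:R + 2))).
  exact: cvg_cst.
apply: (@continuous_max R R (cst 0) (fun t => t - k%:R + 2)); first exact: cvg_cst.
by apply: cvgD; [apply: cvgB; [exact: cvg_id|exact: cvg_cst]|exact: cvg_cst].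
Qed.

(** A locally bounded requirement on how large T must be in terms of t can be
    met by a continuous function of t: sum ramps whose heights bound the
    requirements on [0, m]. *)
Lemma reparametrization (Q : R -> R -> Prop) :
  (forall m : nat, \forall T \near +oo, forall t, 0 <= t -> t <= m%:R -> Q t T) ->
  exists tau : R -> R, continuous tau /\ forall t, 0 <= t -> Q t (tau t).
Proof.
move=> hQ.
have {hQ} /choice[c hc] : forall m : nat, exists c : R, 0 < c /\
    forall T, c <= T -> forall t, 0 <= t -> t <= m%:R -> Q t T.
  move=> m; have [c [cr hc]] := hQ m; exists (`|c| + 1); split.
    by rewrite ltr_wpDl.
  by move=> T cT; apply: hc; have := ler_norm c; lra.
pose N (t : R) := (Num.trunc t).+3.
pose F k t := c k * ramp k t.
have trlt (t : R) : t < (Num.trunc t).+1%:R.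
  by rewrite -truncn_le_nat.
exists (fun t => \sum_(k < N t) F k t); split.
  apply: (@continuous_locally_finite_sum R R R F N).
  - by move=> k t; apply: cvgM; [exact: cvg_cst|exact: ramp_continuous].
  - move=> k t kt; rewrite /F /ramp; have := trlt t.
    have : ((Num.trunc t).+3)%:R <= k%:R :> R by rewrite ler_nat.
    rewrite (_ : (Num.trunc t).+3%:R = (Num.trunc t).+1%:R + 2 :> R); last by rewrite -natrD addn2.
    move=> h1 h2.
    have -> : Num.max 0 (t - k%:R + 2) = 0 by apply/max_idPl; lra.
    by rewrite (min_idPr _) ?mulr0//; lra.
  - move=> t; exists (N (t + 1)); near=> t'.
    rewrite /N !ltnS le_truncn//; near: t'.
    by exists 1 => //= t' /=; rewrite ltr_norml => /andP[? ?]; lra.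
move=> t t0; pose m := (Num.trunc t).+1.
have tm : t <= m%:R by exact: ltW (trlt t).
apply: (hc m).2 => //.
have F0 k : 0 <= F k t.
  apply: mulr_ge0; first exact: ltW (hc k).1.
  by rewrite /ramp le_min ler01 le_max lexx.
have mN : (m < N t)%N by rewrite /m /N.
rewrite (bigD1 (Ordinal mN))//= [X in X <= _](_ : _ = F m t).
  by rewrite lerDl sumr_ge0.
rewrite /F /ramp (_ : Num.min _ _ = 1) ?mulr1//.
apply/min_idPl; rewrite le_max; apply/orP; right.
have := t0; rewrite -(@truncn_le R) /m -natr1; lra.
Unshelve. all: by end_near. Qed.

End Reparametrization.

Section Compactness.
Variables (R : realType) (A : cstarAlgType R).

Definition box (m : nat) : set (R * R) := `[0, 1] `*` `[0, m%:R].

Lemma box_compact m : compact (box m).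
Proof. by apply: compact_setX; exact: segment_compact. Qed.

(** Compactness of the box in the form of a tube lemma: the neighbourhoods of
    its points and the neighbourhoods of infinity are found together. *)
Lemma uniformly_continuous_box (x : R * R -> A) (m : nat) (e : R) : continuous x -> 0 < e ->
  \forall T \near +oo, forall t, 0 <= t -> t <= m%:R -> forall s s', 0 <= s <= 1 ->
    `|s - s'| <= T^-1 -> rnorm (x (s, t) - x (s', t)) <= e.
Proof.
move=> cx e0.
pose P (T : R) (p : R * R) := forall s', `|p.1 - s'| <= T^-1 ->
  rnorm (x p - x (s', p.2)) <= e.
suff : \forall T \near +oo, box m `<=` P T.
  apply: filterS => T h t t0 tm s s' s01 ss'; apply: (h (s, t)) => //.
  by split; rewrite /= in_itv /= ?s01 ?t0 ?tm.
apply: ((compact_near_coveringP (box m)).1 (@box_compact m) _ (pinfty_nbhs R) P _).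
move=> p _.
have e2 : 0 < e / 2 by lra.
have /cvg_rnormP/(_ _ e2)/nbhs_ballP[r /= r0 hr] := cx p.
have r2 : 0 < r / 2 by lra.
exists (ball p (r / 2), [set T | 2 / r < T]) => /=.
  split; first exact: nbhsx_ballx.
  by exists (2 / r); split; [exact: num_real|].
move=> [q T] /= [[q1 q2] rT] s' qs.
have h1 : rnorm (x p - x q) < e / 2.
  by apply: hr; split; [apply: le_ball q1|apply: le_ball q2]; lra.
have h2 : rnorm (x p - x (s', q.2)) < e / 2.
  apply: hr; split; last by apply: le_ball q2; lra.
  move: q1; rewrite /ball /= => q1.
  have rT' : T^-1 < r / 2.
    have r20 : 0 < 2 / r by apply: divr_gt0.
    by rewrite -[r / 2]invrK invf_div ltf_pV2 ?posrE//; exact: lt_trans rT.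
  have := ler_normD (p.1 - q.1) (q.1 - s'); rewrite addrA subrK; lra.
have -> : x q - x (s', q.2) = (x p - x (s', q.2)) - (x p - x q).
  by rewrite opprB [RHS]addrC addrA subrK.
by apply: (le_trans (rnormB _ _)); lra.
Qed.

Lemma uniformly_commuting_box (x : R * R -> A) (a : R -> A) (m : nat) (e : R) :
  continuous x -> 0 < e -> (forall T, rnorm (a T) <= 1) ->
  (forall z, commutator (a T) z @[T --> +oo] --> (0 : A)) ->
  \forall T \near +oo, forall t, 0 <= t -> t <= m%:R -> forall s, 0 <= s <= 1 ->
    rnorm (commutator (a T) (x (s, t))) <= e.
Proof.
move=> cx e0 a1 az.
pose P (T : R) (p : R * R) := rnorm (commutator (a T) (x p)) <= e.
suff : \forall T \near +oo, box m `<=` P T.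
  apply: filterS => T h t t0 tm s s01; apply: (h (s, t)).
  by split; rewrite /= in_itv /= ?s01 ?t0 ?tm.
apply: ((compact_near_coveringP (box m)).1 (@box_compact m) _ (pinfty_nbhs R) P _).
move=> p _.
have e4 : 0 < e / 4 by lra.
have /cvg_rnormP/(_ _ e4) hx := cx p.
have /cvg_rnormP/(_ _ e4) ha := az (x p).
exists ([set q | rnorm (x p - x q) < e / 4], [set T | rnorm (0 - commutator (a T) (x p)) < e / 4]) => //.
move=> [q T] /= [xq aT]; rewrite /P.
rewrite sub0r rnormN in aT.
have -> : commutator (a T) (x q) = commutator (a T) (x p) - (a T * (x p - x q) - (x p - x q) * a T).
  rewrite /commutator mulrBr mulrBl opprB 2!(addrA (a T * x p - _)) subrK.
  by rewrite opprB [RHS]addrC addrA subrK.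
apply: (le_trans (rnormB _ _)).
have := rnormB (a T * (x p - x q)) ((x p - x q) * a T).
have := rnormM (a T) (x p - x q); have := rnormM (x p - x q) (a T).
have := a1 T; have := rnorm_ge0 (x p - x q); nra.
Qed.

End Compactness.

(** * Asymptotically central functions *)
Section CentralFamilies.
Variables (R : realType) (A : cstarAlgType R) (G : groupType) (alpha : G -> starAut A).
Implicit Types (i : A + G) (v w : R -> A).

(** An index is either an element of A, standing for the commutator with it, or
    an element of the group. *)
Definition twist_map i : A -> A := match i with inl _ => id | inr g => alpha g end.
Definition twist_elt i : A := match i with inl z => z | inr _ => 1 end.

Lemma twist_map_star_hom i : star_hom (twist_map i).
Proof. by case: i => [z|g] /=; [split|exact: aut_star_hom]. Qed.

Local Notation twist i := (twisted (twist_map i) (twist_elt i)).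

Definition central w := forall i, twist i (w T) @[T --> +oo] --> (0 : A).

Lemma cvg_rnorm0P (T : Type) (F : set_system T) (FF : Filter F) (f : T -> A) :
  f x @[x --> F] --> (0 : A) <-> forall e : R, 0 < e -> \forall x \near F, rnorm (f x) < e.
Proof.
rewrite cvg_rnormP; split=> h e /h; apply: filterS => x; by rewrite sub0r rnormN.
Qed.

Lemma cvg0_bound (T : Type) (F : set_system T) (FF : Filter F) (f : T -> A) (h : T -> R) :
  h x @[x --> F] --> 0 -> (\forall x \near F, rnorm (f x) <= h x) -> f x @[x --> F] --> (0 : A).
Proof.
move=> /cvgrPdist_lt h0 fh; apply/cvg_rnorm0P => e e0.
near=> x; apply: (@le_lt_trans _ _ (h x)); first by near: x.
apply: le_lt_trans (ler_norm _) _; rewrite -[h x]opprK normrN -[- h x]add0r.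
by near: x; exact: h0.
Unshelve. all: by end_near. Qed.

Lemma cvg0_rnorm (T : Type) (F : set_system T) (FF : Filter F) (f : T -> A) :
  f x @[x --> F] --> (0 : A) -> rnorm (f x) @[x --> F] --> (0 : R).
Proof.
move=> /cvg_rnorm0P f0; apply/cvgrPdist_lt => e e0; near=> x.
by rewrite sub0r normrN ger0_norm ?rnorm_ge0//; near: x; exact: f0.
Unshelve. all: by end_near. Qed.

Lemma central_approx v w : central v -> v T - w T @[T --> +oo] --> (0 : A) -> central w.
Proof.
move=> cv vw i.
have c0 := rnorm_ge0 (twist_elt i).
apply: (@cvg0_bound _ _ _ _ (fun T => rnorm (twist i (v T)) + 2 * rnorm (twist_elt i) * rnorm (v T - w T))).
  rewrite -[0 in X in _ --> X]addr0; apply: cvgD; first exact: cvg0_rnorm (cv i).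
  rewrite -[0 in X in _ --> X](mulr0 (2 * rnorm (twist_elt i))).
  by apply: cvgM; [exact: cvg_cst|exact: cvg0_rnorm vw].
apply: nearW => T; have fH := twist_map_star_hom i.
have e : w T = v T - (v T - w T) by rewrite opprB addrC subrK.
rewrite [X in rnorm (twisted _ _ X) <= _]e twistedB//; apply: (le_trans (rnormB _ _)); apply: lerD => //.
exact: rnorm_twisted_le.
Qed.

Lemma central_mul v w : (forall T, rnorm (v T) <= 1) -> (forall T, rnorm (w T) <= 1) ->
  central v -> central w -> central (fun T => v T * w T).
Proof.
move=> v1 w1 cv cw i.
apply: (@cvg0_bound _ _ _ _ (fun T => rnorm (twist i (v T)) + rnorm (twist i (w T)))).
  rewrite -[0 in X in _ --> X]addr0; apply: cvgD; first exact: cvg0_rnorm (cv i).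
  exact: cvg0_rnorm (cw i).
apply: nearW => T; apply: rnorm_twistedM => //; exact: twist_map_star_hom.
Qed.

Lemma central1 : central (fun=> 1).
Proof. by move=> i; rewrite twisted1; [exact: cvg_cst|exact: twist_map_star_hom]. Qed.

(** The index set is stable under the adjoint: the commutator of star w with z
    is, up to sign, the adjoint of that of w with star z. *)
Lemma central_star w : central w -> central (fun T => star (w T)).
Proof.
move=> cw i; pose j : A + G := match i with inl z => inl (star z) | inr g => inr g end.
apply: (@cvg0_bound _ _ _ _ (fun T => rnorm (twist j (w T)))); first exact: cvg0_rnorm (cw j).
apply: nearW => T; rewrite -(rnorm_star (twist j _)) /j.
case: i {j} => [z|g]; rewrite /twisted /=.
  by rewrite starB !starM starK -rnormN opprB.
by rewrite !mulr1 !mul1r starB (star_hom_star (aut_star_hom (alpha g))).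
Qed.

End CentralFamilies.

Notation twist alpha i := (twisted (twist_map alpha i) (twist_elt i)).

Section ShiftIsometries.
Variables (R : realType) (A : cstarAlgType R).
Implicit Types (s : A) (k : nat).

(** s1^k s0 is a sequence of isometries with orthogonal ranges, and the last
    factor s0 or s1 splits it into two such sequences.  Two isometries suffice
    to produce infinitely many. *)
Lemma isometric_pair_shift (s0 s1 : A) :
  star s0 * s0 = 1 -> star s1 * s1 = 1 -> star s0 * s1 = 0 ->
  isometric_pair 1 (fun k => s1 ^+ k * s0 * s0) (fun k => s1 ^+ k * s0 * s1).
Proof.
move=> h0 h1 h01.
have h10 : star s1 * s0 = 0 by rewrite -[LHS]starK starM starK h01 star0.
have v i j : star (s1 ^+ i * s0) * (s1 ^+ j * s0) = if i == j then 1 else 0.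
  elim: i j => [|i ih] [|j].
  - by rewrite !expr0 !mul1r.
  - by rewrite expr0 mul1r exprS -!mulrA (mulrA (star s0)) h01 mul0r.
  - by rewrite expr0 mul1r exprS -!mulrA starM -mulrA h10 mulr0.
  - rewrite eqSS -ih.
    have -> : star (s1 ^+ i.+1 * s0) * (s1 ^+ j.+1 * s0) =
        star (s1 ^+ i * s0) * (star s1 * s1) * (s1 ^+ j * s0).
      by rewrite !exprS -(mulrA s1) starM !mulrA.
    by rewrite h1 mulr1.
have key x y i j : star (s1 ^+ i * s0 * x) * (s1 ^+ j * s0 * y) =
    if i == j then star x * y else 0.
  have -> : star (s1 ^+ i * s0 * x) * (s1 ^+ j * s0 * y) =
      star x * (star (s1 ^+ i * s0) * (s1 ^+ j * s0)) * y.
    by rewrite (starM _ x) !mulrA.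
  by rewrite v; case: eqP; rewrite ?mulr1// mulr0 mul0r.
split=> [i j|i j|i j|]; rewrite ?key ?h0 ?h1 ?h01 ?mulr1//.
by case: ifP.
Qed.

Lemma isometry_rnorm s : star s * s = 1 -> rnorm s <= 1.
Proof.
move=> h; have := rnorm_cstar s; rewrite h rnorm1; have := rnorm_ge0 s; nra.
Qed.

Lemma polar_continuous (T : topologicalType) (f : T -> A) : continuous f ->
  (forall t, rnorm (defect (f t)) <= 8^-1) -> continuous (fun t => polar (f t)).
Proof.
move=> cf df t; apply/cvg_rnormP => e e0.
have e3 : 0 < e / 3 by lra.
have /cvg_rnormP/(_ _ e3) := cf t; apply: filterS => t' h.
apply: le_lt_trans (polar_lipschitz (df _) (df _)) _; lra.
Qed.

End ShiftIsometries.

(** * Exact isometries from a copy of the Cuntz algebra *)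
Section Lifting.
Variables (R : realType) (A : cstarAlgType R) (G : groupType) (alpha : G -> starAut A).

(** Relations in the quotient Aflat are asymptotic relations between
    representatives. *)
Lemma cuntz_lift : contains_cuntz_infty (Aflat_fixed alpha) -> exists p0 p1 : R -> A,
  [/\ {within halfline (R:=R), continuous p0} /\ {within halfline (R:=R), continuous p1},
      defect (p0 T) @[T --> +oo] --> (0 : A),
      defect (p1 T) @[T --> +oo] --> (0 : A),
      star (p0 T) * p1 T @[T --> +oo] --> (0 : A) &
      central alpha p0 /\ central alpha p1].
Proof.
case=> B [[S [SS _]] [phi [phiH _ phiD]]].
pose F i : Cb A := flat_repr (phi (S i)).
have Fpi i : flat_pi (F i) = phi (S i) by exact: flat_reprK.
have FS i j : star (F i) * F j - (i == j)%:R \in @C0 R A.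
  apply/flat_piP; rewrite flat_piM flat_pi_star !Fpi.
  rewrite -(star_hom_star phiH) -(star_homM phiH) SS.
  case: eqP => _; first exact: (star_hom1 phiH).
  by rewrite (star_hom0 phiH) flat_pi0.
have FD i : central alpha (F i).
  have [cm fx] := phiD (S i); case=> [z|g] /=.
    have := cm z; rewrite -Fpi -!flat_piM => /flat_piP/C0P h.
    apply/cvg_rnorm0P => e e0; have /cvg_rnorm0P/(_ _ e0) := h; apply: filterS => T.
    by rewrite /twisted /= rnormBC.
  have := fx g; rewrite -Fpi flat_mapE => /flat_piP/C0P h.
  apply/cvg_rnorm0P => e e0; have /cvg_rnorm0P/(_ _ e0) := h; apply: filterS => T.
  by rewrite /twisted /= mulr1 mul1r.
have Fd i : defect (F i T) @[T --> +oo] --> (0 : A).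
  have /C0P h := FS i i.
  apply/cvg_rnorm0P => e e0; have /cvg_rnorm0P/(_ _ e0) := h; apply: filterS => T.
  by rewrite /defect rnormBC eqxx.
exists (F 0%N), (F 1%N); split=> //.
- by split; [have [] := set_mem (cb_funP (F 0%N))|have [] := set_mem (cb_funP (F 1%N))].
- by have := FS 0%N 1%N; rewrite (_ : (0 == 1)%N%:R = 0)// subr0 => /C0P.
Qed.

Lemma continuous_max_comp (f : R -> A) (T0 : R) : {within halfline (R:=R), continuous f} ->
  0 <= T0 -> continuous (fun t => f (Num.max T0 t)).
Proof.
move=> cf T00; apply: (continuous_comp_within cf).
  move=> t; apply: (@continuous_max R R (cst T0) id); [exact: cvg_cst|exact: cvg_id].
by move=> t; rewrite /halfline /= in_itv /= andbT le_max T00.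
Qed.

Lemma cvg_max_pinfty (V : topologicalType) (f : R -> V) (l : V) (T0 : R) :
  f T @[T --> +oo] --> l -> f (Num.max T0 T) @[T --> +oo] --> l.
Proof.
move=> fl; apply: cvg_trans fl; apply: near_eq_cvg.
near=> T; rewrite max_r//; near: T; exact: nbhs_pinfty_ge.
Unshelve. all: by end_near. Qed.

(** After a translation of the parameter the lifts are almost isometries at all
    times.  The first is replaced by its isometric part s0; the second is first
    multiplied by 1 - s0 s0^*, and the iteration that computes its isometric
    part keeps the relation star s0 * z = 0. *)
Lemma central_isometries : contains_cuntz_infty (Aflat_fixed alpha) ->
  exists s0 s1 : R -> A, [/\ continuous s0, continuous s1,
    forall t, [/\ star (s0 t) * s0 t = 1, star (s1 t) * s1 t = 1 & star (s0 t) * s1 t = 0] &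
    central alpha s0 /\ central alpha s1].
Proof.
move=> /cuntz_lift[p0 [p1 [[c0 c1] d0 d1 d01 [z0 z1]]]].
(* One real function controls all the defects of the two lifts. *)
pose h0 t := rnorm (defect (p0 t)) + rnorm (defect (p1 t)) + rnorm (star (p0 t) * p1 t).
have h0_0 : h0 T @[T --> +oo] --> (0 : R).
  rewrite -[0 in X in _ --> X]addr0 -[0 in X in _ --> X + _]addr0.
  by apply: cvgD; [apply: cvgD|]; exact: cvg0_rnorm.
have [T0 T00 hT0] : exists2 T0 : R, 0 <= T0 & forall t, T0 <= t -> h0 t <= 64^-1.
  have e0 : 0 < 64^-1 :> R by lra.
  have /cvgrPdist_lt/(_ _ e0)[M [_ hM]] := h0_0.
  exists (`|M| + 1); first by have := normr_ge0 M; lra.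
  move=> t Mt; have Mt' : M < t by have := ler_norm M; lra.
  by have := hM t Mt'; rewrite sub0r normrN => /ltW; rewrite ler_norml => /andP[].
pose q0 t := p0 (Num.max T0 t); pose q1 t := p1 (Num.max T0 t); pose h t := h0 (Num.max T0 t).
have h64 t : h t <= 64^-1 by apply: hT0; rewrite le_max lexx.
have h_0 : h T @[T --> +oo] --> (0 : R) by exact: cvg_max_pinfty.
have zq0 : central alpha q0 by move=> i; have := cvg_max_pinfty T0 (z0 i).
have zq1 : central alpha q1 by move=> i; have := cvg_max_pinfty T0 (z1 i).
have cq0 : continuous q0 by exact: continuous_max_comp.
have cq1 : continuous q1 by exact: continuous_max_comp.
have hD t : [/\ rnorm (defect (q0 t)) <= h t, rnorm (defect (q1 t)) <= h t & rnorm (star (q0 t) * q1 t) <= h t].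
  have := rnorm_ge0 (defect (q0 t)); have := rnorm_ge0 (defect (q1 t)).
  by have := rnorm_ge0 (star (q0 t) * q1 t); rewrite /h /h0 /q0 /q1; split; lra.
clearbody q0 q1 h; clear h0 h0_0 T0 T00 hT0 p0 p1 c0 c1 d0 d1 d01 z0 z1.
have dq0 t : rnorm (defect (q0 t)) <= 8^-1 by have [] := hD t; have := h64 t; lra.
have dq1 t : rnorm (defect (q1 t)) <= 8^-1 by have [] := hD t; have := h64 t; lra.
pose s0 t := polar (q0 t).
have s0q t : rnorm (s0 t - q0 t) <= 2 * h t.
  by have [_] := polar_cvg (dq0 t); have [] := hD t; rewrite /s0; lra.
have s0i t : star (s0 t) * s0 t = 1 by exact: polar_isometry.
have s01 t : rnorm (star (s0 t) * q1 t) <= 4 * h t.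
  have -> : star (s0 t) * q1 t = star (s0 t - q0 t) * q1 t + star (q0 t) * q1 t.
    by rewrite starB mulrBl subrK.
  have := rnormD (star (s0 t - q0 t) * q1 t) (star (q0 t) * q1 t).
  have := rnormM (star (s0 t - q0 t)) (q1 t); rewrite rnorm_star.
  have := rnorm_defect (dq1 t); have := s0q t; have [_ _] := hD t.
  have := rnorm_ge0 (s0 t - q0 t); nra.
(* r is q1 projected to the complement of the range of s0. *)
pose r t := q1 t - s0 t * (star (s0 t) * q1 t).
have s0r t : star (s0 t) * r t = 0.
  by rewrite /r mulrBr mulrA s0i mul1r subrr.
have rE t : defect (r t) = defect (q1 t) + star (star (s0 t) * q1 t) * (star (s0 t) * q1 t).
  have e0 : star (s0 t * (star (s0 t) * q1 t)) * r t = 0 by rewrite starM -mulrA s0r mulr0.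
  have e1 : star (r t) * r t = star (q1 t) * r t by rewrite {1}/r starB mulrBl e0 subr0.
  rewrite /defect e1.
  have e : star (q1 t) * (s0 t * (star (s0 t) * q1 t)) =
      star (star (s0 t) * q1 t) * (star (s0 t) * q1 t) by rewrite starM starK !mulrA.
  by rewrite /r mulrBr e opprB addrCA [RHS]addrC.
have dr t : rnorm (defect (r t)) <= 2 * h t.
  have [_ + _] := hD t; rewrite rE; have := rnormD (defect (q1 t)) (star (star (s0 t) * q1 t) * (star (s0 t) * q1 t)).
  rewrite rnorm_cstar; have := s01 t; have := rnorm_ge0 (star (s0 t) * q1 t); have := h64 t.
  nra.
have dr8 t : rnorm (defect (r t)) <= 8^-1 by have := dr t; have := h64 t; lra.
pose s1 t := polar (r t).
have s1q t : rnorm (q1 t - s1 t) <= 8 * h t.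
  have -> : q1 t - s1 t = s0 t * (star (s0 t) * q1 t) - (s1 t - r t).
    by rewrite /r opprB addrA [s0 t * _ + _]addrC subrK.
  have [_ h1] := polar_cvg (dr8 t); have := rnormB (s0 t * (star (s0 t) * q1 t)) (s1 t - r t).
  have := rnormM (s0 t) (star (s0 t) * q1 t); have := isometry_rnorm (s0i t).
  have := s01 t; have := dr t; have := rnorm_ge0 (star (s0 t) * q1 t); rewrite /s1; nra.
have cs0 : continuous s0 by exact: polar_continuous.
have cr : continuous r.
  move=> t; apply: cvgB; first exact: cq1.
  by apply: cvg_cstarM; [exact: cs0|apply: cvg_cstarM; [apply: cvg_star; exact: cs0|exact: cq1]].
exists s0, s1; split=> //.
- exact: polar_continuous.
- move=> t; split=> //; first exact: polar_isometry.
  apply: (@polar_closed _ _ (fun z => star (s0 t) * z = 0)) => //.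
    apply: closed_comp (@accessible_closed_set1 _ _ 0) => [w _|]; last exact/hausdorff_accessible/norm_hausdorff.
    by apply: cvg_cstarM; [exact: cvg_cst|exact: cvg_id].
  by move=> w w0; rewrite /newton mulrDr -scalerAr mulrA w0 mul0r scaler0 addr0.
- split; [apply: central_approx zq0 _|apply: central_approx zq1 _].
    apply: (@cvg0_bound _ _ _ _ _ _ (fun t => 2 * h t)).
      by rewrite -[0 in X in _ --> X](mulr0 2); apply: cvgM; [exact: cvg_cst|].
    by apply: nearW => t; rewrite rnormBC.
  apply: (@cvg0_bound _ _ _ _ _ _ (fun t => 8 * h t)).
    by rewrite -[0 in X in _ --> X](mulr0 8); apply: cvgM; [exact: cvg_cst|].
  by apply: nearW => t.
Qed.

End Lifting.

(** * Ideals, corners and compressions *)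
Section StarSubalgebra.
Variables (R : realType) (A : cstarAlgType R).
Implicit Types (x y z : A) (B J : A -> Prop).

Definition closed_star_subalgebra B :=
  [/\ closed B, forall x y, B x -> B y -> B (x + y), forall (k : R[i]) x, B x -> B (k *: x),
      forall x y, B x -> B y -> B (x * y) & forall x, B x -> B (star x)].

(** If z - 1 lies in B, so does the difference to 1 of every iterate, even if B
    does not contain 1: applied to ideals and to corners. *)
Lemma polar_sub1 B z : closed_star_subalgebra B -> rnorm (defect z) <= 8^-1 ->
  B (z - 1) -> B (polar z - 1).
Proof.
move=> [cB BD BZ BM Bs] dz Bz.
apply: (@polar_closed _ _ (fun w => B (w - 1))) => //.
  apply: (@closed_comp _ _ (fun w : A => w - 1) B) => // w _.
  by apply: cvgB; [exact: cvg_id|exact: cvg_cst].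
move=> w; move: (w - 1) (subrK 1 w) => d <- Bd.
have BN x : B x -> B (- x) by rewrite -scaleN1r; exact: BZ.
have Be : B (defect (d + 1)).
  have -> : defect (d + 1) = - (star d * d + star d + d).
    by rewrite /defect starD star1 mulrDl mul1r mulrDr mulr1 !addrA opprD [LHS]addrC subrK.
  by apply/BN/(BD) => //; apply: (BD) (Bs _ Bd); apply: BM => //; exact: Bs.
rewrite /newton addrAC addrK mulrDl mul1r; apply: (BD) => //; apply: BZ.
by apply: (BD) => //; exact: BM.
Qed.

(** The self-adjoint part of J.  It contains u - 1 for every unitary u with
    u - 1 in J, because star (u - 1) = - star u * (u - 1). *)
Definition star_ideal J x := J x /\ J (star x).

Lemma star_idealM J x y : closed_ideal J -> star_ideal J x ->
  star_ideal J (y * x) /\ star_ideal J (x * y).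
Proof.
move=> [_ _ _ JM] [J1 J2]; split; split.
- exact: (JM _ _ J1).1.
- by rewrite starM; exact: (JM _ _ J2).2.
- exact: (JM _ _ J1).2.
- by rewrite starM; exact: (JM _ _ J2).1.
Qed.

Lemma star_ideal_subalgebra J : closed_ideal J -> closed_star_subalgebra (star_ideal J).
Proof.
move=> JI; have [cJ J0 JD JM] := JI; split.
- apply: closedI => //; apply: closed_comp => // w _; exact: star_continuous.
- by move=> x y [x1 x2] [y1 y2]; split; rewrite ?starD; exact: JD.
- by move=> k x Jx; rewrite -[x]mul1r scalerAl; exact: (star_idealM _ JI Jx).1.
- by move=> x y Jx Jy; exact: (star_idealM _ JI Jx).2.
- by move=> x [x1 x2]; split; rewrite ?starK.
Qed.

Lemma corner_subalgebra (f : A) : star f = f ->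
  closed_star_subalgebra (fun x => f * x = x /\ x * f = x).
Proof.
move=> fs; split.
- have cl (g : A -> A) : continuous g -> closed [set x | g x = x].
    move=> cg; rewrite (_ : [set x | _] = [set x | g x - x = 0]).
      apply: (@closed_comp _ _ (fun x : A => g x - x) [set 0]).
        by move=> w _; apply: cvgB; [exact: cg|exact: cvg_id].
      exact/accessible_closed_set1/hausdorff_accessible/norm_hausdorff.
    apply/seteqP; split=> x /=; first by move=> ->; rewrite subrr.
    by move/eqP; rewrite subr_eq0 => /eqP.
  apply: closedI; apply: cl => w; apply: cvg_cstarM; try exact: cvg_id; exact: cvg_cst.
- by move=> x y [x1 x2] [y1 y2]; rewrite mulrDr mulrDl x1 x2 y1 y2.
- by move=> k x [x1 x2]; rewrite -scalerAr -scalerAl x1 x2.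
- by move=> x y [x1 x2] [y1 y2]; rewrite mulrA x1 -mulrA y2.
- by move=> x [x1 x2]; split; [rewrite -[in RHS]x2 starM fs|rewrite -[in RHS]x1 starM fs].
Qed.

End StarSubalgebra.

Lemma compression_sum_regroup (V : zmodType) (o d p q r : V) :
  o + p + q - (d + o) = - (d - r - q + (r - p)).
Proof.
rewrite (addrAC d) addrA subrK opprD -!addrA [LHS]addrC !addrA subrK.
by rewrite !opprD !opprK [RHS]addrC (addrC (- d)) addrA.
Qed.

Section Compression.
Variables (R : realType) (A : cstarAlgType R).
Variables (a w : A) (e : R).
Hypotheses (aa : star a * a = 1) (uw : unitary w).
Hypotheses (aw : rnorm (commutator a w) <= e) (aw' : rnorm (commutator (star a) w) <= e).

Definition co_range (a : A) := 1 - a * star a.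
Local Notation f := (co_range a).

Lemma co_range_star : star f = f.
Proof. by rewrite /co_range starB star1 starM starK. Qed.

Lemma star_mul_co_range : star a * f = 0.
Proof. by rewrite /co_range mulrBr mulr1 mulrA aa mul1r subrr. Qed.

Lemma co_range_mul : f * a = 0.
Proof. by rewrite /co_range mulrBl mul1r -mulrA aa mulr1 subrr. Qed.

Lemma co_range_idem : f * f = f.
Proof. by rewrite {1}/co_range mulrBl mul1r -mulrA star_mul_co_range mulr0 subr0. Qed.

Lemma co_range_rnorm : rnorm f <= 1.
Proof.
have := rnorm_cstar f; rewrite co_range_star co_range_idem expr2.
have := rnorm_ge0 f; nra.
Qed.

(** w cut down to the corner of f = co_range a, and completed by the identity on
    the range of a. *)
Definition compression (a w : A) := 1 + co_range a * (w - 1) * co_range a.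

Lemma star_compression : star (compression a w) = compression a (star w).
Proof. by rewrite /compression starD star1 !starM co_range_star starB star1 mulrA. Qed.

Lemma commutatorB1 z x : commutator z (x - 1) = commutator z x :> A.
Proof. by rewrite /commutator mulrBr mulrBl mulr1 mul1r opprB addrA subrK. Qed.

(** The defect of unitarity of a compression is carried by the off-diagonal part
    of w, which is a commutator. *)
Lemma defect_compression : defect (compression a w) =
  star (star a * (w - 1) * f) * (star a * (w - 1) * f).
Proof.
have ud : unitary_defect (w - 1) by apply/unitary_defectP; rewrite addrC subrK.
have aaE : a * star a = 1 - f by rewrite /co_range subKr.
rewrite /defect /compression -/f; move: f aaE co_range_star co_range_idem => g aaE gs gg.
move: (w - 1) ud => d [d1 _].
have -> : star (star a * d * g) * (star a * d * g) =
    - (g * d * g + g * star d * g) - g * star d * g * d * g.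
  rewrite !starM starK gs; transitivity (g * star d * (a * star a) * d * g).
    by rewrite !mulrA.
  rewrite aaE mulrBr mulr1 !mulrBl -(mulrA g (star d) d) d1.
  by rewrite mulrN mulNr mulrDr mulrDl.
rewrite starD star1 !starM gs !(mulrDl, mulrDr) mul1r !mulr1 mulrA.
have -> : g * star d * g * (g * d * g) = g * star d * g * d * g.
  by rewrite !mulrA -(mulrA _ g g) gg.
by rewrite mul1r !opprD !addrA subrr add0r.
Qed.

Lemma compression_defect : 0 <= e -> e <= 1 -> rnorm (defect (compression a w)) <= e.
Proof.
move=> e0 e1; rewrite defect_compression rnorm_cstar.
have -> : star a * (w - 1) * f = commutator (star a) w * f.
  rewrite -commutatorB1 /commutator mulrBl -[(w - 1) * star a * f]mulrA star_mul_co_range.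
  by rewrite mulr0 subr0.
have x0 := rnorm_ge0 (commutator (star a) w * f).
have xe : rnorm (commutator (star a) w * f) <= e.
  apply: le_trans (rnormM _ _) _; apply: le_trans aw'.
  by apply: ler_piMr co_range_rnorm; exact: rnorm_ge0.
by rewrite expr2; nra.
Qed.

(** An element that almost commutes with a and star a is almost block diagonal
    with respect to the range of a, and its block there is a w a^*. *)
Lemma compression_sum : 0 <= e ->
  rnorm (compression a w + a * (w - 1) * star a - w) <= 2 * e.
Proof.
move=> e0; have -> : compression a w + a * (w - 1) * star a - w =
  - (a * commutator (star a) w + f * (w * a - a * w) * star a).
  rewrite -commutatorB1.
  have -> : w * a - a * w = (w - 1) * a - a * (w - 1).
    by rewrite mulrBl mulrBr mul1r mulr1 opprB addrA subrK.
  have aaE : a * star a = 1 - f by rewrite /co_range subKr.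
  rewrite /compression; move: f aaE co_range_mul => g aaE ga.
  move: (w - 1) (subrK 1 w) => d <-.
  have -> : a * commutator (star a) d = d - g * d - a * d * star a.
    by rewrite /commutator mulrBr !mulrA aaE mulrBl mul1r.
  have -> : g * (d * a - a * d) * star a = g * d - g * d * g.
    rewrite mulrBr (mulrA g a) ga mul0r subr0 -!mulrA aaE.
    by rewrite !mulrBr mulr1.
  exact: compression_sum_regroup.
have r1 := isometry_rnorm aa.
rewrite rnormN; apply: (le_trans (rnormD _ _)).
have h1 := rnormM a (commutator (star a) w).
have h2 := rnormM (f * (w * a - a * w)) (star a).
have h3 := rnormM f (w * a - a * w).
rewrite rnorm_star in h2; rewrite (rnormBC (w * a)) -/(commutator a w) in h2 h3.
have l1 : rnorm a * rnorm (commutator (star a) w) <= e.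
  by apply: le_trans aw'; apply: ler_piMl r1; exact: rnorm_ge0.
have l2 : rnorm f * rnorm (commutator a w) <= e.
  by apply: le_trans aw; apply: ler_piMl co_range_rnorm; exact: rnorm_ge0.
have l3 : rnorm (f * (w * a - a * w)) * rnorm a <= e.
  apply: le_trans (le_trans h3 l2); apply: ler_piMr r1; exact: rnorm_ge0.
lra.
Qed.

End Compression.

(** * The path at a fixed parameter *)
Section Path.
Variables (R : realType) (A : cstarAlgType R).
Implicit Types (a b w : nat -> A) (n : nat) (s : R).

(** Blocks for the corner of f = co_range (a 0): the first is f itself, the
    others are copies of f under the range of a 0. *)
Definition co_left a k := if k is k'.+1 then a 0%N * a k'.+1 * co_range (a 0%N) else co_range (a 0%N).
Definition co_right a b k := a 0%N * b k * co_range (a 0%N).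
Definition co_unitary a w k := polar (compression (a 0%N) (w k)).

Definition swindle_path n a b w s :=
  double_swindle n a b (fun k => w k - 1) s *
  double_swindle n (co_left a) (co_right a b) (fun k => co_unitary a w k - 1) s.

(** The linear term vanishes at s = 0 and moves the end point to w 0. *)
Definition corrected_path n a b w s :=
  polar (swindle_path n a b w s + s%:C *: (w 0%N - swindle_path n a b w 1)).

End Path.

Lemma swindle_path1_regroup (V : zmodType) (p x y z u : V) :
  u - p = - (p - (x + z)) - ((x - y) + (y + z - u)).
Proof.
have -> : (x - y) + (y + z - u) = x + z - u by rewrite !addrA subrK.
by rewrite !opprB [RHS]addrC addrA subrK.
Qed.

(** The unitaries w k are the points of the partition, starting from the end of
    the path to be shortened; e bounds both the steps of the partition and the
    commutators with a 0, and 256 is such that the elements fed to polar have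
    a defect of at most 1/8. *)
Section PathProperties.
Variables (R : realType) (A : cstarAlgType R) (a b w : nat -> A) (n : nat) (e : R).
Hypotheses (ab : isometric_pair 1 a b) (uw : forall k, unitary (w k)).
Hypotheses (wn : forall k, (n <= k)%N -> w k = 1).
Hypotheses (e0 : 0 <= e) (e1 : e <= 256^-1).
Hypothesis step : forall k, rnorm (w k.+1 - w k) <= e.
Hypothesis comm : forall k,
  rnorm (commutator (a 0%N) (w k)) <= e /\ rnorm (commutator (star (a 0%N)) (w k)) <= e.
Implicit Type s : R.

Local Notation f := (co_range (a 0%N)).
Local Notation c := (co_unitary a w).

Lemma isometry0 : star (a 0%N) * a 0%N = 1.
Proof. by have [-> _ _ _] := ab. Qed.

Lemma co_isometric_pair : isometric_pair f (co_left a) (co_right a b).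
Proof.
have fs := co_range_star (a 0%N); have ff := co_range_idem isometry0.
have af := star_mul_co_range isometry0; have fa := co_range_mul isometry0.
have [h1 h2 h3 _] := ab.
have key x y : star (a 0%N * x * f) * (a 0%N * y * f) = f * (star x * y) * f.
  rewrite !starM fs -!mulrA (mulrA (star (a 0%N)) (a 0%N)) isometry0 mul1r.
  by rewrite !mulrA.
have key0 y : star f * (a 0%N * y * f) = 0 by rewrite fs !mulrA fa !mul0r.
have key1 y : star (a 0%N * y * f) * f = 0.
  by rewrite -[LHS]starK starM starK key0 star0.
split=> //.
- move=> [|i] [|j] /=.
  + by rewrite fs ff.
  + exact: key0.
  + exact: key1.
  + by rewrite key h1 eqSS; case: eqP => _; rewrite ?mulr1// mulr0 mul0r.
- by move=> i j; rewrite key h2; case: eqP => _; rewrite ?mulr1// mulr0 mul0r.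
- move=> [|i] j /=; first exact: key0.
  by rewrite key h3 mulr0 mul0r.
Qed.

Lemma compression_defects k :
  rnorm (defect (compression (a 0%N) (w k))) <= e /\
  rnorm (defect (star (compression (a 0%N) (w k)))) <= e.
Proof.
have [h1 h2] := comm k; have el : e <= 1 by have := e1; lra.
split; first exact: (compression_defect isometry0 (uw k) h2 e0 el).
rewrite star_compression; apply: (compression_defect isometry0 (unitary_star (uw k)) _ e0 el).
rewrite -rnorm_star (_ : star _ = commutator (w k) (a 0%N)).
  by rewrite /commutator rnormBC.
by rewrite /commutator starB !starM !starK.
Qed.

Lemma small_defect8 (z : A) : rnorm (defect z) <= e -> rnorm (defect z) <= 8^-1.
Proof. by move=> h; have := e1; lra. Qed.

Lemma co_unitary_unitary k : unitary (c k).
Proof.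
have [h1 h2] := compression_defects k.
by apply: polar_unitary; exact: small_defect8.
Qed.

Lemma co_unitary_approx k : rnorm (c k - compression (a 0%N) (w k)) <= 2 * e.
Proof.
have [h1 _] := compression_defects k.
have [_] := polar_cvg (small_defect8 h1); rewrite /co_unitary; lra.
Qed.

Lemma co_unitary_corner : corner_seq f (fun k => c k - 1).
Proof.
have fs := co_range_star (a 0%N); have ff := co_range_idem isometry0.
have h k : f * (c k - 1) = c k - 1 /\ (c k - 1) * f = c k - 1.
  have [h1 _] := compression_defects k.
  apply: (polar_sub1 (corner_subalgebra fs) (small_defect8 h1)).
  by rewrite /compression [1 + _]addrC addrK !mulrA ff -!mulrA ff.
split=> k; [exact: (h k).1|exact: (h k).2|].
by apply/unitary_defectP; rewrite addrC subrK; exact: co_unitary_unitary.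
Qed.

Lemma unit_corner : corner_seq 1 (fun k => w k - 1).
Proof.
by split=> k; rewrite ?mul1r ?mulr1//; apply/unitary_defectP; rewrite addrC subrK.
Qed.

Lemma co_unitary1 k : (n <= k)%N -> c k = 1.
Proof.
move=> /wn wk; rewrite /co_unitary /compression wk subrr mulr0 mul0r addr0.
by apply: polar_id; rewrite /defect star1 mulr1 subrr.
Qed.

Lemma co_unitary_step k : rnorm (c k.+1 - c k) <= 3 * e.
Proof.
have [h1 _] := compression_defects k; have [h2 _] := compression_defects k.+1.
apply: (le_trans (polar_lipschitz (small_defect8 h2) (small_defect8 h1))).
rewrite ler_pM2l//; apply: le_trans (step k).
have -> : compression (a 0%N) (w k.+1) - compression (a 0%N) (w k) = f * (w k.+1 - w k) * f.
  rewrite /compression opprD addrACA subrr add0r -mulrBl -mulrBr; congr (_ * _ * _).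
  by rewrite opprB addrA subrK.
have f1 := co_range_rnorm isometry0.
apply: (le_trans (rnormM _ _)); apply: (le_trans (ler_piMr _ f1)); first exact: rnorm_ge0.
apply: (le_trans (rnormM _ _)); apply: ler_piMl f1; exact: rnorm_ge0.
Qed.

Lemma swindle_path_unitary s : unitary (swindle_path n a b w s).
Proof.
apply: unitaryM; first exact: double_swindle_unitary ab unit_corner.
exact: double_swindle_unitary co_isometric_pair co_unitary_corner.
Qed.

Lemma swindle_path0 : swindle_path n a b w 0 = 1.
Proof. by rewrite /swindle_path !double_swindle0 mulr1. Qed.

Lemma swindle_path_lipschitz s s' :
  rnorm (swindle_path n a b w s - swindle_path n a b w s') <= 8 * pi * `|s - s'|.
Proof.
have -> : 8 * pi * `|s - s'| = 4 * pi * `|s - s'| + 4 * pi * `|s - s'| by ring.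
apply: mul_lipschitz.
- by rewrite (unitary_rnorm (double_swindle_unitary _ _ ab unit_corner)).
- by rewrite (unitary_rnorm (double_swindle_unitary _ _ co_isometric_pair co_unitary_corner)).
- exact: double_swindle_lipschitz ab unit_corner.
- exact: double_swindle_lipschitz co_isometric_pair co_unitary_corner.
Qed.

(** The end point splits as (1 + a_0 (w_0 - 1) a_0^* ) c_0 up to the errors of the
    two double swindles; as star (a 0) * c 0 = star (a 0), this is
    c_0 + a_0 (w_0 - 1) a_0^*, which compression_sum compares with w_0. *)
Lemma swindle_path1 : rnorm (w 0%N - swindle_path n a b w 1) <= 8 * e.
Proof.
pose E := 1 + sandwich (a 0%N) (w 0%N - 1) (a 0%N).
have h1 : rnorm (double_swindle n a b (fun k => w k - 1) 1 - E) <= e.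
  apply: (double_swindle1 ab unit_corner) => //; first by rewrite wn// subrr.
  by move=> k _; rewrite opprB addrA subrK.
have h2 : rnorm (double_swindle n (co_left a) (co_right a b) (fun k => c k - 1) 1 - c 0%N) <= 3 * e.
  have -> : c 0%N = 1 + sandwich (co_left a 0) (c 0%N - 1) (co_left a 0).
    have [k1 k2 _] := co_unitary_corner.
    by rewrite /sandwich /= co_range_star k1 k2 addrC subrK.
  apply: (double_swindle1 co_isometric_pair co_unitary_corner); first by rewrite co_unitary1// subrr.
    by apply: mulr_ge0.
  by move=> k _; rewrite opprB addrA subrK; exact: co_unitary_step.
have h3 : rnorm (swindle_path n a b w 1 - E * c 0%N) <= e + 3 * e.
  apply: mul_lipschitz h1 h2.
    by rewrite (unitary_rnorm (double_swindle_unitary _ _ ab unit_corner)).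
  by rewrite (unitary_rnorm (co_unitary_unitary 0)).
have EC : E * c 0%N = c 0%N + a 0%N * (w 0%N - 1) * star (a 0%N).
  rewrite /E mulrDl mul1r /sandwich; congr (_ + _); rewrite -mulrA; congr (_ * _).
  have [k1 _ _] := co_unitary_corner.
  rewrite -[c 0%N](subrK 1) mulrDr mulr1 -k1 mulrA star_mul_co_range ?mul0r ?add0r//.
  exact: isometry0.
have [g1 g2] := comm 0.
have h4 := compression_sum isometry0 g1 g2 e0.
have h5 := co_unitary_approx 0.
have -> : w 0%N - swindle_path n a b w 1 =
  - (swindle_path n a b w 1 - E * c 0%N) - ((c 0%N - compression (a 0%N) (w 0%N))
  + (compression (a 0%N) (w 0%N) + a 0%N * (w 0%N - 1) * star (a 0%N) - w 0%N)).
  rewrite EC; exact: swindle_path1_regroup.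
apply: (le_trans (rnormB _ _)); rewrite rnormN.
have := rnormD (c 0%N - compression (a 0%N) (w 0%N)) (compression (a 0%N) (w 0%N) + a 0%N * (w 0%N - 1) * star (a 0%N) - w 0%N).
lra.
Qed.

Local Notation approx s := (swindle_path n a b w s + s%:C *: (w 0%N - swindle_path n a b w 1)).

Lemma defect_unitary_add (u v : A) (d : R) : unitary u -> rnorm v <= d -> d <= 1 ->
  rnorm (defect (u + v)) <= 2 * d + d * d.
Proof.
move=> uu vd d1; have u1 := unitary_rnorm uu; have [uu1 _] := uu.
have -> : defect (u + v) = - (star u * v + star v * u + star v * v).
  by rewrite /defect starD mulrDl !mulrDr uu1 !opprD !addrA subrr sub0r.
rewrite rnormN; have := rnormD (star u * v + star v * u) (star v * v).
have := rnormD (star u * v) (star v * u).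
have := rnormM (star u) v; have := rnormM (star v) u; have := rnormM (star v) v.
have := rnorm_ge0 v; rewrite !rnorm_star u1; nra.
Qed.

Lemma approx_defect s : 0 <= s <= 1 ->
  rnorm (defect (approx s)) <= 17 * e /\ rnorm (defect (star (approx s))) <= 17 * e.
Proof.
move=> /andP[s0 s1].
have v : rnorm (s%:C *: (w 0%N - swindle_path n a b w 1)) <= 8 * e.
  rewrite rnormZ ger0_norm//; apply: le_trans swindle_path1; apply: ler_piMl => //.
  exact: rnorm_ge0.
have d1 : 8 * e <= 1 by have := e1; lra.
have u := swindle_path_unitary s.
have ee : 2 * (8 * e) + 8 * e * (8 * e) <= 17 * e by have := e0; have := e1; nra.
split; first exact: le_trans (defect_unitary_add u v d1) ee.
rewrite starD; apply: le_trans (defect_unitary_add (unitary_star u) _ d1) ee.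
by rewrite rnorm_star.
Qed.

Lemma approx_defect8 s : 0 <= s <= 1 -> rnorm (defect (approx s)) <= 8^-1.
Proof. by move=> /approx_defect[h _]; have := e1; lra. Qed.

Lemma corrected_path_unitary s : 0 <= s <= 1 -> unitary (corrected_path n a b w s).
Proof.
by move=> /approx_defect[h1 h2]; apply: polar_unitary; have := e1; lra.
Qed.

Lemma corrected_path0 : corrected_path n a b w 0 = 1.
Proof.
rewrite /corrected_path scale0r addr0 swindle_path0.
by apply: polar_id; rewrite /defect star1 mulr1 subrr.
Qed.

Lemma corrected_path1 : corrected_path n a b w 1 = w 0%N.
Proof.
rewrite /corrected_path scale1r addrC subrK.
by apply: polar_id; rewrite /defect (uw 0%N).1 subrr.
Qed.

Lemma corrected_path_lipschitz s s' : 0 <= s <= 1 -> 0 <= s' <= 1 ->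
  rnorm (corrected_path n a b w s - corrected_path n a b w s') <= (24 * pi + 24 * e) * `|s - s'|.
Proof.
move=> s01 s01'; apply: (le_trans (polar_lipschitz (approx_defect8 s01) (approx_defect8 s01'))).
have -> : approx s - approx s' = (swindle_path n a b w s - swindle_path n a b w s')
   + (s - s')%:C *: (w 0%N - swindle_path n a b w 1).
  by rewrite opprD addrACA rmorphB scalerBl.
have := rnormD (swindle_path n a b w s - swindle_path n a b w s') ((s - s')%:C *: (w 0%N - swindle_path n a b w 1)).
rewrite rnormZ; have := swindle_path_lipschitz s s'.
have : `|s - s'| * rnorm (w 0%N - swindle_path n a b w 1) <= `|s - s'| * (8 * e).
  by apply: ler_wpM2l => //; exact: swindle_path1.
lra.
Qed.

Lemma corrected_path_approx s : 0 <= s <= 1 ->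
  rnorm (corrected_path n a b w s - swindle_path n a b w s) <= 42 * e.
Proof.
move=> s01; have [_ h1] := polar_cvg (approx_defect8 s01); have [h2 _] := approx_defect s01.
have v : rnorm (s%:C *: (w 0%N - swindle_path n a b w 1)) <= 8 * e.
  move: s01 => /andP[s0 s1].
  rewrite rnormZ ger0_norm//; apply: le_trans swindle_path1; apply: ler_piMl => //.
  exact: rnorm_ge0.
have -> : corrected_path n a b w s - swindle_path n a b w s =
  (polar (approx s) - approx s) + s%:C *: (w 0%N - swindle_path n a b w 1).
  by rewrite /corrected_path opprD addrA subrK.
apply: (le_trans (rnormD _ _)); lra.
Qed.

Lemma co_unitary_ideal B k : closed_star_subalgebra B ->
  (forall x y, B x -> B (y * x) /\ B (x * y)) -> B (w k - 1) -> B (c k - 1).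
Proof.
move=> BS BI Bw; have [h1 _] := compression_defects k.
apply: (polar_sub1 BS (small_defect8 h1)).
rewrite /compression [1 + _]addrC addrK.
by apply: (BI _ _ _).2; apply: (BI _ _ _).1.
Qed.

Lemma corrected_path_ideal B s : 0 <= s <= 1 -> closed_star_subalgebra B ->
  (forall x y, B x -> B (y * x) /\ B (x * y)) -> (forall k, B (w k - 1)) ->
  B (corrected_path n a b w s - 1).
Proof.
move=> s01 BS BI Bw; have Bc k := co_unitary_ideal BS BI (Bw k).
have [cB BD BZ BM Bs] := BS.
have B0 : B 0 by rewrite -(scale0r (w 0%N - 1)); exact: BZ.
have B1 x y : B (x - 1) -> B (y - 1) -> B (x * y - 1).
  move=> Bx By; have -> : x * y - 1 = (x - 1) * y + (y - 1) by rewrite mulrBl mul1r addrA subrK.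
  by apply: (BD) => //; exact: (BI _ _ Bx).2.
have Bsw a' b' d s' : (forall k, B (d k)) -> B (swindle n a' b' d s' - 1).
  by move=> Bd; apply: swindle_sub1 => // k; exact: Bs.
have Bp s' : B (swindle_path n a b w s' - 1).
  by apply: (B1); apply: (B1); apply: (Bsw) => k.
apply: (polar_sub1 BS (approx_defect8 s01)).
rewrite addrAC; apply: (BD) => //; apply: (BZ).
have -> : w 0%N - swindle_path n a b w 1 = (w 0%N - 1) - (swindle_path n a b w 1 - 1).
  by rewrite opprB addrA subrK.
by apply: (BD) => //; rewrite -scaleN1r; exact: BZ.
Qed.

Section Twisted.
Variables (g : A -> A) (x : A) (eta M : R).
Hypotheses (gH : star_hom g) (M0 : 0 <= M).
Hypothesis afix : forall k, (k <= n)%N -> nearly_fixed g x eta (a k) /\ nearly_fixed g x eta (b k).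
Hypothesis wfix : forall k, rnorm (twisted g x (w k)) <= M.

Lemma nearly_fixed_sub1 u N : unitary u -> rnorm (twisted g x u) <= N ->
  nearly_fixed g x N (u - 1).
Proof.
move=> uu uN; split; rewrite ?starB ?star1 twistedB// twisted1// subr0//.
exact: le_trans (rnorm_twisted_star _ gH uu) uN.
Qed.

Lemma nearly_fixedM y z d1 d2 : rnorm y <= 1 -> rnorm z <= 1 ->
  nearly_fixed g x d1 y -> nearly_fixed g x d2 z -> nearly_fixed g x (d1 + d2) (y * z).
Proof.
move=> y1 z1 [h1 h2] [h3 h4]; split.
  apply: (le_trans (rnorm_twistedM _ gH _ _)) => //; exact: lerD.
rewrite starM addrC; apply: (le_trans (rnorm_twistedM _ gH _ _)); rewrite ?rnorm_star//; exact: lerD.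
Qed.

Lemma nearly_fixed_star y d1 : nearly_fixed g x d1 y -> nearly_fixed g x d1 (star y).
Proof. by move=> [h1 h2]; split; rewrite ?starK. Qed.

Lemma nearly_fixed_co_range : nearly_fixed g x (2 * eta) f.
Proof.
have [h _] := afix (leq0n n).
have a1 := isometry_rnorm isometry0.
have h2 := nearly_fixedM a1 (_ : rnorm (star (a 0%N)) <= 1) h (nearly_fixed_star h).
suff hf : rnorm (twisted g x f) <= 2 * eta by split; rewrite ?co_range_star.
rewrite /co_range twistedB// twisted1// sub0r rnormN mulr_natl mulr2n.
by have [|] := h2; rewrite ?rnorm_star.
Qed.

Lemma nearly_fixed_co k : (k <= n)%N ->
  nearly_fixed g x (4 * eta) (co_left a k) /\ nearly_fixed g x (4 * eta) (co_right a b k).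
Proof.
move=> kn; have [_ _ _ a1 b1] := isometric_pair_ortho ab.
have [h0 _] := afix (leq0n n); have [ha hb] := afix kn.
have f1 := co_range_rnorm isometry0; have hf := nearly_fixed_co_range.
have eta0 : 0 <= eta by have [/(le_trans (rnorm_ge0 _))] := h0.
have m1 y z : rnorm y <= 1 -> rnorm z <= 1 -> rnorm (y * z : A) <= 1.
  move=> y1 z1; apply: (le_trans (rnormM _ _)); rewrite -[1]mul1r; apply: ler_pM => //; exact: rnorm_ge0.
have e4 : 4 * eta = eta + eta + 2 * eta by ring.
split; last by rewrite e4; apply: nearly_fixedM (nearly_fixedM _ _ _ _) hf => //; exact: m1.
case: k kn ha {hb} => [|k] kn ha /=.
  by have [k1 k2] := hf; split; lra.
by rewrite e4; apply: nearly_fixedM (nearly_fixedM _ _ _ _) hf => //; exact: m1.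
Qed.

Lemma twisted_co_unitary k : rnorm (twisted g x (c k)) <= M + 8 * eta + 4 * rnorm x * e.
Proof.
have -> : c k = (c k - compression (a 0%N) (w k)) + compression (a 0%N) (w k) by rewrite subrK.
rewrite twistedD// addrC; apply: (le_trans (rnormD _ _)); apply: lerD; last first.
  apply: (le_trans (rnorm_twisted_le _ gH _)).
  have -> : 4 * rnorm x * e = 2 * rnorm x * (2 * e) by ring.
  by apply: ler_wpM2l (co_unitary_approx k); rewrite mulr_ge0// rnorm_ge0.
have f1 := co_range_rnorm isometry0; have [hf hf'] := nearly_fixed_co_range.
have ud : unitary_defect (w k - 1) by apply/unitary_defectP; rewrite addrC subrK.
have e8 : 8 * eta = 4 * (2 * eta) by ring.
rewrite /compression twistedD// twisted1// add0r.
rewrite -{2}(co_range_star (a 0%N)) -/(sandwich _ _ _) twisted_sandwich//.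
apply: (le_trans (rnormD _ _)); apply: lerD.
  apply: (le_trans (rnorm_sandwich _ _ _)) => //.
    exact: le_trans (rnorm_star_hom gH _) f1.
  by rewrite twistedB// twisted1// subr0.
by rewrite e8; apply: rnorm_twisted_sandwich_err => //; exact: unitary_defect_norm.
Qed.

(** Each double swindle contributes a factor 4.  The number n of steps is only
    multiplied with eta, which can be chosen after n. *)
Lemma twisted_corrected_path s : 0 <= s <= 1 ->
  rnorm (twisted g x (corrected_path n a b w s)) <=
  8 * M + 192 * (eta * n.+1%:R) + 100 * (rnorm x * e).
Proof.
move=> s01.
have eta0 : 0 <= eta by have [[/(le_trans (rnorm_ge0 _))]] := afix (leq0n n).
have x0 := rnorm_ge0 x; have xe : 0 <= rnorm x * e by exact: mulr_ge0.
have h1 : rnorm (twisted g x (double_swindle n a b (fun k => w k - 1) s)) <= 4 * (M + 8 * eta * n%:R).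
  apply: (rnorm_twisted_double_swindle gH _ ab unit_corner) => // k _.
  exact: nearly_fixed_sub1.
have M'0 : 0 <= M + 8 * eta + 4 * rnorm x * e by have := M0; lra.
have h2 : rnorm (twisted g x (double_swindle n (co_left a) (co_right a b) (fun k => c k - 1) s)) <=
    4 * (M + 8 * eta + 4 * rnorm x * e + 8 * (4 * eta) * n%:R).
  apply: (rnorm_twisted_double_swindle gH _ co_isometric_pair co_unitary_corner) => //.
    exact: nearly_fixed_co.
  by move=> k _; apply: nearly_fixed_sub1; [exact: co_unitary_unitary|exact: twisted_co_unitary].
have h3 : rnorm (twisted g x (swindle_path n a b w s)) <=
    4 * (M + 8 * eta * n%:R) + 4 * (M + 8 * eta + 4 * rnorm x * e + 8 * (4 * eta) * n%:R).
  apply: (le_trans (rnorm_twistedM _ gH _ _)); last exact: lerD.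
    by rewrite (unitary_rnorm (double_swindle_unitary _ _ ab unit_corner)).
  by rewrite (unitary_rnorm (double_swindle_unitary _ _ co_isometric_pair co_unitary_corner)).
have h4 : rnorm (twisted g x (corrected_path n a b w s - swindle_path n a b w s)) <= 84 * (rnorm x * e).
  apply: (le_trans (rnorm_twisted_le _ gH _)).
  have -> : 84 * (rnorm x * e) = 2 * rnorm x * (42 * e) by ring.
  by apply: ler_wpM2l (corrected_path_approx s01); rewrite mulr_ge0.
have := rnormD (twisted g x (corrected_path n a b w s - swindle_path n a b w s)) (twisted g x (swindle_path n a b w s)).
rewrite -twistedD// subrK -[n.+1%:R]natr1.
have : 0 <= eta * n%:R by rewrite mulr_ge0.
rewrite [eta * (_ + 1)]mulrDr mulr1; lra.
Qed.

End Twisted.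
End PathProperties.

(** * Continuity in both variables and choice of the speeds *)
Section Continuity.
Variables (R : realType) (A : cstarAlgType R).
Implicit Types (a b d w : nat -> R -> A) (N : R -> nat).

Lemma continuous_mulA (T : topologicalType) (f g : T -> A) :
  continuous f -> continuous g -> continuous (fun p => f p * g p).
Proof. by move=> cf cg p; apply: cvg_cstarM; [exact: cf|exact: cg]. Qed.

Lemma continuous_addA (T : topologicalType) (f g : T -> A) :
  continuous f -> continuous g -> continuous (fun p => f p + g p).
Proof. by move=> cf cg p; apply: cvgD; [exact: cf|exact: cg]. Qed.

Lemma continuous_oppA (T : topologicalType) (f : T -> A) :
  continuous f -> continuous (fun p => - f p).
Proof. by move=> cf p; apply: cvgN; exact: cf. Qed.

Lemma continuous_starA (T : topologicalType) (f : T -> A) :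
  continuous f -> continuous (fun p => star (f p)).
Proof. by move=> cf p; apply: cvg_star; exact: cf. Qed.

Lemma continuous_sandwich (T : topologicalType) (f g h : T -> A) :
  continuous f -> continuous g -> continuous h -> continuous (fun p => sandwich (f p) (g p) (h p)).
Proof.
by move=> cf cg ch; apply: continuous_mulA (continuous_starA ch); exact: continuous_mulA.
Qed.

Lemma continuous_cstA (T : topologicalType) (z : A) : continuous (fun _ : T => z).
Proof. by move=> p; exact: cvg_cst. Qed.

Definition locally_bounded N :=
  forall t : R, exists m : nat, \forall t' \near t, (N t' <= m)%N.

Lemma continuous_swindle a b d N :
  (forall k, continuous (a k)) -> (forall k, continuous (b k)) -> (forall k, continuous (d k)) ->
  locally_bounded N -> (forall k t, (N t <= k)%N -> d k t = 0) ->
  continuous (fun p : R * R =>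
    swindle (N p.2) (a^~ p.2) (b^~ p.2) (d^~ p.2) p.1).
Proof.
move=> ca cb cd bN d0.
have cX : continuous (fun t => swindle_diag (N t) (a^~ t) (b^~ t) (d^~ t)).
  apply: (@continuous_locally_finite_sum _ _ _ (fun k t =>
    sandwich (a k t) (d k t) (a k t) + sandwich (b k t) (star (d k t)) (b k t)) N) => //.
    by move=> k; apply: continuous_addA; apply: continuous_sandwich => //; exact: continuous_starA.
  by move=> k t /d0 ->; rewrite star0 !sandwich0 addr0.
have cY : continuous (fun t => swindle_off (N t) (a^~ t) (b^~ t) (d^~ t)).
  apply: (@continuous_locally_finite_sum _ _ _ (fun k t =>
    sandwich (b k t) (star (d k t)) (a k t) + sandwich (a k t) (- d k t) (b k t)) N) => //.
    move=> k; apply: continuous_addA; apply: continuous_sandwich => //.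
      exact: continuous_starA.
    exact: continuous_oppA.
  by move=> k t /d0 ->; rewrite star0 oppr0 !sandwich0 addr0.
have c2 (f : R -> A) : continuous f -> continuous (fun p : R * R => f p.2).
  by move=> cf p; apply: (@continuous_comp _ _ _ snd f); [exact: cvg_snd|exact: cf].
have c1 (f : R -> R) : continuous f -> continuous (fun p : R * R => f p.1).
  by move=> cf p; apply: (@continuous_comp _ _ _ fst f); [exact: cvg_fst|exact: cf].
have cpi : continuous (fun s : R => pi * s).
  by move=> s; apply: cvgM; [exact: cvg_cst|exact: cvg_id].
have ccos : continuous (fun s : R => (1 - cos (pi * s)) / 2).
  move=> s; apply: cvgM; last exact: cvg_cst.
  apply: cvgB; first exact: cvg_cst.
  by apply: (@continuous_comp _ _ _ (fun s => pi * s) cos); [exact: cpi|exact: continuous_cos].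
have csin : continuous (fun s : R => sin (pi * s) / 2).
  move=> s; apply: cvgM; last exact: cvg_cst.
  by apply: (@continuous_comp _ _ _ (fun s => pi * s) sin); [exact: cpi|exact: continuous_sin].
rewrite /swindle; apply: continuous_addA; first apply: continuous_addA.
- exact: continuous_cstA.
- by move=> p; apply: cvg_rscale; [exact: (c1 _ ccos)|exact: (c2 _ cX)].
- by move=> p; apply: cvg_rscale; [exact: (c1 _ csin)|exact: (c2 _ cY)].
Qed.

Lemma continuous_double_swindle a b d N :
  (forall k, continuous (a k)) -> (forall k, continuous (b k)) -> (forall k, continuous (d k)) ->
  locally_bounded N -> (forall k t, (N t <= k)%N -> d k t = 0) ->
  continuous (fun p : R * R =>
    double_swindle (N p.2) (a^~ p.2) (b^~ p.2) (d^~ p.2) p.1).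
Proof.
move=> ca cb cd bN d0; apply: continuous_mulA; first exact: continuous_swindle.
apply: (@continuous_swindle b (fun k => a k.+1) (fun k => d k.+1)) => //.
by move=> k t kt; apply: d0; rewrite ltnW.
Qed.

Definition clamp (s : R) : R := Num.min 1 (Num.max 0 s).

Lemma clamp_in s : 0 <= clamp s <= 1.
Proof. by rewrite /clamp le_min ler01 le_max lexx ge_min lexx. Qed.

Lemma clamp_id s : 0 <= s <= 1 -> clamp s = s.
Proof. by move=> /andP[s0 s1]; rewrite /clamp max_r// min_r. Qed.

Lemma clamp_continuous : continuous clamp.
Proof.
move=> t; apply: (@continuous_min R R (cst 1) (fun t => Num.max 0 t)).
  exact: cvg_cst.
by apply: (@continuous_max R R (cst 0) id); [exact: cvg_cst|exact: cvg_id].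
Qed.

Lemma continuous_corrected_path a b w N (e : R -> R) :
  (forall k, continuous (a k)) -> (forall k, continuous (b k)) -> (forall k, continuous (w k)) ->
  locally_bounded N ->
  (forall t, isometric_pair 1 (a^~ t) (b^~ t)) -> (forall k t, unitary (w k t)) ->
  (forall t k, (N t <= k)%N -> w k t = 1) -> (forall t, 0 <= e t <= 256^-1) ->
  (forall t k, rnorm (w k.+1 t - w k t) <= e t) ->
  (forall t k, rnorm (commutator (a 0%N t) (w k t)) <= e t /\
    rnorm (commutator (star (a 0%N t)) (w k t)) <= e t) ->
  continuous (fun p : R * R =>
    corrected_path (N p.2) (a^~ p.2) (b^~ p.2) (w^~ p.2) (clamp p.1)).
Proof.
move=> ca cb cw bN ab uw wN e01 step comm.
have c2 (f : R -> A) : continuous f -> continuous (fun p : R * R => f p.2).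
  by move=> cf p; apply: (@continuous_comp _ _ _ snd f); [exact: cvg_snd|exact: cf].
have e0 t : 0 <= e t by have /andP[] := e01 t.
have e1 t : e t <= 256^-1 by have /andP[] := e01 t.
have cf : continuous (fun t => co_range (a 0%N t)).
  apply: continuous_addA; first exact: continuous_cstA.
  by apply: continuous_oppA; apply: continuous_mulA => //; exact: continuous_starA.
have cc k : continuous (fun t => co_unitary (a^~ t) (w^~ t) k).
  apply: polar_continuous.
    apply: continuous_addA; first exact: continuous_cstA.
    apply: continuous_mulA => //; apply: continuous_mulA => //.
    by apply: continuous_addA => //; exact: continuous_cstA.
  move=> t; have [h _] := compression_defects (ab t) (uw^~ t) (e0 t) (e1 t) (comm t) k.
  by have := e1 t; lra.
have cl k : continuous (fun t => co_left (a^~ t) k).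
  case: k => [|k] //=; apply: continuous_mulA => //; exact: continuous_mulA.
have cr k : continuous (fun t => co_right (a^~ t) (b^~ t) k).
  by apply: continuous_mulA => //; exact: continuous_mulA.
have cpath : continuous (fun p : R * R => swindle_path (N p.2) (a^~ p.2) (b^~ p.2) (w^~ p.2) p.1).
  apply: continuous_mulA.
    apply: (@continuous_double_swindle a b (fun k t => w k t - 1)) => //.
      by move=> k; apply: continuous_addA => //; exact: continuous_cstA.
    by move=> k t /wN ->; rewrite subrr.
  apply: (@continuous_double_swindle (fun k t => co_left (a^~ t) k) (fun k t => co_right (a^~ t) (b^~ t) k)
     (fun k t => co_unitary (a^~ t) (w^~ t) k - 1)) => //.
    by move=> k; apply: continuous_addA => //; exact: continuous_cstA.
  by move=> k t kt; rewrite (@co_unitary1 _ _ _ _ (N t)) ?subrr// => j /wN.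
have cpair (h : R -> R) : continuous h -> continuous (fun p : R * R => (h p.1, p.2)).
  move=> ch p; apply: (@cvg_pair _ _ _ (nbhs p) (nbhs (h p.1)) (nbhs p.2) _ _ _ (fun p => h p.1) snd);
    last exact: cvg_snd.
  by apply: (@continuous_comp _ _ _ fst h); [exact: cvg_fst|exact: ch].
apply: polar_continuous; last first.
  move=> p; exact: (approx_defect8 (ab p.2) (uw^~ p.2) (wN p.2) (e0 p.2) (e1 p.2) (step p.2) (comm p.2) (clamp_in p.1)).
have cs : continuous (fun p : R * R => clamp p.1).
  by move=> p; apply: (@continuous_comp _ _ _ fst clamp); [exact: cvg_fst|exact: clamp_continuous].
apply: continuous_addA.
  move=> p; apply: (@continuous_comp _ _ _ (fun p : R * R => (clamp p.1, p.2)) (fun p : R * R => swindle_path (N p.2) (a^~ p.2) (b^~ p.2) (w^~ p.2) p.1)).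
    exact: (cpair _ clamp_continuous).
  exact: cpath.
have cpath1 : continuous (fun p : R * R =>
    swindle_path (N p.2) (a^~ p.2) (b^~ p.2) (w^~ p.2) 1).
  move=> p; apply: (@continuous_comp _ _ _ (fun p : R * R => ((1 : R), p.2)) (fun p : R * R => swindle_path (N p.2) (a^~ p.2) (b^~ p.2) (w^~ p.2) p.1)).
    by apply: (cpair (fun=> (1 : R))) => x; exact: cvg_cst.
  exact: cpath.
move=> p; apply: cvg_rscale; first exact: cs.
by apply: cvgB; [exact: (c2 _ (cw 0%N))|exact: cpath1].
Qed.

End Continuity.

Section Dynamic.
Variables (R : realType) (A : cstarAlgType R) (G : groupType) (alpha : G -> starAut A).
Variables (a b : nat -> R -> A) (u : R * R -> A) (B : A -> Prop) (idx : nat -> A + G).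
Hypotheses (ca : forall k, continuous (a k)) (cb : forall k, continuous (b k)).
Hypothesis ab : forall T, isometric_pair 1 (a^~ T) (b^~ T).
Hypotheses (za : forall k, central alpha (a k)) (zb : forall k, central alpha (b k)).
Hypotheses (cu : continuous u) (uu : forall p, unitary (u p)) (u0 : forall t, u (0, t) = 1).
Hypotheses (BS : closed_star_subalgebra B) (BI : forall x y, B x -> B (y * x) /\ B (x * y)).
Hypothesis Bu : forall p, B (u p - 1).

(** The constant in front is the one required at a fixed parameter; the decay
    in t makes the errors vanish in the limit. *)
Definition tol (t : R) : R := 256^-1 / (1 + t).

Lemma tol_itv t : 0 <= t -> 0 < tol t <= 256^-1.
Proof.
move=> t0; rewrite /tol; have t1 : 0 < 1 + t by lra.
apply/andP; split; first by rewrite divr_gt0.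
by rewrite ler_pdivrMr//; lra.
Qed.

Lemma tol_le t m : 0 <= t -> t <= m -> tol m <= tol t.
Proof.
move=> t0 tm; rewrite /tol ler_pM2l//.
by rewrite lef_pV2 ?posrE//; lra.
Qed.

(** The number of steps of the partition is about nu t; letting it vary
    continuously makes the partition points vary continuously. *)
Lemma partition_speed : exists nu : R -> R, continuous nu /\ forall t, 0 <= t ->
  0 < nu t /\ forall s s', 0 <= s <= 1 -> `|s - s'| <= (nu t)^-1 ->
    rnorm (u (s, t) - u (s', t)) <= tol t.
Proof.
apply: (@reparametrization _ (fun t T => 0 < T /\ forall s s', 0 <= s <= 1 -> `|s - s'| <= T^-1 ->
    rnorm (u (s, t) - u (s', t)) <= tol t)) => m.
have /andP[e0 _] := tol_itv (ler0n R m).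
have := uniformly_continuous_box m cu e0 => h.
near=> T; move=> t t0 tm; split; first by near: T; exact: nbhs_pinfty_gt.
move=> s s' s01 ss; apply: le_trans (tol_le t0 tm).
by have : forall t, 0 <= t -> t <= m%:R -> forall s s', 0 <= s <= 1 -> `|s - s'| <= T^-1 -> rnorm (u (s, t) - u (s', t)) <= tol m%:R; [near: T|apply].
Unshelve. all: by end_near. Qed.

Lemma near_forall_lt (P : nat -> R -> Prop) :
  (forall k, \forall T \near +oo, P k T) ->
  forall n, \forall T \near +oo, forall k, (k < n)%N -> P k T.
Proof.
move=> hP; elim=> [|n ih]; first by near=> T.
near=> T => k; rewrite ltnS leq_eqVlt => /orP[/eqP ->|kn]; first by near: T.
by move: k kn; near: T.
Unshelve. all: by end_near. Qed.

Lemma central_commutator k z : commutator (a k T) z @[T --> +oo] --> (0 : A).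
Proof.
by have := za k (inl z); rewrite /twisted /=.
Qed.

Lemma central_star_commutator k z : commutator (star (a k T)) z @[T --> +oo] --> (0 : A).
Proof.
by have := central_star (za k) (inl z); rewrite /twisted /=.
Qed.

Lemma central_near w i (e : R) : central alpha w -> 0 < e ->
  \forall T \near +oo, nearly_fixed (twist_map alpha i) (twist_elt i) e (w T).
Proof.
move=> zw e0; have /cvg_rnorm0P/(_ _ e0) h1 := zw i.
have /cvg_rnorm0P/(_ _ e0) h2 := central_star zw i.
near=> T; split; first by apply/ltW; near: T.
by apply/ltW; near: T.
Unshelve. all: by end_near. Qed.

Definition speed_ok (N : R -> nat) (t T : R) :=
  (forall s, 0 <= s <= 1 -> rnorm (commutator (a 0%N T) (u (s, t))) <= tol t /\
     rnorm (commutator (star (a 0%N T)) (u (s, t))) <= tol t) /\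
  (forall i k, i%:R <= t -> (k <= N t)%N ->
     nearly_fixed (twist_map alpha (idx i)) (twist_elt (idx i)) ((1 + t)^-1 / (N t).+1%:R) (a k T) /\
     nearly_fixed (twist_map alpha (idx i)) (twist_elt (idx i)) ((1 + t)^-1 / (N t).+1%:R) (b k T)).

(** This choice comes second: the isometries must be almost fixed to a precision
    that beats the number N t of blocks. *)
Lemma commutation_speed (N : R -> nat) :
  (forall m : nat, exists K : nat, forall t, 0 <= t -> t <= m%:R -> (N t <= K)%N) ->
  exists tau : R -> R, continuous tau /\ forall t, 0 <= t -> speed_ok N t (tau t).
Proof.
move=> bN; apply: (@reparametrization _ (speed_ok N)) => m.
have [K NK] := bN m.
have /andP[e0 _] := tol_itv (ler0n R m).
have a1 T : rnorm (a 0%N T) <= 1 by have [_ _ _ h _] := isometric_pair_ortho (ab T).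
have a1' T : rnorm (star (a 0%N T)) <= 1 by rewrite rnorm_star.
have h1 := uniformly_commuting_box m cu e0 a1 (central_commutator 0).
have h2 := uniformly_commuting_box m cu e0 a1' (central_star_commutator 0).
pose eta : R := (1 + m%:R)^-1 / K.+1%:R.
have m1 : 0 < 1 + m%:R :> R by have := ler0n R m; lra.
have eta0 : 0 < eta by rewrite divr_gt0// invr_gt0.
pose P i k T := nearly_fixed (twist_map alpha (idx i)) (twist_elt (idx i)) eta (a k T) /\
     nearly_fixed (twist_map alpha (idx i)) (twist_elt (idx i)) eta (b k T).
have h3 : \forall T \near +oo, forall i, (i < m.+1)%N -> forall k, (k < K.+1)%N -> P i k T.
  apply: (@near_forall_lt (fun i T => forall k, (k < K.+1)%N -> P i k T)) => i.
  apply: (@near_forall_lt (P i)) => k; near=> T; split; near: T; exact: central_near.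
near=> T; move=> t t0 tm; split.
  move=> s s01; have tt := tol_le t0 tm; split; apply: le_trans tt.
    by move: t t0 tm s s01; near: T.
  by move: t t0 tm s s01; near: T.
move=> i k it kN.
have im : (i < m.+1)%N by rewrite ltnS -(ler_nat R) (le_trans it).
have kK : (k < K.+1)%N by rewrite ltnS (leq_trans kN)// NK.
have ee : eta <= (1 + t)^-1 / (N t).+1%:R.
  apply: ler_pM; rewrite ?invr_ge0 ?(ltW m1)//.
    by rewrite lef_pV2 ?posrE//; lra.
  by rewrite lef_pV2 ?posrE// ler_nat ltnS NK.
have [[p1 p2] [p3 p4]] : P i k T by move: i im {it} k kK {kN}; near: T.
by split; split; apply: le_trans ee.
Unshelve. all: by end_near. Qed.

Definition pos (t : R) : R := Num.max 0 t.

Lemma pos_ge0 t : 0 <= pos t.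
Proof. by rewrite /pos le_max lexx. Qed.

Lemma pos_id t : 0 <= t -> pos t = t.
Proof. by move=> t0; rewrite /pos max_r. Qed.

Lemma max0_lipschitz (p q : R) : `|Num.max 0 p - Num.max 0 q| <= `|p - q|.
Proof.
have h1 := ler_norm (p - q); have := ler_norm (q - p); rewrite distrC => h2.
have h0 := normr_ge0 (p - q).
by case: (leP 0 p) => hp; case: (leP 0 q) => hq; rewrite ler_norml; apply/andP; split; lra.
Qed.

Lemma pos_continuous : continuous pos.
Proof. by move=> t; apply: (@continuous_max R R (cst 0) id); [exact: cvg_cst|exact: cvg_id]. Qed.

Lemma continuous_bounded_nat (nu : R -> R) (m : nat) : continuous nu ->
  exists K : nat, forall t, 0 <= t -> t <= m%:R -> ((Num.trunc (nu t)).+1 <= K)%N.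
Proof.
move=> cnu; have [|c _ hc] := EVT_max (ler0n R m) (f := nu).
  exact: continuous_subspaceT.
exists (Num.trunc (nu c)).+1 => t t0 tm; rewrite ltnS le_truncn//.
by apply: hc; rewrite in_itv /= t0 tm.
Qed.

Lemma truncn_locally_bounded (nu : R -> R) : continuous nu ->
  locally_bounded (fun t => (Num.trunc (nu t)).+1).
Proof.
move=> cnu t; exists (Num.trunc (nu t + 1)).+1.
have /cvgrPdist_lt/(_ _ ltr01) := cnu t; apply: filterS => t'.
rewrite ltr_norml => /andP[h1 h2]; rewrite ltnS le_truncn//; lra.
Qed.

(** The partition points are max 0 (1 - k / nu t); from k = N t on they are 0,
    where u is 1, so that the sums over blocks are locally finite.  All
    functions are extended to negative t by their value at 0. *)
Lemma dynamic_path : exists y : R * R -> A,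
  [/\ continuous y,
      forall t, 0 <= t -> y (0, t) = 1 /\ y (1, t) = u (1, t),
      forall s t, 0 <= s <= 1 -> 0 <= t -> unitary (y (s, t)) /\ B (y (s, t) - 1),
      forall s s' t, 0 <= s <= 1 -> 0 <= s' <= 1 -> 0 <= t ->
        rnorm (y (s, t) - y (s', t)) <= (24 * pi + 1) * `|s - s'| &
      forall i (M e : R), 0 <= M -> 0 < e ->
        (\forall t \near +oo, forall s, 0 <= s <= 1 ->
          rnorm (twist alpha (idx i) (u (s, t))) <= M) ->
        \forall t \near +oo, forall s, 0 <= s <= 1 ->
          rnorm (twist alpha (idx i) (y (s, t))) <= 8 * M + e].
Proof.
have [nu [cnu nuP]] := partition_speed.
pose N0 t := (Num.trunc (nu t)).+1.
have [tau [ctau tauP]] := commutation_speed (fun m => continuous_bounded_nat m cnu).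
pose a' k t := a k (tau (pos t)); pose b' k t := b k (tau (pos t)).
pose sk (k : nat) (t : R) : R := Num.max 0 (1 - k%:R / nu (pos t)).
pose w k t := u (sk k t, pos t).
pose N t := N0 (pos t); pose e t := tol (pos t).
have nu0 t : 0 < nu (pos t) by have [] := nuP _ (pos_ge0 t).
have sk01 k t : 0 <= sk k t <= 1.
  rewrite /sk le_max lexx ge_max ler01 lerBlDr lerDl divr_ge0//; exact: ltW.
have ccomp (V : topologicalType) (f g : R -> R) (h : R -> V) : continuous f -> continuous g ->
    continuous h -> continuous (fun t => h (f (g t))).
  by move=> cf cg ch t; apply: (@continuous_comp _ _ _ (fun t => f (g t)) h);
    [apply: (@continuous_comp _ _ _ g f); [exact: cg|exact: cf]|exact: ch].
have ca' k : continuous (a' k) by exact: (ccomp A tau pos (a k) ctau pos_continuous (@ca k)).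
have cb' k : continuous (b' k) by exact: (ccomp A tau pos (b k) ctau pos_continuous (@cb k)).
have cnup : continuous (fun t => nu (pos t)).
  by move=> t; apply: (@continuous_comp _ _ _ pos nu); [exact: pos_continuous|exact: cnu].
have csk k : continuous (sk k).
  move=> t; apply: (@continuous_max R R (cst 0) (fun t => 1 - k%:R / nu (pos t))).
    exact: cvg_cst.
  apply: cvgB; first exact: cvg_cst.
  apply: cvgM; first exact: cvg_cst.
  by apply: cvgV; [rewrite gt_eqF|exact: cnup].
have cw k : continuous (w k).
  move=> t; apply: (@continuous_comp _ _ _ (fun t => (sk k t, pos t)) u); last exact: cu.
  apply: (@cvg_pair _ _ _ (nbhs t) (nbhs (sk k t)) (nbhs (pos t)) _ _ _ (sk k) pos).
    exact: csk.
  exact: pos_continuous.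
have bN : locally_bounded N.
  by exact: (@truncn_locally_bounded (fun t => nu (pos t)) cnup).
have ab' t : isometric_pair 1 (a'^~ t) (b'^~ t) by exact: ab.
have wN t k : (N t <= k)%N -> w k t = 1.
  move=> Nk; rewrite /w /sk (_ : Num.max _ _ = 0) ?u0//.
  apply/max_idPl; rewrite subr_le0 ler_pdivlMr// mul1r.
  have : nu (pos t) < (N t)%:R by rewrite -truncn_le_nat.
  by move/ltW/le_trans; apply; rewrite ler_nat.
have e01 t : 0 <= e t <= 256^-1.
  by have /andP[h1 h2] := tol_itv (pos_ge0 t); rewrite h2 ltW.
have step t k : rnorm (w k.+1 t - w k t) <= e t.
  have [_ h] := nuP _ (pos_ge0 t); apply: h; first exact: sk01.
  have -> : (nu (pos t))^-1 = `|(1 - k.+1%:R / nu (pos t)) - (1 - k%:R / nu (pos t))|.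
    have -> : (1 - k.+1%:R / nu (pos t)) - (1 - k%:R / nu (pos t)) = - (nu (pos t))^-1.
      by rewrite -[k.+1%:R]natr1; ring.
    by rewrite normrN ger0_norm// invr_ge0 ltW.
  exact: max0_lipschitz.
have comm t k : rnorm (commutator (a' 0%N t) (w k t)) <= e t /\
    rnorm (commutator (star (a' 0%N t)) (w k t)) <= e t.
  by have [h _] := tauP _ (pos_ge0 t); exact: h.
have uw k t : unitary (w k t) by exact: uu.
have e0 t : 0 <= e t by have /andP[] := e01 t.
have e1 t : e t <= 256^-1 by have /andP[] := e01 t.
pose y (p : R * R) := corrected_path (N p.2) (a'^~ p.2) (b'^~ p.2) (w^~ p.2) (clamp p.1).
have w0 t : 0 <= t -> w 0%N t = u (1, t).
  by move=> t0; rewrite /w /sk mul0r subr0 pos_id// max_r.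
exists y; split.
- exact: (continuous_corrected_path ca' cb' cw bN ab' uw wN e01 step comm).
- move=> t t0; rewrite /y /= !clamp_id ?lexx ?ler01//; split.
    exact: corrected_path0.
  rewrite -w0//.
  exact: corrected_path1 (uw^~ t).
- move=> s t s01 t0; rewrite /y /= clamp_id//; split.
    exact: (corrected_path_unitary (ab' t) (uw^~ t) (wN t) (e0 t) (e1 t) (step t) (comm t)).
  apply: (corrected_path_ideal (ab' t) (uw^~ t) (wN t) (e0 t) (e1 t) (step t) (comm t)) => // k.
  exact: Bu.
- move=> s s' t s01 s01' t0; rewrite /y /= !clamp_id//.
  apply: le_trans (corrected_path_lipschitz (ab' t) (uw^~ t) (wN t) (e0 t) (e1 t) (step t) (comm t) s01 s01') _.
  by apply: ler_wpM2r => //; have := e1 t; lra.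
move=> i M d M0 d0 hM.
pose x := twist_elt (idx i); pose C := 192 + rnorm x.
have C0 : 0 < C by have := rnorm_ge0 x; rewrite /C; lra.
near=> t; move=> s s01.
have t0 : 0 <= t by near: t; apply: nbhs_pinfty_ge; exact: num_real.
have it : i%:R <= t by near: t; apply: nbhs_pinfty_ge; exact: num_real.
have Ct : C / d <= t by near: t; apply: nbhs_pinfty_ge; exact: num_real.
have t1 : 0 < 1 + t by lra.
rewrite /y /= clamp_id//.
have wfix k : rnorm (twist alpha (idx i) (w k t)) <= M.
  rewrite /w pos_id//; move: (sk k t) (sk01 k t) => r r01.
  by move: r r01; near: t.
have [_ hfix] := tauP _ t0.
have afix k : (k <= N t)%N ->
    nearly_fixed (twist_map alpha (idx i)) x ((1 + t)^-1 / (N t).+1%:R) (a' k t) /\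
    nearly_fixed (twist_map alpha (idx i)) x ((1 + t)^-1 / (N t).+1%:R) (b' k t).
  by rewrite /N /a' /b' (pos_id t0) => kN; exact: hfix.
apply: (le_trans (twisted_corrected_path (ab' t) (uw^~ t) (wN t) (e0 t) (e1 t) (step t) (comm t)
  (twist_map_star_hom alpha (idx i)) M0 afix wfix s01)).
rewrite divfK ?pnatr_eq0// /e pos_id// /tol -addrA lerD2l -/x.
have -> : 192 * (1 + t)^-1 + 100 * (rnorm x * (256^-1 / (1 + t))) =
  (192 + 100 / 256 * rnorm x) / (1 + t) by ring.
have x0 := rnorm_ge0 x.
rewrite ler_pdivrMr//; move: Ct; rewrite ler_pdivrMr// /C; nra.
Unshelve. all: by end_near. Qed.

End Dynamic.

(** * Upper limits, enumerations, and the proof of the theorem *)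
Section Limsup.
Variables (R : realType) (A : cstarAlgType R).
Implicit Types F H : R -> R -> A.

Definition eventually_le F (M : R) :=
  \forall t \near +oo, forall s, 0 <= s <= 1 -> rnorm (F s t) <= M.

(** Every number above the upper limit of F eventually bounds F, so the
    comparison reduces to eventual bounds at fixed levels. *)
Lemma limsup_sup_le F H (C M0 : R) : 0 <= C -> eventually_le F M0 ->
  (forall M e, 0 <= M -> 0 < e -> eventually_le F M -> eventually_le H (C * M + e)) ->
  (limsup_sup H <= C%:E * limsup_sup F)%E.
Proof.
move=> C0 FM0 FH.
have unitE s : unit_itv s -> 0 <= s <= 1 by rewrite /unit_itv /= in_itv.
have sup_le F' (t M : R) : (forall s, 0 <= s <= 1 -> rnorm (F' s t) <= M) ->
    (ereal_sup [set (rnorm (F' s t))%:E | s in @unit_itv R] <= M%:E)%E.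
  by move=> h; apply: ge_ereal_sup => _ [s /unitE s01 <-]; rewrite lee_fin h.
have limsup_le F' M : eventually_le F' M -> (limsup_sup F' <= M%:E)%E.
  move=> h; pose V := [set t : R | forall s, 0 <= s <= 1 -> rnorm (F' s t) <= M].
  pose g (t : R) := ereal_sup [set (rnorm (F' s t))%:E | s in @unit_itv R].
  apply: (@le_trans _ _ (ereal_sup (g @` V))).
    by apply: ereal_inf_lbound; exists V.
  by apply: ge_ereal_sup => _ [t ht <-]; exact: sup_le.
have L0 : (0 <= limsup_sup F)%E.
  apply: limf_esup_ge0 => [[M [_ hM]]|t].
    by apply: (hM (M + 1)); rewrite ltrDl.
  apply: (@le_trans _ _ (rnorm (F 0 t))%:E); first by rewrite lee_fin rnorm_ge0.
  by apply: ereal_sup_ubound; exists 0 => //; rewrite /unit_itv /= in_itv /= lexx ler01.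
have Lfin := limsup_le _ _ FM0.
have [l lE] : exists l : R, limsup_sup F = l%:E.
  by move: L0 Lfin; case: (limsup_sup F) => [l| |] //; exists l.
rewrite lE lee_fin in L0; rewrite lE -EFinM.
apply/lee_addgt0Pr => e e0; rewrite -EFinD.
have d0 : 0 < e / 2 / (C + 1) by rewrite divr_gt0// ?divr_gt0//; lra.
have e2 : 0 < e / 2 by lra.
set d := e / 2 / (C + 1) in d0.
have Cd : C * d <= e / 2.
  have C1 : 0 < C + 1 by lra.
  by rewrite /d mulrA ler_pdivrMr//; lra.
have : (limsup_sup F < (l + d)%:E)%E by rewrite lE lte_fin ltrDl.
rewrite /limsup_sup /limf_esup => /ereal_inf_lt[_ [V FV <-] hV].
have Fld : eventually_le F (l + d).
  apply: filterS FV => t Vt s s01; rewrite -lee_fin.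
  apply: le_trans (ltW hV).
  apply: (@le_trans _ _ (ereal_sup [set (rnorm (F s t))%:E | s in @unit_itv R])).
    by apply: ereal_sup_ubound; exists s => //; rewrite /unit_itv /= in_itv.
  by apply: ereal_sup_ubound; exists t.
have ld0 : 0 <= l + d by lra.
apply: le_trans (limsup_le _ _ (FH _ _ ld0 e2 Fld)) _.
by rewrite lee_fin mulrDr; lra.
Qed.

End Limsup.

Section Enumeration.

Lemma countable_enumeration (T : choiceType) (z0 : T) (S : set T) : countable S ->
  exists f : nat -> T, forall z, S z -> exists k, f k = z.
Proof.
move=> /countable_injP[f finj].
exists (fun k => xget z0 [set z | S z /\ f z = k]) => z Sz; exists (f z).
case: xgetP => [y _ [Sy fy]|/(_ z)/=]; last by case; split.
by apply: finj => //; rewrite inE.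
Qed.

End Enumeration.

Section Final.
Variables (R : realType) (A : cstarAlgType R) (J : set A) (G : groupType) (alpha : G -> starAut A).

Lemma commutator_regroup (V : zmodType) (p q r s : V) :
  r - s = (p - q) + ((r - p) - (s - q)).
Proof.
by rewrite opprD opprK (addrACA r) [RHS]addrC -(addrA (r - s)) (addrACA (- p)) addNr subrr !addr0.
Qed.

Lemma commutator_dist (w z z' : A) : unitary w ->
  rnorm (commutator w z) <= rnorm (commutator w z') + 2 * rnorm (z - z').
Proof.
move=> uw; have -> : commutator w z = commutator w z' + commutator w (z - z').
  by rewrite /commutator mulrBr mulrBl; exact: commutator_regroup.
apply: (le_trans (rnormD _ _)); rewrite lerD2l.
apply: (le_trans (rnormB _ _)); have := rnormM w (z - z'); have := rnormM (z - z') w.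
by rewrite (unitary_rnorm uw); lra.
Qed.

Lemma unitary_of_ideal_star (x : A) : closed_ideal J -> unitary_of_ideal J x ->
  star_ideal J (x - 1).
Proof.
move=> [_ _ _ JM] [[u1 u2] Jx]; split=> //.
have -> : star (x - 1) = (- star x) * (x - 1).
  by rewrite starB star1 mulrBr mulr1 mulNr u1 opprK addrC.
exact: (JM _ _ Jx).1.
Qed.

Lemma clamped_continuous (x : R -> R -> A) :
  {within @unit_itv R `*` @halfline R, continuous (fun p : R * R => x p.1 p.2)} ->
  continuous (fun p : R * R => x (clamp p.1) (pos p.2)).
Proof.
move=> cx.
have cg : continuous (fun p : R * R => (clamp p.1, pos p.2)).
  have c1 : continuous (fun p : R * R => clamp p.1).
    by move=> p; apply: (@continuous_comp _ _ _ fst (@clamp R)); [exact: cvg_fst|exact: clamp_continuous].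
  have c2 : continuous (fun p : R * R => pos p.2).
    by move=> p; apply: (@continuous_comp _ _ _ snd (@pos R)); [exact: cvg_snd|exact: pos_continuous].
  move=> p; apply: (@cvg_pair _ _ _ (nbhs p) (nbhs (clamp p.1)) (nbhs (pos p.2)) _ _ _
    (fun p => clamp p.1) (fun p => pos p.2)); [exact: c1|exact: c2].
apply: (continuous_comp_within cx cg).
move=> p; split; rewrite /= /unit_itv /halfline /= in_itv /= ?clamp_in//.
by rewrite andbT pos_ge0.
Qed.

Lemma shift_isometries_central (s0 s1 : R -> A) :
  (forall t, [/\ star (s0 t) * s0 t = 1, star (s1 t) * s1 t = 1 & star (s0 t) * s1 t = 0]) ->
  continuous s0 -> continuous s1 -> central alpha s0 -> central alpha s1 ->
  exists a b : nat -> R -> A,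
  [/\ forall k, continuous (a k), forall k, continuous (b k),
      forall t, isometric_pair 1 (a^~ t) (b^~ t) &
      forall k, central alpha (a k) /\ central alpha (b k)].
Proof.
move=> sP c0 c1 z0 z1.
have n0 t : rnorm (s0 t) <= 1 by have [/isometry_rnorm] := sP t.
have n1 t : rnorm (s1 t) <= 1 by have [_ /isometry_rnorm] := sP t.
have nM (y z : A) : rnorm y <= 1 -> rnorm z <= 1 -> rnorm (y * z) <= 1.
  move=> y1 z1'; apply: (le_trans (rnormM _ _)); rewrite -[1]mul1r.
  by apply: ler_pM => //; exact: rnorm_ge0.
have pk k : [/\ continuous (fun t => s1 t ^+ k), central alpha (fun t => s1 t ^+ k) &
    forall t, rnorm (s1 t ^+ k) <= 1].
  elim: k => [|k [ck zk nk]].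
    split; [exact: continuous_cstA|exact: central1|by move=> t; rewrite expr0 rnorm1].
  split.
  - rewrite (_ : (fun t => s1 t ^+ k.+1) = (fun t => s1 t * s1 t ^+ k)).
      exact: continuous_mulA.
    by apply/funext => t; rewrite exprS.
  - rewrite (_ : (fun t => s1 t ^+ k.+1) = (fun t => s1 t * s1 t ^+ k)).
      exact: central_mul.
    by apply/funext => t; rewrite exprS.
  - by move=> t; rewrite exprS; exact: nM.
exists (fun k t => s1 t ^+ k * s0 t * s0 t), (fun k t => s1 t ^+ k * s0 t * s1 t); split.
- by move=> k; have [ck _ _] := pk k; apply: continuous_mulA => //; exact: continuous_mulA.
- by move=> k; have [ck _ _] := pk k; apply: continuous_mulA => //; exact: continuous_mulA.
- by move=> t; have [h0 h1 h01] := sP t; exact: isometric_pair_shift.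
- move=> k; have [_ zk nk] := pk k.
  have zk0 : central alpha (fun t => s1 t ^+ k * s0 t) by exact: central_mul.
  by split; apply: central_mul => // t; exact: nM.
Qed.

End Final.

Section MainEstimate.
Variables (R : realType) (A : cstarAlgType R) (J : set A) (G : groupType) (alpha : G -> starAut A).
Variables (x : R -> R -> A).
Hypotheses (idJ : closed_ideal J) (cuntz : contains_cuntz_infty (Aflat_fixed alpha)).
Hypothesis xUJ : continuous_into (unitary_of_ideal J) x.

Lemma dense_near (D : set A) (a : A) (e : R) : dense D -> 0 < e ->
  exists2 z, D z & rnorm (a - z) < e.
Proof.
move=> dD e0; have ce : 0 < e%:C by rewrite ltcR.
have nb : nbhs a (ball a e%:C) by exact: nbhsx_ballx.
have [|z [zO zD]] := dD ((ball a e%:C)^°) _ (open_interior _).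
  by exists a; exact: nb.
exists z => //; have := interior_subset zO.
by rewrite -ball_normE /= rnormE ltcR.
Qed.

Lemma star_ideal_unitaryM (v w : A) :
  star_ideal J (v - 1) -> star_ideal J (w - 1) -> star_ideal J (v * w - 1).
Proof.
move=> Jv Jw; have [_ BD _ _ _] := star_ideal_subalgebra idJ.
have -> : v * w - 1 = (v - 1) * w + (w - 1) by rewrite mulrBl mul1r addrA subrK.
by apply: BD => //; exact: (star_idealM _ idJ Jv).2.
Qed.

(** The commutators of u = x(s,t) x(0,t)^* are at most twice those of x; the path
    for u multiplies them by 8, and the final factor x(0,t) adds 1:
    17 = 2 * 8 + 1. *)
Lemma lipschitz_path (idx : nat -> A + G) : exists y : R -> R -> A,
  [/\ continuous_into (unitary_of_ideal J) y,
      forall t, 0 <= t -> y 0 t = x 0 t /\ y 1 t = x 1 t,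
      forall s s' t, 0 <= s <= 1 -> 0 <= s' <= 1 -> 0 <= t ->
        rnorm (y s t - y s' t) <= (24 * pi + 1) * `|s - s'| &
      forall i (M e : R), 0 <= M -> 0 < e ->
        eventually_le (fun s t => twist alpha (idx i) (x s t)) M ->
        eventually_le (fun s t => twist alpha (idx i) (y s t)) (17 * M + e)].
Proof.
have [s0 [s1 [cs0 cs1 sP [zs0 zs1]]]] := central_isometries cuntz.
have [a [b [ca cb ab zab]]] := shift_isometries_central sP cs0 cs1 zs0 zs1.
have [cx xJ] := xUJ.
pose X (p : R * R) := x (clamp p.1) (pos p.2).
have cX : continuous X by exact: clamped_continuous.
have XJ p : unitary_of_ideal J (X p).
  apply: xJ; rewrite /unit_itv /halfline /= in_itv /= ?clamp_in//.
  by rewrite andbT pos_ge0.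
have uX p : unitary (X p) by have [] := XJ p.
have cX0 : continuous (fun p : R * R => X (0, p.2)).
  move=> p; apply: (@continuous_comp _ _ _ (fun p : R * R => ((0 : R), p.2)) X); last exact: cX.
  apply: (@cvg_pair _ _ _ (nbhs p) (nbhs (0 : R)) (nbhs p.2) _ _ _ (fun=> (0 : R)) snd).
    exact: cvg_cst.
  exact: cvg_snd.
pose u (p : R * R) := X p * star (X (0, p.2)).
have cu : continuous u by apply: continuous_mulA => //; exact: continuous_starA.
have uu p : unitary (u p) by apply: unitaryM => //; exact: unitary_star.
have u0 t : u (0, t) = 1 by rewrite /u /=; have [] := uX (0, t).
have BX p : star_ideal J (X p - 1) by exact: unitary_of_ideal_star.
have Bu p : star_ideal J (u p - 1).
  apply: star_ideal_unitaryM => //.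
  by have [J1 J2] := BX (0, p.2); split; rewrite ?starB ?star1 ?starK in J1 J2 *.
have BS := star_ideal_subalgebra idJ.
have BI (z y : A) : star_ideal J z -> star_ideal J (y * z) /\ star_ideal J (z * y).
  exact: star_idealM.
have [y0 [cy0 y0e y0u y0L y0t]] := dynamic_path idx ca cb ab (fun k => (zab k).1) (fun k => (zab k).2)
  cu uu u0 BS BI Bu.
have Xx s t : 0 <= s <= 1 -> 0 <= t -> X (s, t) = x s t.
  by move=> s01 t0; rewrite /X /= clamp_id// pos_id.
have i0 : 0 <= (0 : R) <= 1 by rewrite lexx ler01.
have i1 : 0 <= (1 : R) <= 1 by rewrite lexx ler01.
exists (fun s t => y0 (s, t) * X (0, t)); split.
- split.
    apply: continuous_subspaceT.
    have -> : (fun p : R * R => y0 (p.1, p.2) * X (0, p.2)) = (fun p : R * R => y0 p * X (0, p.2)).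
      by apply/funext => -[].
    exact: continuous_mulA.
  move=> s t; rewrite /unit_itv /halfline /= !in_itv /= andbT => s01 t0.
  have [yu yB] := y0u s t s01 t0; split; first exact: unitaryM.
  by have [] := star_ideal_unitaryM yB (BX (0, t)).
- move=> t t0; have [-> ->] := y0e t t0; rewrite mul1r Xx//; split=> //.
  by rewrite /u /= -mulrA (Xx 0)// (Xx 1)// -(Xx 0 t)// (uX (0, t)).1 mulr1.
- move=> s s' t s01 s01' t0; rewrite -mulrBl; apply: (le_trans (rnormM _ _)).
  by rewrite (unitary_rnorm (uX _)) mulr1; exact: y0L.
move=> i M e M0 e0 hM.
have fH := twist_map_star_hom alpha (idx i).
have tu (v w : A) : unitary v -> unitary w ->
    rnorm (twist alpha (idx i) (v * w)) <= rnorm (twist alpha (idx i) v) + rnorm (twist alpha (idx i) w).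
  by move=> uv uw; apply: rnorm_twistedM => //; rewrite unitary_rnorm.
have h1 : \forall t \near +oo, forall s, 0 <= s <= 1 -> rnorm (twist alpha (idx i) (u (s, t))) <= 2 * M.
  near=> t; move=> s s01.
  have t0 : 0 <= t by near: t; apply: nbhs_pinfty_ge; exact: num_real.
  have hx r : 0 <= r <= 1 -> rnorm (twist alpha (idx i) (x r t)) <= M by move: r; near: t.
  rewrite /u /= !Xx//.
  have ux r : 0 <= r <= 1 -> unitary (x r t) by move=> r01; rewrite -Xx.
  apply: (le_trans (tu _ _ (ux _ s01) (unitary_star (ux _ i0)))).
  have := rnorm_twisted_star (twist_elt (idx i)) fH (ux _ i0).
  have := hx _ s01; have := hx _ i0; lra.
have MM0 : 0 <= 2 * M by rewrite mulr_ge0.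
have h2 := y0t i (2 * M) e MM0 e0 h1.
near=> t; move=> s s01.
have t0 : 0 <= t by near: t; apply: nbhs_pinfty_ge; exact: num_real.
have hx r : 0 <= r <= 1 -> rnorm (twist alpha (idx i) (x r t)) <= M by move: r; near: t.
have hy r : 0 <= r <= 1 -> rnorm (twist alpha (idx i) (y0 (r, t))) <= 8 * (2 * M) + e by move: r; near: t.
apply: (le_trans (tu _ _ (y0u _ _ s01 t0).1 (uX _))).
have := hx _ i0; rewrite Xx//; have := hy _ s01; lra.
Unshelve. all: by end_near. Qed.

End MainEstimate.

Local Close Scope complex_scope.

Theorem theorem5p5 (R : realType) (A : cstarAlgType R) (J : set A)
    (G : groupType) (alpha : G -> starAut A) (u : G -> G -> A)
    (sepA : separable_space A) (idJ : closed_ideal J)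
    (countG : countable [set: G]) (act : cocycle_action alpha u)
    (cuntz : contains_cuntz_infty (Aflat_fixed alpha))
    (x : R -> R -> A) (xUJ : continuous_into (unitary_of_ideal J) x) :
  exists y : R -> R -> A,
    [/\ continuous_into (unitary_of_ideal J) y,
        forall t : R, 0 <= t ->
          [/\ y 0 t = x 0 t, y 1 t = x 1 t &
              (Lip (fun s => y s t) < (25%:R * pi)%:E)%E],
        forall a : A,
          (limsup_sup (fun s t => commutator (y s t) a) <=
           243%:R%:E * limsup_sup (fun s t => commutator (x s t) a))%E &
        forall g : G,
          (limsup_sup (fun s t => (alpha g (y s t) - y s t)%R) <=
           243%:R%:E * limsup_sup (fun s t => (alpha g (x s t) - x s t)%R))%E].
Proof.
have [D [countD denseD]] := sepA.
have [fa fa_surj] := countable_enumeration 0 countD.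
have [fg fg_surj] := countable_enumeration 1%g countG.
(* Even indices enumerate a dense sequence, odd ones the group. *)
pose idx (k : nat) : A + G := if odd k then inr (fg k./2) else inl (fa k./2).
have [y [yUJ ye yL yt]] := lipschitz_path idJ cuntz xUJ idx.
have itv0 (s : R) : unit_itv s -> 0 <= s <= 1 by rewrite /unit_itv /= in_itv.
have [_ xJ] := xUJ; have [_ yJ] := yUJ.
have inJ (s t : R) : 0 <= s <= 1 -> 0 <= t -> unit_itv s /\ halfline t.
  by move=> s01 t0; rewrite /unit_itv /halfline /= !in_itv /= s01 t0.
have ux (s t : R) : 0 <= s <= 1 -> 0 <= t -> unitary (x s t).
  by move=> s01 t0; have [s1 t1] := inJ s t s01 t0; have [] := xJ s t s1 t1.
have uy (s t : R) : 0 <= s <= 1 -> 0 <= t -> unitary (y s t).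
  by move=> s01 t0; have [s1 t1] := inJ s t s01 t0; have [] := yJ s t s1 t1.
exists y; split => //.
- move=> t t0; have [y0 y1] := ye t t0; split => //.
  apply: (@le_lt_trans _ _ (24 * pi + 1)%:E); last first.
    by rewrite lte_fin; have := pi_ge2 R; lra.
  apply: ge_ereal_sup => _ [s [s' [/itv0 s01 /itv0 s01' ss ->]]].
  rewrite lee_fin ler_pdivrMr ?normr_gt0 ?subr_eq0//; exact: yL.
- move=> a; apply: (@limsup_sup_le _ _ _ _ _ (2 * rnorm a)) => //.
    near=> t => s s01; have t0 : 0 <= t by near: t; apply: nbhs_pinfty_ge; exact: num_real.
    apply: (le_trans (rnormB _ _)).
    have := rnormM (x s t) a; have := rnormM a (x s t).
    by rewrite (unitary_rnorm (ux _ _ s01 t0)); lra.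
  move=> M e M0 e0 hM.
  (* Replacing a by z changes each commutator by at most e / 40. *)
  have e1 : 0 < e / 80 by lra.
  have [z Dz az] := dense_near a denseD e1.
  have [k fk] := fa_surj z Dz.
  have idxE : idx k.*2 = inl z by rewrite /idx odd_double doubleK fk.
  have tE (w : A) : twist alpha (idx k.*2) w = commutator w z by rewrite idxE.
  have hx : eventually_le (fun s t => twist alpha (idx k.*2) (x s t)) (M + e / 40).
    near=> t => s s01; have t0 : 0 <= t by near: t; apply: nbhs_pinfty_ge; exact: num_real.
    rewrite tE; apply: (le_trans (commutator_dist z a (ux _ _ s01 t0))).
    have : rnorm (commutator (x s t) a) <= M by move: s s01; near: t.
    by rewrite rnormBC; lra.
  have M1 : 0 <= M + e / 40 by lra.
  have e2 : 0 < e / 40 by lra.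
  have hy := yt _ _ _ M1 e2 hx.
  near=> t => s s01; have t0 : 0 <= t by near: t; apply: nbhs_pinfty_ge; exact: num_real.
  apply: (le_trans (commutator_dist a z (uy _ _ s01 t0))).
  have : rnorm (twist alpha (idx k.*2) (y s t)) <= 17 * (M + e / 40) + e / 40.
    by move: s s01; near: t.
  rewrite tE; lra.
- move=> g; apply: (@limsup_sup_le _ _ _ _ _ 2) => //.
    near=> t => s s01; have t0 : 0 <= t by near: t; apply: nbhs_pinfty_ge; exact: num_real.
    apply: (le_trans (rnormB _ _)); have := rnorm_star_hom (aut_star_hom (alpha g)) (x s t).
    by rewrite (unitary_rnorm (ux _ _ s01 t0)); lra.
  move=> M e M0 e0 hM.
  have [k fk] := fg_surj g Logic.I.
  have tE (w : A) : twist alpha (idx k.*2.+1) w = alpha g w - w.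
    by rewrite /idx /= odd_double /= uphalf_double fk /twisted /= mulr1 mul1r.
  have hx : eventually_le (fun s t => twist alpha (idx k.*2.+1) (x s t)) M.
    by apply: filterS hM => t h s s01; rewrite tE; exact: h.
  apply: filterS (yt _ _ _ M0 e0 hx) => t h s s01.
  by have := h s s01; rewrite tE; lra.
Unshelve. all: by end_near. Qed.
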